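(* Let $X_1,X_2,\dots$ be i.i.d. real-valued random variables with common distribution function $F$, and for each $n\ge 1$ let $X_{1:n}\le\dots\le X_{n:n}$ be the order statistics of $X_1,\dots,X_n$. Let $k_n,m_n$ be integers with $0\le k_n<n-m_n\le n$, put $\alpha_n=k_n/n$, $\beta_n=m_n/n$, and assume $\alpha_n\to\alpha$, $\beta_n\to\beta$ with $0<\alpha<1-\beta<1$. For real weights $c_{i,n}$ define the trimmed $L$-statistic $$L_n=n^{-1}\sum_{i=k_n+1}^{n-m_n}c_{i,n}X_{i:n}.$$ Suppose: (ii) there exists $\varepsilon>0$ such that for each $t\in\mathbb{R}$, as $n\to\infty$, $$F^{-1}\bigl(\alpha+t\sqrt{\log n/n}\bigr)-F^{-1}(\alpha)=O\bigl((\log n)^{-(1+\varepsilon)}\bigr),\qquad F^{-1}\bigl(1-\beta+t\sqrt{\log n/n}\bigr)-F^{-1}(1-\beta)=O\bigl((\log n)^{-(1+\varepsilon)}\bigr);$$ (iii) $\max(|\alpha_n-\alpha|,|\beta_n-\beta|)=O\bigl(\sqrt{\log n/n}\bigr)$ as $n\to\infty$; and assume there is a function $J$, defined on an open set $I$ with $[\alpha,1-\beta]\subset I\subseteq(0,1)$, such that (i) $J$ is Lipschitz on $I$: there is $C\ge0$ with $|J(u)-J(v)|\le C|u-v|$ for all $u,v\in I$; (iv) with $c^0_{i,n}=n\int_{(i-1)/n}^{i/n}J(u)\,du$, there is $\tilde\varepsilon>0$ such that $$\sum_{i=k_n+1}^{n-m_n}|c_{i,n}-c^0_{i,n}|=O\Bigl(\frac{1}{(\log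 n)^{\tilde\varepsilon}}\sqrt{\frac{n}{\log n}}\Bigr)\quad (n\to\infty).$$ Let $\mu_n=\int_{\alpha_n}^{1-\beta_n}J(u)F^{-1}(u)\,du$, let $$\sigma^2=\int_\alpha^{1-\beta}\int_\alpha^{1-\beta}J(u)J(v)(u\wedge v-uv)\,dF^{-1}(u)\,dF^{-1}(v),$$ assumed to satisfy $\sigma>0$, and let $F_{L_n}(x)=\mathbf{P}\{\sqrt n(L_n-\mu_n)/\sigma\le x\}$. Then for each $c>0$ and $A>0$, $$1-F_{L_n}(x)=[1-\Phi(x)](1+o(1)),\qquad F_{L_n}(-x)=\Phi(-x)(1+o(1))$$ as $n\to\infty$, uniformly in the range $-A\le x\le c\sqrt{\log n}$, where $\Phi$ is the standard normal distribution function.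
   Context: $F^{-1}$ denotes the left-continuous inverse $F^{-1}(u)=\inf\{x:F(x)\ge u\}$ for $0<u\le1$, with $F^{-1}(0)=F^{-1}(0^+)$. Integrals with respect to the left-continuous integrator $F^{-1}$ are taken over half-open intervals: $\int_a^b=\int_{[a,b)}$. $u\wedge v=\min(u,v)$. The quantities $\mu_n$ are well defined for all sufficiently large $n$ since $\alpha_n\to\alpha$, $\beta_n\to\beta$. *)

(* Defs.v *)
From HB Require Import structures.
From mathcomp Require Import all_boot all_order all_algebra.
From mathcomp Require Import all_classical all_reals all_analysis.
Set Implicit Arguments. Unset Strict Implicit. Unset Printing Implicit Defensive.
Import Order.TTheory GRing.Theory Num.Theory.
Import numFieldNormedType.Exports.
Local Open Scope classical_set_scope.
Local Open Scope ring_scope.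

Section defs.
Context {R : realType}.

(* Mutual independence of the sequence X 0, X 1, ... (0-based; X i is the
   paper's X_{i+1}): product rule for every initial segment and all Borel sets
   (taking B i = setT gives every finite subfamily). *)
Definition mutually_independent {d} {T : measurableType d}
  (P : probability T R) (X : nat -> T -> R) : Prop :=
  forall (n : nat) (B : nat -> set R), (forall i, (i < n)%N -> measurable (B i)) ->
    P (\bigcap_(i in `I_n) (X i @^-1` B i)) = (\prod_(i < n) P (X i @^-1` B i))%E.

Definition common_cdf {d} {T : measurableType d}
  (P : probability T R) (X : nat -> T -> R) (F : R -> R) : Prop :=
  forall i x, F x = fine (P [set w | X i w <= x]).

(* Left-continuous inverse F^{-1}(u) = inf {x : F x >= u} (relevant for 0<u<1). *)
Definition Finv (F : R -> R) (u : R) : R := inf [set x | u <= F x].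

Definition ostat {T : Type} (X : nat -> T -> R) (n i : nat) (w : T) : R :=
  nth 0 (sort (<=%O : rel R) [seq X j w | j <- iota 0 n]) i.-1.

Definition Lstat {T : Type} (X : nat -> T -> R) (c : nat -> nat -> R)
  (k m : nat -> nat) (n : nat) (w : T) : R :=
  n%:R^-1 * \sum_(k n + 1 <= i < (n - m n).+1) c i n * ostat X n i w.

Definition c0 (J : R -> R) (i n : nat) : R :=
  n%:R * Rintegral lebesgue_measure `[i.-1%:R / n%:R, i%:R / n%:R] J.

Definition mu_n (J F : R -> R) (k m : nat -> nat) (n : nat) : R :=
  Rintegral lebesgue_measure `[(k n)%:R / n%:R, 1 - (m n)%:R / n%:R]
    (fun u => J u * Finv F u).

(* sigma^2 = int_[a,b) int_[a,b) J(u)J(v)(u /\ v - uv) dF^{-1}(u) dF^{-1}(v),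
   nu being the Lebesgue-Stieltjes measure of F^{-1}. *)
Definition sigma2 (nu : {measure set R -> \bar R}) (J : R -> R) (a b : R) : R :=
  Rintegral nu `[a, b[ (fun v =>
    Rintegral nu `[a, b[ (fun u => J u * J v * (Order.min u v - u * v))).

Definition Phi (x : R) : R := fine (normal_prob 0 1 `]-oo, x]).

Definition FLn {d} {T : measurableType d} (P : probability T R)
  (X : nat -> T -> R) (c : nat -> nat -> R) (k m : nat -> nat)
  (J F : R -> R) (sigma : R) (n : nat) (x : R) : R :=
  fine (P [set w | Num.sqrt n%:R * (Lstat X c k m n w - mu_n J F k m n) / sigma <= x]).

End defs.

(* Main.v *)
(**
Linearization. Let H be a primitive of J, F_n the empirical distribution function, Q = F^{-1}.
By the layer-cake formula both mu_n and L_n (with c^0 in place of c) are integrals over x of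
H(b) - H(clamp a b G(x)), with a = alpha_n, b = 1 - beta_n, and G = F, respectively G = F_n.
A second-order expansion of H shows that L_n - mu_n is the mean of the bounded centred i.i.d.
variables psi(X_i), psi(z) = - int_[Q(alpha), Q(1-beta)) J(F(x)) (1{z <= x} - F(x)) dx, up to
an error which is controlled deterministically by (i)-(iv) on the event
sup |F_n - F| <= t sqrt(log n / n); times sqrt n it is o(1 / sqrt(log n)). The variance of
psi(X_1) is sigma^2, the image of Lebesgue measure under F being dF^{-1}. By Hoeffding's bound at the
quantiles of order j/n, the event fails with probability at most 4 n^{-M}, with M as large
as we please for t large, which is negligible against 1 - Phi(x) on the range considered.

Moderate deviations. For sums of bounded i.i.d. variables, Lindeberg's replacement is applied
to the smoothed indicator u |-> Phi((u - x) / sqrt s). Its derivatives are bounded by an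
exponential exp(h (u - x) + h^2 s / 2) which, integrated against the moment generating function of
the partial sums with h = x, makes every replacement error of order exp(- x^2 / 2) times a power of
n^{-1/2}, so that it is small relative to 1 - Phi(x).

Finally 1 - Phi varies by a factor 1 + o(1) on a window of width o(1 / sqrt(log n)).
*)
Require Import Defs.
From HB Require Import structures.
From mathcomp Require Import all_boot all_order all_algebra.
From mathcomp Require Import all_classical all_reals all_analysis.
From mathcomp Require Import measurable_realfun ring lra.
Set Implicit Arguments. Unset Strict Implicit. Unset Printing Implicit Defensive.
Import Order.TTheory GRing.Theory Num.Theory.
Import numFieldNormedType.Exports.
Local Open Scope classical_set_scope.
Local Open Scope ring_scope.

(** * The normal tail *)

(** At the upper end of the range [1 - Phi x] is as small as a power of [1 / n], so every error has
    to be measured relative to the tail; an additive bound of Berry-Esseen type would be useless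
    there. Smoothing with variance [e2] costs a factor [e2 ^- 2]. With [L] the square root of
    [ln n], taking [e2 = L^-8] turns this cost into a power of [L], absorbed by
    [n^(-1/2) = exp (- L^2 / 2)]; the smoothing width [L^-4], taken a multiple of [L] times, is
    still [o(1 / L)]. No moment of the [X i] is assumed: psi is bounded because it integrates over a
    bounded interval, and on the good event the order statistics kept by the trimming lie between
    two quantiles. Condition (ii) acts where the linearization breaks down, on strips of levels of
    width of order [sqrt (ln n / n)] around [alpha] and [1 - beta]; the length of such a strip in
    [x] is a quantile increment, and [sqrt n * sqrt (ln n / n) * (ln n)^(-1 - eps) = (ln n)^(-1/2 -
    eps)]. Condition (iv) yields [(ln n)^(-1/2 - eps')] in the same way. The lower tail is the upper
    tail of the sums of [- psi]. *)

Section taylor.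
Context {R : realType}.
Implicit Types f : R -> R.

Lemma mvt_abs (f df : R -> R) (y : R) :
  (forall x : R, is_derive x 1 f (df x)) ->
  exists2 c, `|c| <= `|y| & f y - f 0 = df c * y.
Proof.
move=> fdf; have cf a b : {within `[a, b], continuous f}.
  apply/continuous_subspaceT => r.
  exact/differentiable_continuous/derivable1_diffP.
have [y0|y0] := leP 0 y.
  have [c cy E] := MVT_segment y0 (fun x _ => fdf x) (cf _ _).
  exists c; last by rewrite E subr0.
  by move: cy; rewrite in_itv/= => /andP[c0 cy]; rewrite !ger0_norm.
have [c cy E] := MVT_segment (ltW y0) (fun x _ => fdf x) (cf _ _).
exists c; last by rewrite -opprB E sub0r mulrN opprK.
by move: cy; rewrite in_itv/= => /andP[cy c0]; rewrite ler0_norm// ltr0_norm// lerN2.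
Qed.

(** Three nested mean-value steps, each worth one factor [|y|]; the sharp constant 1/6 is given up,
    as constants are absorbed later. *)
Lemma taylor3 (f f1 f2 f3 : R -> R) (y M : R) :
  (forall x : R, is_derive x 1 f (f1 x)) -> (forall x : R, is_derive x 1 f1 (f2 x)) ->
  (forall x : R, is_derive x 1 f2 (f3 x)) ->
  (forall t, `|t| <= `|y| -> `|f3 t| <= M) ->
  `|f y - f 0 - y * f1 0 - y ^+ 2 / 2 * f2 0| <= M * `|y| ^+ 3.
Proof.
move=> d1 d2 d3 f3M.
have M0 : 0 <= M by apply: le_trans (f3M 0 _); rewrite ?normr0.
pose h x := f x - f 0 - x * f1 0 - x ^+ 2 / 2 * f2 0.
have dh (x : R) : is_derive x 1 h (f1 x - f1 0 - x * f2 0).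
  rewrite /h; apply: is_derive_eq.
  by rewrite /GRing.scale/= ; field.
pose h1 x := f1 x - f1 0 - x * f2 0.
have dh1 (x : R) : is_derive x 1 h1 (f2 x - f2 0).
  rewrite /h1; apply: is_derive_eq.
  by rewrite /GRing.scale/= ; ring.
have e2 t : `|t| <= `|y| -> `|f2 t - f2 0| <= M * `|y|.
  move=> ty; have [c ct ->] := mvt_abs t d3.
  by rewrite normrM ler_pM// f3M// (le_trans ct).
have e1 t : `|t| <= `|y| -> `|h1 t| <= M * `|y| * `|y|.
  move=> ty; have [c ct] := mvt_abs t dh1.
  have -> : h1 0 = 0 by rewrite /h1; ring.
  by rewrite subr0 => ->; rewrite normrM ler_pM// e2// (le_trans ct).
have [c cy] := mvt_abs y dh.
have -> : h 0 = 0 by rewrite /h; ring.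
rewrite subr0 -/(h y) => ->; rewrite normrM.
by apply: le_trans (ler_wpM2r _ (e1 c cy)) _; rewrite // !exprS expr0 mulr1 !mulrA.
Qed.

(** One-sided because it is applied to the time variable of [heat], where the derivative formulas
    hold for positive times only. *)
Lemma taylor2_right (f f1 f2 : R -> R) (s t M : R) : 0 <= t ->
  (forall x : R, s <= x -> is_derive x 1 f (f1 x)) ->
  (forall x : R, s <= x -> is_derive x 1 f1 (f2 x)) ->
  (forall x, s <= x <= s + t -> `|f2 x| <= M) ->
  `|f (s + t) - f s - t * f1 s| <= M * t ^+ 2.
Proof.
move=> t0 d1 d2 f2M.
have st : s <= s + t by rewrite lerDl.
have [|c0|c /[!in_itv]/= /andP[c1 c2] E] := @MVT_segment _ f f1 s (s + t) st.
- by move=> x /[!in_itv]/= /andP[/ltW sx _]; exact: d1.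
- apply: derivable_within_continuous => x /[!in_itv]/= /andP[sx _].
  by have [] := d1 _ sx.
have [|c0|c' /[!in_itv]/= /andP[c1' c2'] E'] := @MVT_segment _ f1 f2 s c c1.
- by move=> x /[!in_itv]/= /andP[/ltW sx _]; exact: d2.
- apply: derivable_within_continuous => x /[!in_itv]/= /andP[sx _].
  by have [] := d2 _ sx.
have -> : f (s + t) - f s - t * f1 s = f2 c' * ((c - s) * t).
  by rewrite E mulrA -E'; ring.
rewrite normrM ler_pM//; first by apply: f2M; rewrite c1'/= (le_trans c2').
have cs : 0 <= c - s by rewrite subr_ge0.
rewrite ger0_norm ?mulr_ge0// expr2 ler_wpM2r//.
by rewrite lerBlDl.
Qed.

End taylor.

Section normal_tail.
Context {R : realType}.
Implicit Types x y t a z w u : R.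

Definition gpdf x : R := normal_peak 1 * expR (- (x ^+ 2) / 2).

Lemma gpdfE : normal_pdf 0 1 = gpdf.
Proof.
apply/funext => x; rewrite normal_pdfE ?oner_neq0//= /normal_fun /gpdf.
by rewrite subr0 expr1n mulr2n.
Qed.

Lemma gpdf_gt0 x : 0 < gpdf x.
Proof. by rewrite mulr_gt0 ?expR_gt0 ?normal_peak_gt0// oner_neq0. Qed.

Lemma gpdf_le x : gpdf x <= expR (- (x ^+ 2) / 2).
Proof.
rewrite ler_piMl ?expR_ge0// /normal_peak invf_le1 ?sqrtr_gt0; last first.
  by rewrite expr1n mul1r pmulrn_lgt0 ?pi_gt0.
rewrite -[leLHS]sqrtr1 ler_wsqrtr// expr1n mul1r.
have := pi_ge2 R; rewrite mulr2n; lra.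
Qed.

Lemma is_derive_gpdf x : is_derive x 1 gpdf (- x * gpdf x).
Proof.
rewrite /gpdf.
have -> : (fun x : R => normal_peak 1 * expR (- x ^+ 2 / 2)) =
  (normal_peak 1 \*: (expR \o (fun x : R => - x ^+ 2 / 2))) by [].
apply: is_derive_eq.
by rewrite /GRing.scale/=; field.
Qed.

Lemma is_derive_Phi x : is_derive x 1 Phi (gpdf x).
Proof.
have [||||D E] := @continuous_FTC1 R (normal_pdf 0 1) (BInfty _ true) x (x + 1).
- by rewrite ltrDl.
- by apply: integrableS (integrable_normal_pdf _ _) => //.
- by rewrite ltNyr.
- exact/continuous_normal_pdf/oner_neq0.
have -> : Phi = (fun y => \int[lebesgue_measure]_(t in `]-oo, y]) normal_pdf 0 1 t) by [].
by apply: DeriveDef => //; rewrite -derive1E E gpdfE.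
Qed.

Let idRV : measurableTypeR R -> R := idfun.

HB.instance Definition _ :=
  @isMeasurableFun.Build _ _ _ _ idRV (@measurable_id _ _ setT).

Let PhiE y : (Phi y)%:E = cdf (idRV : {RV (normal_prob 0 1 : probability _ R) >-> R}) y.
Proof. by rewrite fineK//; exact: fin_num_measure. Qed.

Lemma Phi_ge0 y : 0 <= Phi y :> R.
Proof. by rewrite -lee_fin PhiE cdf_ge0. Qed.

Lemma Phi_le1 y : Phi y <= 1 :> R.
Proof. by rewrite -lee_fin PhiE cdf_le1. Qed.

Lemma Phi_nondecreasing : {homo (@Phi R) : x y / x <= y}.
Proof. by move=> x y xy; rewrite -lee_fin !PhiE cdf_nondecreasing. Qed.

Lemma Phi_cvgy : Phi y @[y --> +oo] --> (1 : R).
Proof.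
have /fine_cvgP[_] := cvg_cdfy1 (idRV : {RV (normal_prob 0 1 : probability _ R) >-> R}).
exact.
Qed.

Lemma Phi_cvgNy : Phi y @[y --> -oo] --> (0 : R).
Proof.
have /fine_cvgP[_] := cvg_cdfNy0 (idRV : {RV (normal_prob 0 1 : probability _ R) >-> R}).
exact.
Qed.

(** The density is even, so [Phi y + Phi (- y)] has zero derivative; its constant value is read off
    at infinity. *)
Lemma PhiN x : Phi (- x) = 1 - Phi x :> R.
Proof.
pose g y : R := Phi y + Phi (- y).
have dg (y : R) : is_derive y 1 g 0.
  rewrite /g.
  have -> : (fun y : R => Phi y + Phi (- y)) = (Phi + (Phi \o -%R)) by [].
  have d1 := is_derive_Phi y; have d2 := is_derive_Phi (- y).
  apply: is_derive_eq.
  by rewrite /GRing.scale/= /gpdf sqrrN mulrN1 subrr.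
have gy : g y @[y --> +oo] --> (1 + 0 : R).
  apply: cvgD; first exact: Phi_cvgy.
  have := Phi_cvgNy; rewrite cvgNy_compNP; exact.
have gc : g y @[y --> +oo] --> g x.
  have -> : g = cst (g x) by apply/funext => y; apply: is_derive_0_is_cst.
  exact: cvg_cst.
have := cvg_unique (@Rhausdorff R) gy gc; rewrite addr0 /g => ->.
by rewrite addrC addKr.
Qed.

(** Beyond 1 the function [exp (- u^2 / 2) + Phi u] decreases, since the density is at most
    [u * exp (- u^2 / 2)] there. It is compared at [t] and at a far point [y] where
    [1 - Phi y <= e]. *)
Lemma Phi_tail_le t : 1 <= t -> 1 - Phi t <= expR (- (t ^+ 2) / 2).
Proof.
move=> t1; apply/ler_addgt0Pl => e e0.
have /cvgrPdist_le/(_ _ e0)[M [_ MP]] := Phi_cvgy.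
pose y := Num.max t (M + 1).
have ty : t <= y by rewrite le_max lexx.
have {MP} Qy : 1 - Phi y <= e.
  have : M < y by rewrite lt_max ltrDl ltr01 orbT.
  by move/MP => /=; apply: le_trans; exact: ler_norm.
pose g u : R := expR (- (u ^+ 2) / 2) + Phi u.
have dg (u : R) : is_derive u 1 g (gpdf u - u * expR (- (u ^+ 2) / 2)).
  rewrite /g.
  have -> : (fun u : R => expR (- u ^+ 2 / 2) + Phi u) =
    ((expR \o (fun x : R => - x ^+ 2 / 2)) + Phi) by [].
  have d1 := is_derive_Phi u.
  apply: is_derive_eq.
  by rewrite /GRing.scale/=; field.
have [|c /[!in_itv]/= /andP[tc cy] E] := MVT_segment ty (fun u _ => dg u).
  apply/continuous_subspaceT => r.
  exact/differentiable_continuous/derivable1_diffP.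
have : g y - g t <= 0.
  rewrite E mulr_le0_ge0// ?subr_ge0// subr_le0; apply: le_trans (gpdf_le c) _.
  by rewrite ler_peMl ?expR_ge0// (le_trans t1).
have := expR_ge0 (- y ^+ 2 / 2); rewrite /g; lra.
Qed.

(** The factor [exp (- 3 / 2)] is what the density can lose on an interval of length [1 / (1 + y)]
    starting at [y >= 0]. *)
Definition kap : R := normal_peak 1 * expR (- (3 / 2)).

Lemma kap_gt0 : 0 < kap.
Proof. by rewrite mulr_gt0 ?expR_gt0 ?normal_peak_gt0// oner_neq0. Qed.

(** A lower bound of Mills type: the density is integrated over [[y, y + 1 / (1 + y)]] only, where
    the square of the argument stays below [y^2 + 3]. Negative [x] is reduced to 0 by monotonicity,
    hence the maximum. *)
Lemma Phi_tail_ge x (h := Num.max x 0) :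
  kap * expR (- (h ^+ 2) / 2) / (1 + h) <= 1 - Phi x.
Proof.
have main y : 0 <= y -> kap * expR (- (y ^+ 2) / 2) / (1 + y) <= 1 - Phi y.
  move=> y0; pose z := y + (1 + y)^-1.
  have y1 : 0 < 1 + y by rewrite ltr_pwDl.
  have yz : y <= z by rewrite lerDl invr_ge0 ltW.
  have [|c /[!in_itv]/= /andP[yc cz] E] := MVT_segment yz (fun u _ => is_derive_Phi u).
    apply/continuous_subspaceT => r; have d1 := is_derive_Phi r.
    exact/differentiable_continuous/derivable1_diffP.
  apply: (@le_trans _ _ (Phi z - Phi y)); last by rewrite lerB// Phi_le1.
  rewrite E addrAC subrr add0r ler_wpM2r// ?invr_ge0 ?(ltW y1)// /kap /gpdf -mulrA ler_wpM2l//.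
    by rewrite normal_peak_ge0.
  rewrite -expRD ler_expR.
  have c2 : c ^+ 2 <= z ^+ 2 by rewrite ler_pXn2r// nnegrE (le_trans y0)// (le_trans yc).
  have : z ^+ 2 <= y ^+ 2 + 3.
    have i1 : (1 + y)^-1 <= 1 by rewrite invf_le1// lerDl.
    have i0 : 0 <= (1 + y)^-1 by rewrite invr_ge0 ltW.
    have e1 : y * (1 + y)^-1 = 1 - (1 + y)^-1.
      by rewrite -[X in X - _](@divff _ (1 + y)) ?gt_eqF// mulrDl mul1r addrAC subrr add0r.
    rewrite /z; nra.
  lra.
rewrite /h; have [x0|x0] := leP 0 x; first exact: main.
apply: le_trans (main 0 _) _ => //.
by rewrite lerB// Phi_nondecreasing// ltW.
Qed.

Lemma Phi_tail_gt0 x : 0 < 1 - Phi x :> R.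
Proof.
apply: lt_le_trans (Phi_tail_ge x).
apply: divr_gt0; first by rewrite mulr_gt0 ?expR_gt0 ?kap_gt0.
by rewrite ltr_pwDl// le_max lexx orbT.
Qed.

(** The hazard rate, density over tail, is at most [(1 + h) / kap] by [Phi_tail_ge]; a shift by
    [y - x] therefore loses at most that proportion of the tail per unit of length. *)
Lemma Phi_tail_shift x y (h := Num.max x 0) : x <= y ->
  (1 - Phi x) * (1 - (y - x) * (1 + h) / kap) <= 1 - Phi y.
Proof.
move=> xy.
have h1 : 0 < 1 + h by rewrite ltr_pwDl// le_max lexx orbT.
have [|c /[!in_itv]/= /andP[xc cy] E] := MVT_segment xy (fun u _ => is_derive_Phi u).
  apply/continuous_subspaceT => r; have d1 := is_derive_Phi r.
  exact/differentiable_continuous/derivable1_diffP.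
suff : gpdf c <= (1 - Phi x) * (1 + h) / kap.
  move=> /(ler_wpM2r (_ : 0 <= y - x)); rewrite subr_ge0 => /(_ xy).
  rewrite -E => H; rewrite mulrBr mulr1 -subr_ge0.
  rewrite -subr_ge0 in H; apply: le_trans H _.
  rewrite le_eqVlt; apply/orP; left; apply/eqP; ring.
rewrite ler_pdivlMr ?kap_gt0// -ler_pdivrMr//.
apply: le_trans (Phi_tail_ge x); rewrite -/h ler_wpM2r ?invr_ge0 ?(ltW h1)//.
rewrite mulrC ler_wpM2l ?(ltW kap_gt0)//; apply: le_trans (gpdf_le c) _.
rewrite ler_expR !mulNr lerN2 ler_wpM2r// /h.
have [x0|x0] := leP 0 x; last by rewrite expr0n/= sqr_ge0.
by rewrite ler_pXn2r// nnegrE (le_trans x0).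
Qed.

(** Completing the square: part of the Gaussian decay is traded for an exponential with a free slope
    [a], and a Gaussian in [z + a] is kept to absorb polynomials. *)
Lemma gpdf_tilt a z : gpdf z <= expR (a * z + a ^+ 2 / 2) * expR (- ((z + a) ^+ 2) / 2).
Proof.
rewrite -expRD; apply: le_trans (gpdf_le z) _.
by rewrite ler_expR le_eqVlt; apply/orP; left; apply/eqP; field.
Qed.

Lemma sqr_expR_le w : w ^+ 2 * expR (- (w ^+ 2) / 2) <= 2 :> R.
Proof.
have := expR_ge1Dx (w ^+ 2 / 2); rewrite mulNr expRN => H.
rewrite ler_pdivrMr ?expR_gt0//; lra.
Qed.

Lemma pow4_expR_le w : w ^+ 4 * expR (- (w ^+ 2) / 2) <= 8 :> R.
Proof.
have := @expR_ge1Dxn R (w ^+ 2 / 2) 1; rewrite mulNr expRN => /(_ _)/=.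
rewrite divr_ge0 ?sqr_ge0// => /(_ isT).
rewrite ler_pdivrMr ?expR_gt0// => H.
have -> : w ^+ 4 = 8 * ((w ^+ 2 / 2) ^+ 2 / 2`!%:R) by rewrite (_ : 2`! = 2)//; field.
by rewrite ler_wpM2l// (le_trans _ H)// lerDr.
Qed.

(** The left-hand side is the third derivative of [Phi]. The constants are larger than needed here,
    so that the bound agrees with that of [gpdf_hermite3_le]. *)
Lemma gpdf_hermite2_le a z :
  `|(z ^+ 2 - 1) * gpdf z| <= (65 + 8 * a ^+ 4) * expR (a * z + a ^+ 2 / 2).
Proof.
rewrite normrM (ger0_norm (ltW (gpdf_gt0 _))).
pose w := z + a; pose E := expR (- (w ^+ 2) / 2).
apply: (@le_trans _ _ (`|z ^+ 2 - 1| * (expR (a * z + a ^+ 2 / 2) * E))).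
  by rewrite ler_wpM2l// gpdf_tilt.
rewrite mulrCA mulrC ler_wpM2r ?expR_ge0//.
have E0 : 0 <= E by exact: expR_ge0.
have E1 : E <= 1 by rewrite /E -expR0 ler_expR mulNr oppr_le0 divr_ge0// sqr_ge0.
have w2 := sqr_expR_le w.
have : `|z ^+ 2 - 1| <= 1 + 2 * w ^+ 2 + 2 * a ^+ 2.
  have -> : z = w - a by rewrite /w addrK.
  have s1 := sqr_ge0 (w - a); have s2 := sqr_ge0 (w + a).
  rewrite ler_norml; apply/andP; split; move: s1 s2; rewrite !expr2; lra.
move=> H0; apply: le_trans (ler_wpM2r E0 H0) _.
rewrite -/E in w2.
have a2 : 2 * a ^+ 2 <= 1 + a ^+ 4.
  by have := sqr_ge0 (a ^+ 2 - 1); rewrite (exprM a 2 2) !expr2; lra.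
have a4 : 0 <= a ^+ 4 by rewrite (exprM a 2 2) sqr_ge0.
have aE : a ^+ 2 * E <= a ^+ 2 by rewrite ler_piMr// sqr_ge0.
lra.
Qed.

(** This polynomial comes from the second time derivative of [heat]. With [w = z + a], the
    polynomial is at most [1 + 8 w^4 + 8 a^4], and [w^4] times the Gaussian is at most 8, whence
    [65 = 1 + 8 * 8]. *)
Lemma gpdf_hermite3_le a z :
  `|(3 * z - z ^+ 3) / 4 * gpdf z| <= (65 + 8 * a ^+ 4) * expR (a * z + a ^+ 2 / 2).
Proof.
rewrite normrM (ger0_norm (ltW (gpdf_gt0 _))).
pose w := z + a; pose E := expR (- (w ^+ 2) / 2).
apply: (@le_trans _ _ (`|(3 * z - z ^+ 3) / 4| * (expR (a * z + a ^+ 2 / 2) * E))).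
  by rewrite ler_wpM2l// gpdf_tilt.
rewrite mulrCA mulrC ler_wpM2r ?expR_ge0//.
have E0 : 0 <= E by exact: expR_ge0.
have E1 : E <= 1 by rewrite /E -expR0 ler_expR mulNr oppr_le0 divr_ge0// sqr_ge0.
have w4 := pow4_expR_le w.
have z4 : z ^+ 4 <= 8 * w ^+ 4 + 8 * a ^+ 4.
  have -> : z = w - a by rewrite /w addrK.
  rewrite !(exprM _ 2 2).
  have h1 : (w - a) ^+ 2 <= 2 * w ^+ 2 + 2 * a ^+ 2.
    by have := sqr_ge0 (w + a); rewrite !expr2; lra.
  have h2 : 0 <= (w - a) ^+ 2 by rewrite sqr_ge0.
  have h3 : ((w - a) ^+ 2) ^+ 2 <= (2 * w ^+ 2 + 2 * a ^+ 2) ^+ 2 by rewrite ler_pXn2r// nnegrE (le_trans h2).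
  apply: (le_trans h3); rewrite -subr_ge0.
  have -> : 8 * (w ^+ 2) ^+ 2 + 8 * (a ^+ 2) ^+ 2 - (2 * w ^+ 2 + 2 * a ^+ 2) ^+ 2
    = 4 * (w ^+ 2 - a ^+ 2) ^+ 2 by ring.
  by rewrite mulr_ge0// sqr_ge0.
have zn : `|(3 * z - z ^+ 3) / 4| <= 1 + z ^+ 4.
  (* The two squares expand to [|z|^3 <= z^4 + z^2 / 4]. *)
  have p1 : 0 <= (z ^+ 2 - z * 2^-1) ^+ 2 by rewrite sqr_ge0.
  have p2 : 0 <= (z ^+ 2 + z * 2^-1) ^+ 2 by rewrite sqr_ge0.
  have p3 : z ^+ 3 = z * z ^+ 2 by rewrite exprS.
  have p4 : z ^+ 4 = z ^+ 2 * z ^+ 2 by rewrite -exprD.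
  rewrite ler_norml; apply/andP; split; nra.
have := ler_wpM2r E0 zn => H; apply: (le_trans H).
rewrite -/E in w4.
have a4 : 0 <= a ^+ 4 by rewrite (exprM a 2 2) sqr_ge0.
have aE : a ^+ 4 * E <= a ^+ 4 by rewrite ler_piMr.
have := ler_wpM2r E0 z4; lra.
Qed.

End normal_tail.

(** * Smoothed indicators and the heat equation *)

Section heat.
Context {R : realType}.
Implicit Types x y t a z w u s h b : R.

(** The probability that [u] plus a centred normal variable of variance [s] exceeds [x]: the
    indicator of [u > x] after heat time [s]. The suffixes below denote derivatives in [u] and in
    [s]. *)
Definition heat x s u : R := Phi ((u - x) / Num.sqrt s).
Definition heat_u x s u : R := gpdf ((u - x) / Num.sqrt s) / Num.sqrt s.
Definition heat_uu x s u : R :=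
  - ((u - x) / Num.sqrt s) * gpdf ((u - x) / Num.sqrt s) / s.
Definition heat_uuu x s u : R :=
  (((u - x) / Num.sqrt s) ^+ 2 - 1) * gpdf ((u - x) / Num.sqrt s) / (s * Num.sqrt s).
Definition heat_ss x s u : R :=
  (3 * ((u - x) / Num.sqrt s) - ((u - x) / Num.sqrt s) ^+ 3) / 4
    * gpdf ((u - x) / Num.sqrt s) / s ^+ 2.

Let is_derive_z x s u : is_derive u 1 (fun u : R => (u - x) / Num.sqrt s) (Num.sqrt s)^-1.
Proof.
have -> : (fun u : R => (u - x) / Num.sqrt s) = (Num.sqrt s)^-1 \*: ((@id R) - cst x).
  by apply/funext => v /=; rewrite mulrC.
apply: is_derive_eq.
by rewrite /GRing.scale/= subr0 mulr1.
Qed.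

Lemma is_derive_heat x s u : is_derive u 1 (heat x s) (heat_u x s u).
Proof.
have d1 := is_derive_z x s u; have d2 := is_derive_Phi ((u - x) / Num.sqrt s).
exact: (@is_derive1_comp _ _ (fun u : R => (u - x) / Num.sqrt s) u _ _ d2 d1).
Qed.

Lemma is_derive_heat_u x s u : 0 < s -> is_derive u 1 (heat_u x s) (heat_uu x s u).
Proof.
move=> s0; have d1 := is_derive_z x s u; have d2 := is_derive_gpdf ((u - x) / Num.sqrt s).
have d3 := @is_derive1_comp _ _ (fun u : R => (u - x) / Num.sqrt s) u _ _ d2 d1.
have -> : heat_u x s = (Num.sqrt s)^-1 \*: (gpdf \o (fun u : R => (u - x) / Num.sqrt s)).
  by apply/funext => v; rewrite /heat_u/= mulrC.
apply: is_derive_eq.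
rewrite /GRing.scale/= /heat_uu -[X in _ = _ / X](@sqr_sqrtr _ s) ?ltW//.
have r0 : Num.sqrt s != 0 by rewrite sqrtr_eq0 -ltNge.
by field.
Qed.

Lemma is_derive_heat_uu x s u : 0 < s -> is_derive u 1 (heat_uu x s) (heat_uuu x s u).
Proof.
move=> s0; have d1 := is_derive_z x s u; have d2 := is_derive_gpdf ((u - x) / Num.sqrt s).
have d3 := @is_derive1_comp _ _ (fun u : R => (u - x) / Num.sqrt s) u _ _ d2 d1.
have -> : heat_uu x s = (- s^-1) \*: ((fun u : R => (u - x) / Num.sqrt s) *
   (gpdf \o (fun u : R => (u - x) / Num.sqrt s))).
  by apply/funext => v; rewrite /heat_uu/= /GRing.scale/= !mulrfctE/=; ring.
apply: is_derive_eq.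
rewrite /GRing.scale/= /heat_uuu.
have r0 : Num.sqrt s != 0 by rewrite sqrtr_eq0 -ltNge.
have := @sqr_sqrtr _ s (ltW s0); move: (Num.sqrt s) r0 => r r0 <-.
by field.
Qed.

Let is_derive_zs x s u : 0 < s ->
  is_derive s 1 (fun s : R => (u - x) / Num.sqrt s)
    (- ((u - x) / Num.sqrt s) / (2 * s)).
Proof.
move=> s0.
have r0 : Num.sqrt s != 0 by rewrite sqrtr_eq0 -ltNge.
have d1 := is_derive1_sqrt s0.
have d2 := is_deriveV r0 d1.
have -> : (fun s : R => (u - x) / Num.sqrt s) = (u - x) \*: (fun s : R => (Num.sqrt s)^-1).
  by [].
apply: is_derive_eq.
rewrite /GRing.scale/=.
have := @sqr_sqrtr _ s (ltW s0); move: (Num.sqrt s) r0 => r r0 <-.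
by field.
Qed.

(** The heat equation. It lets the second-order term of a removed summand of variance [v] cancel
    against an increase of the time by [v]. *)
Lemma is_derive_heat_s x s u : 0 < s ->
  is_derive s 1 (fun s => heat x s u) (heat_uu x s u / 2).
Proof.
move=> s0; have d1 := is_derive_zs x u s0.
have d2 := is_derive_Phi ((u - x) / Num.sqrt s).
have d3 := @is_derive1_comp _ _ (fun s : R => (u - x) / Num.sqrt s) s _ _ d2 d1.
apply: (is_derive_eq d3); rewrite /heat_uu.
by field; rewrite gt_eqF//= sqrtr_eq0 -ltNge.
Qed.

Lemma is_derive_heat_uu_s x s u : 0 < s ->
  is_derive s 1 (fun s => heat_uu x s u / 2) (heat_ss x s u).
Proof.
move=> s0; have d1 := is_derive_zs x u s0.
have d2 := is_derive_gpdf ((u - x) / Num.sqrt s).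
have d3 := @is_derive1_comp _ _ (fun s : R => (u - x) / Num.sqrt s) s _ _ d2 d1.
have d4 : is_derive s 1 (fun s : R => s^-1) (- s ^- 2).
  by apply: is_derive_eq (is_deriveV _ (is_derive_id _ _)) _; rewrite /GRing.scale/= ?gt_eqF// mulr1.
have -> : (fun s => heat_uu x s u / 2) = (- 2^-1) \*: ((fun s : R => (u - x) / Num.sqrt s) *
   (gpdf \o (fun s : R => (u - x) / Num.sqrt s)) * (fun s : R => s^-1)).
  by apply/funext => v; rewrite /heat_uu/= /GRing.scale/= !mulrfctE/=; ring.
apply: is_derive_eq.
rewrite /GRing.scale/= /heat_ss !mulrfctE/=.
have r0 : Num.sqrt s != 0 by rewrite sqrtr_eq0 -ltNge.
have := @sqr_sqrtr _ s (ltW s0); move: (Num.sqrt s) r0 => r r0 <-.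
by field.
Qed.

(** The slope [a = h * sqrt s] in [gpdf_tilt] makes the exponent linear in [u] with slope [h],
    whatever the time [s]. *)
Let exponentE x s u h : 0 < s ->
  (h * Num.sqrt s) * ((u - x) / Num.sqrt s) + (h * Num.sqrt s) ^+ 2 / 2 =
  h * (u - x) + h ^+ 2 * s / 2.
Proof.
move=> s0; rewrite exprMn sqr_sqrtr ?ltW//.
by field; rewrite sqrtr_eq0 -ltNge.
Qed.

(* The weight [exp (h (u - x) + h^2 s / 2)] makes the bound integrate, against the
   moment generating function of the partial sums, to [exp (- x^2 / 2)] at [h = x]. *)
Definition heat_weight x s u h e2 : R :=
  (65 + 72 * h ^+ 4) / e2 ^+ 2 * expR (h * (u - x) + h ^+ 2 * s / 2).

(** Origin of the 72 in [heat_weight]: the constant 8 of the Hermite bounds times [3^2], for times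
    up to 3. *)
Let pow4_le s h : 0 < s <= 3 -> (h * Num.sqrt s) ^+ 4 <= 9 * h ^+ 4.
Proof.
move=> /andP[s0 s3]; rewrite exprMn (exprM (Num.sqrt s) 2 2) sqr_sqrtr ?(ltW s0)// mulrC.
rewrite ler_wpM2r//; first by rewrite (exprM h 2 2) sqr_ge0.
have -> : 9 = 3 ^+ 2 :> R by rewrite -natrX.
by rewrite ler_pXn2r// nnegrE ltW.
Qed.

(** As [e2 <= 1], both denominators, [s * sqrt s] here and [s^2] in [heat_ss], are at least [e2^2];
    the two derivatives thus share one weight. *)
Lemma heat_uuu_le x s u h e2 : 0 < e2 <= 1 -> e2 <= s <= 3 ->
  `|heat_uuu x s u| <= heat_weight x s u h e2.
Proof.
move=> /andP[e0 e1] /andP[es s3]; have s0 : 0 < s by exact: lt_le_trans es.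
have r0 : 0 < Num.sqrt s by rewrite sqrtr_gt0.
rewrite /heat_uuu normrM [`|(_ * _)^-1|]ger0_norm ?invr_ge0 ?mulr_ge0 ?(ltW s0) ?(ltW r0)//.
rewrite ler_pdivrMr ?mulr_gt0//.
apply: le_trans (gpdf_hermite2_le (h * Num.sqrt s) _) _.
rewrite exponentE// /heat_weight [leRHS]mulrAC ler_wpM2r ?expR_ge0//.
rewrite mulrAC ler_pdivlMr ?exprn_gt0//.
have q0 : 0 <= (h * Num.sqrt s) ^+ 4 by rewrite (exprM _ 2 2) sqr_ge0.
apply: ler_pM => //; first by rewrite addr_ge0// mulr_ge0.
- by rewrite exprn_ge0// ltW.
- by rewrite lerD2l; have := @pow4_le s h; rewrite s0 s3 => /(_ isT); lra.
rewrite expr2 ler_pM ?(ltW e0)//.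
have e21 : e2 ^+ 2 <= s.
  by rewrite (le_trans _ es)// expr2 ler_piMl// ltW.
by rewrite -ler_sqr ?nnegrE ?(ltW e0) ?(ltW r0)// sqr_sqrtr ?(ltW s0).
Qed.

Lemma heat_ss_le x s u h e2 : 0 < e2 <= 1 -> e2 <= s <= 3 ->
  `|heat_ss x s u| <= heat_weight x s u h e2.
Proof.
move=> /andP[e0 e1] /andP[es s3]; have s0 : 0 < s by exact: lt_le_trans es.
have r0 : 0 < Num.sqrt s by rewrite sqrtr_gt0.
rewrite /heat_ss normrM [`|(_ ^+ 2)^-1|]ger0_norm ?invr_ge0 ?exprn_ge0 ?(ltW s0)//.
rewrite ler_pdivrMr ?exprn_gt0//.
apply: le_trans (gpdf_hermite3_le (h * Num.sqrt s) _) _.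
rewrite exponentE// /heat_weight [leRHS]mulrAC ler_wpM2r ?expR_ge0//.
rewrite mulrAC ler_pdivlMr ?exprn_gt0//.
have q0 : 0 <= (h * Num.sqrt s) ^+ 4 by rewrite (exprM _ 2 2) sqr_ge0.
apply: ler_pM => //; first by rewrite addr_ge0// mulr_ge0.
- by rewrite exprn_ge0// ltW.
- by rewrite lerD2l; have := @pow4_le s h; rewrite s0 s3 => /(_ isT); lra.
by rewrite ler_pXn2r// nnegrE ltW.
Qed.

(** The third derivative is needed at points within [b] of [u]; moving its weight back to [u] costs
    [exp (h b)]. *)
Lemma heat_taylor_u x s u h e2 b y : 0 <= h -> 0 < e2 <= 1 -> e2 <= s <= 3 -> `|y| <= b ->
  `|heat x s (u + y) - heat x s u - y * heat_u x s u - y ^+ 2 / 2 * heat_uu x s u|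
  <= b ^+ 3 * expR (h * b) * heat_weight x s u h e2.
Proof.
move=> h0 e01 es yb; have s0 : 0 < s.
  by move: e01 es => /andP[e0 _] /andP[es _]; exact: lt_le_trans es.
have sh (f df : R -> R) : (forall v : R, is_derive v 1 f (df v)) ->
    forall v : R, is_derive v 1 (fun v => f (u + v)) (df (u + v)).
  move=> fdf v; have d1 : is_derive v 1 (fun v : R => u + v) 1.
    have -> : (fun v : R => u + v) = cst u + id by [].
    by apply: is_derive_eq; rewrite add0r.
  by rewrite -[df _]mulr1; exact: (@is_derive1_comp _ f (fun v : R => u + v)).
pose M := expR (h * b) * heat_weight x s u h e2.
have := @taylor3 R (fun v => heat x s (u + v)) (fun v => heat_u x s (u + v))
  (fun v => heat_uu x s (u + v)) (fun v => heat_uuu x s (u + v)) y M.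
move=> /(_ _ _ _ _)/wrap[|||t ty|].
- by apply: sh => v; exact: is_derive_heat.
- by apply: sh => v; exact: is_derive_heat_u.
- by apply: sh => v; exact: is_derive_heat_uu.
- apply: le_trans (heat_uuu_le _ _ h e01 es) _.
  rewrite /M /heat_weight [leRHS]mulrCA; apply: ler_wpM2l.
    rewrite divr_ge0 ?sqr_ge0// addr_ge0// mulr_ge0// (exprM h 2 2) sqr_ge0//.
  rewrite -expRD ler_expR.
  have : h * t <= h * b.
    by rewrite ler_wpM2l// (le_trans (ler_norm t))// (le_trans ty).
  lra.
rewrite addr0 => /le_trans; apply.
rewrite -mulrA mulrC; apply: ler_wpM2r.
  rewrite /M mulr_ge0 ?expR_ge0// mulr_ge0 ?expR_ge0// divr_ge0 ?sqr_ge0//.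
  by rewrite addr_ge0// mulr_ge0// (exprM h 2 2) sqr_ge0.
by rewrite ler_pXn2r// nnegrE// (le_trans _ yb).
Qed.

(** The exponent of the weight grows with time, so the weight at the final time [s + t] dominates on
    the whole interval. *)
Lemma heat_taylor_s x s u h e2 t : 0 < e2 <= 1 -> e2 <= s -> 0 <= t -> s + t <= 3 ->
  `|heat x (s + t) u - heat x s u - t / 2 * heat_uu x s u|
  <= t ^+ 2 * heat_weight x (s + t) u h e2.
Proof.
move=> e01 es t0 st; have s0 : 0 < s.
  by move: e01 => /andP[e0 _]; exact: lt_le_trans es.
have := @taylor2_right R (fun v => heat x v u) (fun v => heat_uu x v u / 2)
   (fun v => heat_ss x v u) s t (heat_weight x (s + t) u h e2) t0.
move=> /(_ _ _ _)/wrap[||r /andP[sr rt]|].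
- by move=> v sv; apply: is_derive_heat_s; exact: lt_le_trans sv.
- by move=> v sv; apply: is_derive_heat_uu_s; exact: lt_le_trans sv.
- apply: le_trans (heat_ss_le _ _ h e01 _) _.
    by rewrite (le_trans es)//= (le_trans rt).
  rewrite /heat_weight; apply: ler_wpM2l.
    rewrite divr_ge0 ?sqr_ge0// addr_ge0// mulr_ge0// (exprM h 2 2) sqr_ge0//.
  by rewrite ler_expR lerD2l ler_pM2r// ler_wpM2l// sqr_ge0.
by rewrite mulrA [t * _ / _]mulrAC [_ * t ^+ 2]mulrC.
Qed.

End heat.

(** * Bounded random variables *)

Section bounded_measurable.
Context d {T : measurableType d} {R : realType}.
Implicit Types f g : T -> R.

(** Every expectation in the proof is that of a bounded variable. This class is stable under the
    operations used and integrable for finite measures, which settles integrability once and for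
    all. *)
Definition bmf f := measurable_fun setT f /\ exists B, forall w, `|f w| <= B.

Lemma bmf_cst (r : R) : bmf (fun=> r).
Proof. by split; [exact: measurable_cst|exists `|r|]. Qed.

Lemma bmfD f g : bmf f -> bmf g -> bmf (fun w => f w + g w).
Proof.
move=> [mf [B fB]] [mg [C gC]]; split; first exact: measurable_funD.
by exists (B + C) => w; rewrite (le_trans (ler_normD _ _))// lerD.
Qed.

Lemma bmfN f : bmf f -> bmf (fun w => - f w).
Proof.
move=> [mf [B fB]]; split; last by exists B => w; rewrite normrN.
exact: measurableT_comp.
Qed.

Lemma bmfB f g : bmf f -> bmf g -> bmf (fun w => f w - g w).
Proof. by move=> bf bg; apply: bmfD => //; exact: bmfN. Qed.

Lemma bmfM f g : bmf f -> bmf g -> bmf (fun w => f w * g w).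
Proof.
move=> [mf [B fB]] [mg [C gC]]; split; first exact: measurable_funM.
by exists (B * C) => w; rewrite normrM ler_pM.
Qed.

Lemma bmfZ (r : R) f : bmf f -> bmf (fun w => r * f w).
Proof. by apply: bmfM; exact: bmf_cst. Qed.

Lemma bmf_norm f : bmf f -> bmf (fun w => `|f w|).
Proof.
move=> [mf [B fB]]; split; last by exists B => w; rewrite normr_id.
exact: measurableT_comp.
Qed.

Lemma bmf_sum n (f : nat -> T -> R) : (forall i, bmf (f i)) ->
  bmf (fun w => \sum_(i < n) f i w).
Proof.
move=> bf; elim: n => [|n IH].
  by under eq_fun do rewrite big_ord0; exact: bmf_cst.
by under eq_fun do rewrite big_ord_recr /=; exact: bmfD.
Qed.

Lemma bmf_comp (h : R -> R) f : bmf f -> measurable_fun setT h ->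
  (forall B, exists C, forall x, `|x| <= B -> `|h x| <= C) -> bmf (fun w => h (f w)).
Proof.
move=> [mf [B fB]] mh /(_ B)[C hC]; split; first exact: measurableT_comp.
by exists C => w; apply: hC.
Qed.

Lemma bmf_expR f : bmf f -> bmf (fun w => expR (f w)).
Proof.
move=> bf; apply: bmf_comp => // B; exists (expR B) => x xB.
by rewrite ger0_norm ?expR_ge0// ler_expR (le_trans (ler_norm x)).
Qed.

Lemma bmf_indic (A : set T) : measurable A -> bmf (\1_A : T -> R).
Proof.
move=> mA; split; first exact: measurable_indic.
by exists 1 => w; rewrite indicE; case: (_ \in _); rewrite ?normr1 ?normr0.
Qed.

Lemma bmf_integrable (mu : {measure set T -> \bar R}) D f :
  measurable D -> (mu D < +oo)%E -> bmf f -> mu.-integrable D (EFin \o f).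
Proof.
move=> mD Doo [mf [B fB]]; apply: measurable_bounded_integrable => //.
  exact: measurable_funTS.
exists B; split; first exact: num_real.
by move=> M BM w _ /=; rewrite (le_trans (fB w))// ltW.
Qed.

End bounded_measurable.

Section expectation.
Context d {T : measurableType d} {R : realType} (P : probability T R).
Implicit Types f g : T -> R.
Local Notation E f := (\int[P]_w f w).

Lemma bmf_Pint f : bmf f -> P.-integrable setT (EFin \o f).
Proof.
move=> bf; apply: (bmf_integrable _ _ bf); first exact: measurableT.
by apply: (@le_lt_trans _ _ 1%E); [exact: probability_le1|exact: ltry].
Qed.
Local Hint Resolve bmf_Pint : core.

Lemma Ebmf_cst (r : R) : E (fun=> r) = r.
Proof. by rewrite Rintegral_cst// [X in fine X](_ : _ = 1%E) ?mulr1//; exact: probability_setT. Qed.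

Lemma EbmfD f g : bmf f -> bmf g -> E (fun w => f w + g w) = E f + E g.
Proof. by move=> bf bg; rewrite RintegralD//; exact: bmf_Pint. Qed.

Lemma EbmfB f g : bmf f -> bmf g -> E (fun w => f w - g w) = E f - E g.
Proof. by move=> bf bg; rewrite RintegralB//; exact: bmf_Pint. Qed.

Lemma EbmfZ r f : bmf f -> E (fun w => r * f w) = r * E f.
Proof. by move=> bf; rewrite RintegralZl//; exact: bmf_Pint. Qed.

Lemma Ebmf_le f g : bmf f -> bmf g -> (forall w, f w <= g w) -> E f <= E g.
Proof. by move=> bf bg fg; apply: le_Rintegral => //; exact: bmf_Pint. Qed.

Lemma Ebmf_norm_le f g : bmf f -> bmf g -> (forall w, `|f w| <= g w) -> `|E f| <= E g.
Proof.
move=> bf bg fg; apply: le_trans (le_normr_Rintegral _ (bmf_Pint bf)) _ => //.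
by apply: Ebmf_le => //; exact: bmf_norm.
Qed.

Lemma Ebmf_indic (A : set T) : measurable A -> E (\1_A : T -> R) = fine (P A).
Proof. by move=> mA; rewrite /Rintegral integral_indic// setIT. Qed.

Lemma chernoff f (r : R) : bmf f -> 0 <= r ->
  fine (P [set w | r <= f w]) <= E (fun w => expR (f w)) / expR r.
Proof.
move=> bf r0.
have mA : measurable [set w | r <= f w].
  by rewrite -[X in measurable X]setTI; apply: measurable_fun_le => //; case: bf.
rewrite -Ebmf_indic// ler_pdivlMr ?expR_gt0// mulrC -EbmfZ; last exact: bmf_indic.
apply: Ebmf_le.
- by apply: bmfZ; exact: bmf_indic.
- exact: bmf_expR.
move=> w; rewrite indicE; case: (boolP (w \in _)) => [/[!inE]/= rf|_].
  by rewrite mulr1 ler_expR.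
by rewrite mulr0 expR_ge0.
Qed.

End expectation.

(** * Independence: product rule for expectations, partial sums against the next variable *)

Section independence.
Context d {T : measurableType d} {R : realType} (P : probability T R).
Local Notation E f := (\int[P]_w f w).

Definition indep2 (U V : T -> R) := forall A B : set R, measurable A -> measurable B ->
  P (U @^-1` A `&` V @^-1` B) = (P (U @^-1` A) * P (V @^-1` B))%E.

(** The law of the pair and the product of the laws agree on rectangles, hence everywhere; the
    expectation is then an iterated integral. *)
Lemma EbmfM_indep (U V : T -> R) (f g : R -> R) :
  measurable_fun setT U -> measurable_fun setT V -> indep2 U V ->
  measurable_fun setT f -> measurable_fun setT g ->
  bmf (fun w => f (U w)) -> bmf (fun w => g (V w)) ->
  E (fun w => f (U w) * g (V w)) = E (fun w => f (U w)) * E (fun w => g (V w)).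
Proof.
move=> mU mV UV mf mg bf bg.
pose U' : {mfun T >-> R} := mfun_Sub (mem_set mU).
pose V' : {mfun T >-> R} := mfun_Sub (mem_set mV).
have mUV : measurable_fun setT (fun w => (U w, V w)) by exact: measurable_fun_pair.
pose UV' : {mfun T >-> (R * R)%type} := mfun_Sub (mem_set mUV).
pose H (z : R * R) := ((f z.1 * g z.2)%:E).
have mH : measurable_fun setT H.
  by apply/measurable_EFinP; apply: measurable_funM; apply: measurableT_comp.
have iH : P.-integrable setT (H \o UV') by apply: bmf_Pint; exact: bmfM.
have eqm X : measurable X ->
    (distribution P U' \x distribution P V')%E X = distribution P UV' X.
  by apply: product_measure_unique => A B mA mB; exact: UV.
have iH1 : (distribution P UV').-integrable setT H.
  by apply: integrable_pushforward => //; exact: measurable_funP.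
have iH2 : (distribution P U' \x distribution P V')%E.-integrable setT H.
  apply/integrableP; split => //.
  rewrite (eq_measure_integral (distribution P UV')); last by move=> A mA _; exact: eqm.
  by case/integrableP : iH1.
have ig : (distribution P V').-integrable setT (EFin \o g).
  apply: integrable_pushforward => //; first exact/measurable_EFinP.
  exact: bmf_Pint.
have iV : (\int[distribution P V']_y (g y)%:E = (E (fun w => g (V w)))%:E)%E.
  rewrite integral_distribution; last exact: bmf_Pint.
    rewrite fineK//; apply: integrable_fin_num => //; exact: bmf_Pint.
  exact/measurable_EFinP.
have -> : E (fun w => f (U w) * g (V w)) = fine (\int[distribution P UV']_z H z)%E.
  by rewrite integral_distribution.
rewrite (eq_measure_integral (distribution P U' \x distribution P V')%E); last first.
  by move=> A mA _; exact/esym/eqm.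
rewrite -integral12_prod_meas1// /fubini_F.
under eq_integral => x _.
  rewrite /H/=; under eq_integral do rewrite EFinM.
  rewrite integralZl// iV -EFinM; over.
rewrite (_ : (\int[_]_x _)%E = \int[P]_w (f (U w) * E (fun w => g (V w)))%:E)%E; last first.
  rewrite (@integral_distribution _ _ _ _ _ P U' (fun x => (f x * E (fun w => g (V w)))%:E))//.
    by apply/measurable_EFinP; apply: measurable_funM.
  by apply: bmf_Pint; apply: bmfM => //; exact: bmf_cst.
by rewrite -[RHS]RintegralZr//; exact: bmf_Pint.
Qed.

Section partial_sums.
Variables (X : nat -> T -> R) (g : R -> R).
Hypotheses (mX : forall i, measurable_fun setT (X i)) (mg : measurable_fun setT g).
Hypothesis Xindep : mutually_independent P X.

Let S k w := \sum_(i < k) g (X i w).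

Let mS k : measurable_fun setT (S k).
Proof. by apply: measurable_sum => i; exact: measurableT_comp. Qed.

Let preim (Y : T -> R) A : measurable_fun setT Y -> measurable A -> measurable (Y @^-1` A).
Proof. by move=> mY mA; rewrite -[X in measurable X]setTI; exact: mY. Qed.

Let cylinder (B : nat -> set R) n := \bigcap_(i in `I_n) (X i @^-1` B i).

Let mcyl B n : (forall i, measurable (B i)) -> measurable (cylinder B n).
Proof.
by move=> mB; apply: bigcap_measurableType => i _; exact: preim.
Qed.

Let cyl_upd B n k (B1 : set R) : (k < n)%N -> B k = setT ->
  cylinder (fun i => if i == k then B1 else B i) n = X k @^-1` B1 `&` cylinder B n.
Proof.
move=> kn Bk; apply/seteqP; split => w /=.
  move=> H; split; first by have := H k kn; rewrite /= eqxx.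
  move=> i /= ni; have := H i ni => /=; case: eqP => [->|//].
  by rewrite Bk.
move=> [Xk H] i /= ni; have := H i ni => /=.
by case: eqP => [->|].
Qed.

Let cyl_prod B n k (B1 : set R) : (k < n)%N -> B k = setT -> measurable B1 ->
  (forall i, measurable (B i)) ->
  P (X k @^-1` B1 `&` cylinder B n) = (P (X k @^-1` B1) * P (cylinder B n))%E.
Proof.
move=> kn Bk mB1 mB; rewrite -cyl_upd// /cylinder !Xindep//; last first.
  by move=> i _; case: ifP.
rewrite (bigD1 (Ordinal kn))//= eqxx [in RHS](bigD1 (Ordinal kn))//= Bk.
rewrite preimage_setT (_ : P setT = 1%E) ?mul1e; last exact: probability_setT.
congr (_ * _)%E; apply: eq_bigr => i /negbTE.
by rewrite -val_eqE/= => ->.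
Qed.

(** The independence assumption speaks of single variables only. For the sum the induction has to
    carry an arbitrary cylinder in the coordinates from [k] on: the case of [S k.+1] needs the law
    of [(S k, X k)] on such a cylinder, where the event on [X k] is one more constraint of the
    cylinder for [S k]. *)
Let indep_cylinder k : forall n B A, (k < n)%N -> (forall i, measurable (B i)) ->
  (forall i, (i < k)%N -> B i = setT) -> measurable A ->
  P (S k @^-1` A `&` cylinder B n) = (P (S k @^-1` A) * P (cylinder B n))%E.
Proof.
elim: k => [|k IH] n B A kn mB BT mA.
  have -> : S 0 = cst 0 by apply/funext => w; rewrite /S big_ord0.
  rewrite preimage_cst; case: ifPn => _.
    by rewrite setTI (_ : P setT = 1%E) ?mul1e//; exact: probability_setT.
  by rewrite set0I measure0 mul0e.
have kn' : (k < n)%N by exact: ltn_trans kn.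
have mSX : measurable_fun setT (fun w => (S k w, X k w)) by exact: measurable_fun_pair.
have mC := mcyl n mB.
pose SX : {mfun T >-> (R * R)%type} := mfun_Sub (mem_set mSX).
(* [m1] is the law of [(S k, X k)] restricted to the cylinder, [m2] the full law times the
   probability of the cylinder. *)
pose m1 : {measure set (R * R) -> \bar R} :=
  measure_function_pushforward__canonical__measure_function_Measure (mrestr P mC) mSX.
have p0 : (0 <= fine (P (cylinder B n))) by exact: fine_ge0.
pose m2 : {measure set (R * R) -> \bar R} := mscale (NngNum p0) (distribution P SX).
have SXk A1 B1 : measurable A1 -> measurable B1 ->
    P (S k @^-1` A1 `&` X k @^-1` B1) = (P (S k @^-1` A1) * P (X k @^-1` B1))%E.
  move=> mA1 mB1; pose B' i := if i == k then B1 else [set: R].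
  have cE : cylinder B' k.+1 = X k @^-1` B1.
    rewrite (cyl_upd (B := fun=> setT))//; apply/setIidPl => w _ i _ //.
  rewrite -cE IH// => i; first by rewrite /B'; case: ifP.
  by rewrite /B' => /ltn_eqF ->.
have m12 D : measurable D -> m1 D = m2 D.
  pose G : set (set (R * R)) := [set D | exists A1, measurable A1 /\ exists B1, measurable B1 /\ D = A1 `*` B1].
  have GT : G setT by exists setT; split => //; exists setT; split => //; rewrite setXTT.
  apply: (measure_unique G (fun=> setT)) => //.
  - rewrite measurable_prod_measurableType; congr (<<s _ >>).
    rewrite predeqE; split => [[A1 mA1 [B1 mB1 <-]]|[A1 [mA1 [B1 [mB1 ->]]]]].
      by exists A1; split => //; exists B1.
    by exists A1 => //; exists B1.
  - move=> _ _ [A1 [mA1 [A2 [mA2 ->]]]] [B1 [mB1 [B2 [mB2 ->]]]].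
    rewrite -setXI; exists (A1 `&` B1); split; first exact: measurableI.
    by exists (A2 `&` B2); split => //; exact: measurableI.
  - by apply/seteqP; split => // x _; exists 0%N.
  - move=> _ [A1 [mA1 [B1 [mB1 ->]]]].
    have -> : m2 (A1 `*` B1) =
        ((fine (P (cylinder B n)))%:E * P (S k @^-1` A1 `&` X k @^-1` B1))%E by [].
    rewrite fineK ?fin_num_measure// SXk//.
    have -> : m1 (A1 `*` B1) = P ((S k @^-1` A1 `&` X k @^-1` B1) `&` cylinder B n) by [].
    (* The event on [X k] is absorbed into the cylinder, whose coordinate [k] is free, and the
       induction hypothesis applies to [S k]. *)
    rewrite -setIA -cyl_upd ?BT// IH//.
    + by rewrite cyl_upd ?BT// cyl_prod ?BT// muleA muleC.
    + by move=> i; case: ifP.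
    + by move=> i ik; rewrite ltn_eqF// BT// (ltn_trans ik).
  - move=> _; apply: (@le_lt_trans _ _ 1%E); last exact: ltry.
    apply: (@le_trans _ _ (P (cylinder B n))); last exact: probability_le1.
    by rewrite /m1/= /pushforward/= /mrestr preimage_setT setTI.
pose D := (fun z : R * R => z.1 + g z.2) @^-1` A.
have mD : measurable D.
  rewrite /D -[X in measurable X]setTI.
  by apply: measurable_funD => //; exact: measurableT_comp.
have E1 : S k.+1 @^-1` A = (fun w => (S k w, X k w)) @^-1` D.
  by apply/seteqP; split => w /=; rewrite /D /S/= big_ord_recr.
have -> : P (S k.+1 @^-1` A `&` cylinder B n) = m1 D by rewrite E1.
rewrite m12// E1 muleC -[X in (X * _)%E]fineK// fin_num_measure//.
Qed.

Lemma indep2_partial_sum k : indep2 (S k) (X k).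
Proof.
move=> A B mA mB; pose B' i := if i == k then B else [set: R].
have cE : cylinder B' k.+1 = X k @^-1` B.
  by rewrite (cyl_upd (B := fun=> setT))//; apply/setIidPl => w _ i _ //.
rewrite -cE indep_cylinder// => i; first by rewrite /B'; case: ifP.
by rewrite /B' => /ltn_eqF ->.
Qed.

End partial_sums.

End independence.

(** * Lindeberg's replacement and moderate deviations *)

Section exponential_moments.
Context {R : realType}.

Lemma expR_taylor2 (t : R) : `|t| <= 1 ->
  expR t <= 1 + t + t ^+ 2 / 2 + expR 1 * `|t| ^+ 3.
Proof.
move=> t1; have := @taylor3 R expR expR expR expR t (expR 1).
move=> /(_ _ _ _ _)/wrap[u ut|].
  by rewrite ger0_norm ?expR_ge0// ler_expR (le_trans (ler_norm _))// (le_trans ut).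
by rewrite expR0 mulr1 mulr1 ler_norml => /andP[_]; lra.
Qed.

End exponential_moments.

Section lindeberg.
Context d {T : measurableType d} {R : realType} (P : probability T R).
Implicit Types x s h e u : R.
Variables (X : nat -> T -> R) (g : R -> R) (b : R).
Hypotheses (mX : forall i, measurable_fun setT (X i)) (mg : measurable_fun setT g).
Hypothesis Xindep : mutually_independent P X.
Hypothesis gb : forall x, `|g x| <= b.
Hypothesis Eg : forall i, \int[P]_w g (X i w) = 0.
Local Notation E f := (\int[P]_w f w).

Definition psum n w := \sum_(i < n) g (X i w).

Let bg i : bmf (fun w => g (X i w)).
Proof. by split; [exact: measurableT_comp|exists b => w]. Qed.

Lemma bmf_psum n : bmf (psum n).
Proof. exact: (@bmf_sum _ _ _ n (fun i w => g (X i w)) bg). Qed.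

Let b0 : 0 <= b. Proof. by apply: le_trans (gb 0). Qed.

Lemma mgf_psum_le h q n : (forall i, E (fun w => expR (h * g (X i w))) <= q) ->
  E (fun w => expR (h * psum n w)) <= q ^+ n.
Proof.
move=> Eq; elim: n => [|n IH].
  under eq_Rintegral do rewrite /psum big_ord0 mulr0 expR0.
  by rewrite Ebmf_cst expr0.
have -> : E (fun w => expR (h * psum n.+1 w)) =
    E (fun w => expR (h * psum n w) * expR (h * g (X n w))).
  by apply: eq_Rintegral => w _; rewrite /psum big_ord_recr/= mulrDr expRD.
have mh : measurable_fun setT (fun u : R => expR (h * u)).
  by apply: measurableT_comp => //; exact: measurable_funM.
rewrite (@EbmfM_indep _ _ _ P (psum n) (X n) (fun u => expR (h * u)) (fun u => expR (h * g u)))//.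
- rewrite exprSr ler_pM//; apply: Rintegral_ge0 => w _; exact: expR_ge0.
- by case: (bmf_psum n).
- exact: indep2_partial_sum.
- exact: (measurableT_comp mh).
- by apply/bmf_expR/bmfZ/bmf_psum.
- exact/bmf_expR/bmfZ/bg.
Qed.

(** Third-order expansion of the exponential; the linear term vanishes by centring and
    [1 + y <= exp y] concludes. *)
Lemma mgf_le h i : `|h| * b <= 1 -> E (fun w => expR (h * g (X i w))) <=
  expR (h ^+ 2 * E (fun w => g (X i w) ^+ 2) / 2 + expR 1 * (`|h| * b) ^+ 3).
Proof.
move=> hb.
have b2 : bmf (fun w => g (X i w) ^+ 2) by exact: bmfM.
apply: (@le_trans _ _ (E (fun w => (1 + expR 1 * (`|h| * b) ^+ 3) +
   (h * g (X i w) + h ^+ 2 / 2 * g (X i w) ^+ 2)))).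
  apply: Ebmf_le.
  - exact/bmf_expR/bmfZ/bg.
  - by apply: bmfD; [exact: bmf_cst|apply: bmfD; exact: bmfZ].
  move=> w; have H : `|h * g (X i w)| <= `|h| * b by rewrite normrM ler_wpM2l.
  apply: le_trans (expR_taylor2 (le_trans H hb)) _.
  have : `|h * g (X i w)| ^+ 3 <= (`|h| * b) ^+ 3.
    by rewrite ler_pXn2r// nnegrE// mulr_ge0.
  move=> /(ler_wpM2l (expR_ge0 1)); rewrite exprMn; lra.
rewrite EbmfD; [|exact: bmf_cst|by apply: bmfD; exact: bmfZ].
rewrite Ebmf_cst EbmfD ?EbmfZ//; [|exact: bmfZ|exact: bmfZ].
rewrite Eg mulr0 add0r; apply: le_trans (expR_ge1Dx _).
lra.
Qed.

(** For [|h| b <= 1] the cubic term of [mgf_le] is at most [e (h b)^2], and the variance is at most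
    [b^2]. *)
Lemma mgf_psum_subgauss h n : `|h| * b <= 1 ->
  E (fun w => expR (h * psum n w)) <= expR (n%:R * ((1 + expR 1) * (h * b) ^+ 2)).
Proof.
move=> hb; rewrite expRM_natl; apply: mgf_psum_le => i.
apply: le_trans (mgf_le _ hb) _; rewrite ler_expR.
have : E (fun w => g (X i w) ^+ 2) <= b ^+ 2.
  rewrite -[leRHS](Ebmf_cst P); apply: Ebmf_le; [exact: bmfM|exact: bmf_cst|].
  by move=> w; rewrite -real_normK ?num_real// ler_pXn2r// nnegrE.
move=> /(ler_wpM2l (sqr_ge0 h)).
have : (`|h| * b) ^+ 3 <= (h * b) ^+ 2.
  have -> : (h * b) ^+ 2 = (`|h| * b) ^+ 2 by rewrite !exprMn real_normK ?num_real.
  by rewrite exprS ler_piMl// exprn_ge0// mulr_ge0.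
move=> /(ler_wpM2l (expR_ge0 1)).
have := sqr_ge0 (h * b); rewrite exprMn; lra.
Qed.

Section heat_step.
Variable v : R.
Hypotheses (v0 : 0 <= v) (Eg2 : forall i, E (fun w => g (X i w) ^+ 2) = v).

Let measurable_heat x s : measurable_fun setT (heat x s).
Proof.
apply: continuous_measurable_fun => u; have D := is_derive_heat x s u.
exact/differentiable_continuous/derivable1_diffP.
Qed.

Let measurable_gpdf : measurable_fun setT (@gpdf R).
Proof.
apply: continuous_measurable_fun => u; have D := is_derive_gpdf u.
exact/differentiable_continuous/derivable1_diffP.
Qed.

Let bmf_heat x s f : bmf f -> bmf (fun w : T => heat x s (f w)).
Proof.
move=> bf; apply: bmf_comp => // B; exists 1 => u _.
by rewrite ger0_norm ?Phi_ge0 ?Phi_le1.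
Qed.

Let bmf_gpdf x s f : bmf f -> bmf (fun w : T => gpdf ((f w - x) / Num.sqrt s)).
Proof.
move=> bf; apply: (@bmf_comp _ _ _ gpdf (fun w => (f w - x) / Num.sqrt s)) => //.
  apply: bmfM; last exact: bmf_cst.
  by apply: bmfB => //; exact: bmf_cst.
move=> B; exists 1 => u _.
rewrite ger0_norm ?(ltW (gpdf_gt0 _))//; apply: le_trans (gpdf_le u) _.
by rewrite -expR0 ler_expR mulNr oppr_le0 divr_ge0// sqr_ge0.
Qed.

(** One replacement. Given the partial sum, the new summand is centred with variance [v], so the
    orders one and two of the expansion in space match the first order in time by the heat equation.
    What remains are two Taylor remainders, integrated against the exponential weight. *)
Lemma heat_step x s h e2 n : 0 <= h -> 0 < e2 <= 1 -> e2 <= s -> s + v <= 3 ->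
  `|E (fun w => heat x s (psum n.+1 w)) - E (fun w => heat x (s + v) (psum n w))| <=
  (b ^+ 3 * expR (h * b) + v ^+ 2) * ((65 + 72 * h ^+ 4) / e2 ^+ 2) *
  expR (- (h * x) + h ^+ 2 * (s + v) / 2) * E (fun w => expR (h * psum n w)).
Proof.
move=> h0 e01 es sv; have s0 : 0 < s by move: e01 => /andP[e0 _]; exact: lt_le_trans es.
have s3 : e2 <= s <= 3 by rewrite es/= (le_trans _ sv)// lerDl.
pose W := psum n; pose Y w := g (X n w).
have bW : bmf W by exact: bmf_psum.
have bhW : bmf (fun w => expR (h * W w)) by exact/bmf_expR/bmfZ.
have bH1 : bmf (fun w => heat_u x s (W w)).
  by apply: bmfM; [exact: bmf_gpdf|exact: bmf_cst].
have bH2 : bmf (fun w => heat_uu x s (W w)).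
  apply: bmfM; last exact: bmf_cst.
  apply: bmfM; last exact: bmf_gpdf.
  apply: bmfN; apply: bmfM; last exact: bmf_cst.
  by apply: bmfB => //; exact: bmf_cst.
have bY : bmf Y by exact: bg.
have bY2 : bmf (fun w => Y w ^+ 2) by exact: bmfM.
have mW : measurable_fun setT W by case: bW.
have Eu : E (fun w => heat_u x s (W w) * Y w) = 0.
  rewrite (@EbmfM_indep _ _ _ P W (X n) (heat_u x s) g)// ?Eg ?mulr0//.
    exact: indep2_partial_sum.
  apply: continuous_measurable_fun => u; have D := is_derive_heat_u x u s0.
  exact/differentiable_continuous/derivable1_diffP.
have Euu : E (fun w => heat_uu x s (W w) * Y w ^+ 2) = E (fun w => heat_uu x s (W w)) * v.
  rewrite (@EbmfM_indep _ _ _ P W (X n) (heat_uu x s) (fun y => g y ^+ 2))// ?Eg2//.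
  - exact: indep2_partial_sum.
  - apply: continuous_measurable_fun => u; have D := is_derive_heat_uu x u s0.
    exact/differentiable_continuous/derivable1_diffP.
  - exact: measurable_funX.
(* [A] is the Taylor remainder in space, [B] the one in time. *)
pose A w := heat x s (W w + Y w) - heat x s (W w) - Y w * heat_u x s (W w) - Y w ^+ 2 / 2 * heat_uu x s (W w).
pose B w := heat x (s + v) (W w) - heat x s (W w) - v / 2 * heat_uu x s (W w).
have bA : bmf A.
  apply: bmfB; last by apply: bmfM => //; apply: bmfM => //; exact: bmf_cst.
  apply: bmfB; last exact: bmfM.
  by apply: bmfB; apply: bmf_heat => //; exact: bmfD.
have bB : bmf B.
  by apply: bmfB; [apply: bmfB; exact: bmf_heat|exact: bmfZ].
have -> : E (fun w => heat x s (psum n.+1 w)) - E (fun w => heat x (s + v) (psum n w)) =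
    E (fun w => A w - B w).
  rewrite -EbmfB; [|exact/bmf_heat/bmf_psum|exact/bmf_heat/bmf_psum].
  (* Apart from [A - B] there remain the first-order term and the difference of the two second-order
     terms, of zero mean by [Eu] and [Euu]. *)
  have -> : E (fun w => heat x s (psum n.+1 w) - heat x (s + v) (psum n w)) =
    E (fun w => (A w - B w) + (heat_u x s (W w) * Y w + (2^-1 * (heat_uu x s (W w) * Y w ^+ 2)
       - v / 2 * heat_uu x s (W w)))).
    apply: eq_Rintegral => w _; rewrite /A /B.
    have -> : psum n.+1 w = W w + Y w by rewrite /psum big_ord_recr.
    rewrite -/(W w).
    by move: (W w) (Y w) (heat _ _ _) (heat _ _ _) (heat _ _ _) (heat_u _ _ _) (heat_uu _ _ _) => *; ring.
  have b3 : bmf (fun w => 2^-1 * (heat_uu x s (W w) * Y w ^+ 2)) by apply/bmfZ/bmfM.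
  have b4 : bmf (fun w => v / 2 * heat_uu x s (W w)) by exact/bmfZ.
  rewrite EbmfD; [|exact: bmfB|by apply: bmfD; [exact: bmfM|exact: bmfB]].
  rewrite [X in _ + X]EbmfD; [|exact: bmfM|exact: bmfB].
  rewrite [X in _ + (_ + X)]EbmfB// !EbmfZ//; last exact: bmfM.
  rewrite Eu Euu; lra.
pose K := (b ^+ 3 * expR (h * b) + v ^+ 2) * ((65 + 72 * h ^+ 4) / e2 ^+ 2) *
  expR (- (h * x) + h ^+ 2 * (s + v) / 2).
rewrite -/K -EbmfZ//; apply: Ebmf_norm_le; [exact: bmfB|exact: bmfZ|move=> w].
apply: le_trans (ler_normB _ _) _.
have HA := heat_taylor_u x (W w) h0 e01 s3 (gb (X n w)).
have HB := @heat_taylor_s R x s (W w) h e2 v e01 es v0 sv.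
apply: le_trans (lerD HA HB) _.
rewrite /heat_weight /K.
have C0 : 0 <= (65 + 72 * h ^+ 4) / e2 ^+ 2.
  by rewrite divr_ge0 ?sqr_ge0// addr_ge0// mulr_ge0// (exprM h 2 2) sqr_ge0.
have bb : 0 <= b ^+ 3 * expR (h * b) by rewrite mulr_ge0 ?expR_ge0// exprn_ge0.
rewrite -/(W w); move: (_ / e2 ^+ 2) (b ^+ 3 * _) C0 bb => C Q C0 Q0.
rewrite -[leRHS]mulrA -expRD.
have -> : - (h * x) + h ^+ 2 * (s + v) / 2 + h * W w = h * (W w - x) + h ^+ 2 * (s + v) / 2 by ring.
have : expR (h * (W w - x) + h ^+ 2 * s / 2) <= expR (h * (W w - x) + h ^+ 2 * (s + v) / 2).
  by rewrite ler_expR lerD2l ler_wpM2r// ler_wpM2l ?sqr_ge0// lerDl.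
move: (expR _) (expR _) => E1 E2 /(ler_wpM2l (mulr_ge0 Q0 C0)); lra.
Qed.

End heat_step.

(* Each summand is traded for the increment [1 / n] of the heat time, which starts at [e2]
   and ends at [1 + e2], when no summand is left. *)
Lemma lindeberg_heat x h e2 n : (0 < n)%N -> 0 <= h -> 0 < e2 <= 1 -> h * b <= 1 ->
  (forall i, E (fun w => g (X i w) ^+ 2) = n%:R^-1) ->
  `|E (fun w => heat x e2 (psum n w)) - Phi (- x / Num.sqrt (1 + e2))| <=
  n%:R * (b ^+ 3 * expR 1 + n%:R^-1 ^+ 2) * ((65 + 72 * h ^+ 4) / e2 ^+ 2) *
  expR (- (h * x) + h ^+ 2 * (1 + e2) / 2 + n%:R * (expR 1 * (h * b) ^+ 3)).
Proof.
move=> n0 h0 /andP[e0 e1] hb Eg2.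
have hb0 : 0 <= h * b by exact: mulr_ge0.
have hb3 : 0 <= expR 1 * (h * b) ^+ 3 by rewrite mulr_ge0 ?expR_ge0// exprn_ge0.
have b3 : 0 <= b ^+ 3 by rewrite exprn_ge0.
have P0 u : 0 <= b ^+ 3 * expR (h * b) + u ^+ 2.
  by rewrite addr_ge0 ?sqr_ge0// mulr_ge0 ?expR_ge0// exprn_ge0.
have hn : `|h| = h by rewrite ger0_norm.
have K0 : 0 <= (65 + 72 * h ^+ 4) / e2 ^+ 2.
  by rewrite divr_ge0 ?sqr_ge0// addr_ge0// mulr_ge0// (exprM h 2 2) sqr_ge0.
have nv : n%:R * n%:R^-1 = 1 :> R by rewrite divff// pnatr_eq0 -lt0n.
have v0 : 0 <= n%:R^-1 :> R by rewrite invr_ge0.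
move: (n%:R^-1) nv v0 Eg2 => v nv v0 Eg2.
have e23 : 1 + e2 <= 3 by lra.
have hs u k : e2 <= u -> u + v <= 3 ->
  `|E (fun w => heat x u (psum k.+1 w)) - E (fun w => heat x (u + v) (psum k w))| <=
  (b ^+ 3 * expR (h * b) + v ^+ 2) * ((65 + 72 * h ^+ 4) / e2 ^+ 2) *
  expR (- (h * x) + h ^+ 2 * (u + v) / 2) * E (fun w => expR (h * psum k w)).
  by apply: heat_step; rewrite ?e0.
move: (_ / e2 ^+ 2) K0 hs => K K0 hs.
(* [s k] is the heat time reached when [k] summands are left; [V] interpolates between the smoothed
   sum, [k = n], and a pure normal probability, [k = 0]. *)
have [s sE] : {s : nat -> R | forall k, s k = e2 + (n - k)%:R * v} by eexists.
have [V VE] : {V : nat -> R | forall k, V k = E (fun w => heat x (s k) (psum k w))} by eexists.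
have Vn : V n = E (fun w => heat x e2 (psum n w)) by rewrite VE sE subnn mul0r addr0.
have V0 : V 0%N = Phi (- x / Num.sqrt (1 + e2)).
  rewrite VE; under eq_Rintegral do rewrite /psum big_ord0.
  by rewrite Ebmf_cst /heat sE subn0 nv sub0r addrC.
pose D := (b ^+ 3 * expR 1 + v ^+ 2) * K *
  expR (- (h * x) + h ^+ 2 * (1 + e2) / 2 + n%:R * (expR 1 * (h * b) ^+ 3)).
have step k : (k < n)%N -> `|V k.+1 - V k| <= D.
  move=> kn; have skE : s k = s k.+1 + v.
    by rewrite !sE -(subnSK kn) -addrA -natr1 mulrDl mul1r.
  have es : e2 <= s k.+1 by rewrite sE lerDl mulr_ge0.
  have sk : s k <= 1 + e2.
    have kv : (n - k)%:R * v <= n%:R * v by rewrite ler_wpM2r ?v0 ?ler_nat ?leq_subr.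
    by move: kv; rewrite nv sE addrC lerD2r.
  have sk3 : s k <= 3 by exact: le_trans sk e23.
  have := hs (s k.+1) k es; rewrite -skE => /(_ sk3).
  rewrite -!VE => /le_trans; apply.
  have mg1 := @mgf_psum_le h (expR (h ^+ 2 * v / 2 + expR 1 * (h * b) ^+ 3)) k.
  have {mg1}mg1 : E (fun w => expR (h * psum k w)) <=
     expR (k%:R * (h ^+ 2 * v / 2 + expR 1 * (h * b) ^+ 3)).
    rewrite expRM_natl; apply: mg1 => i.
    by have := @mgf_le h i; rewrite Eg2 hn => /(_ hb).
  apply: le_trans (ler_wpM2l _ mg1) _; first by rewrite mulr_ge0 ?expR_ge0 ?mulr_ge0 ?P0 ?K0.
  rewrite /D -[leLHS]mulrA -expRD; apply: ler_pM.
  - by rewrite mulr_ge0 ?P0 ?K0.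
  - exact: expR_ge0.
  - by rewrite ler_wpM2r ?K0 ?lerD2r ?ler_wpM2l ?b3 ?ler_expR ?hb.
  rewrite ler_expR.
  have k1 : k%:R * (expR 1 * (h * b) ^+ 3) <= n%:R * (expR 1 * (h * b) ^+ 3).
    by rewrite ler_wpM2r ?hb3 ?ler_nat 1?(ltnW kn).
  (* The variance of the remaining summands and the heat time add up to a constant, so the exponent,
     and with it the bound [D], is the same for all steps. *)
  have k2 : k%:R * v + s k = 1 + e2.
    by rewrite sE (natrB _ (ltnW kn)) mulrBl nv; ring.
  rewrite [leLHS](_ : _ = - (h * x) + h ^+ 2 * (k%:R * v + s k) / 2 + k%:R * (expR 1 * (h * b) ^+ 3)).
    by rewrite k2 lerD2l.
  by ring.
rewrite -Vn -V0 -(telescope_sumr V (leq0n n)) big_mkord.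
apply: le_trans (ler_norm_sum _ _ _) _.
apply: (@le_trans _ _ (\sum_(k < n) D)); first by apply: ler_sum => k _; exact: step.
by rewrite sumr_const card_ord -[leLHS]mulr_natl /D !mulrA lexx.
Qed.

End lindeberg.

Section tail_comparison.
Context {R : realType}.
Implicit Types x u w r H : R.

Lemma kap_le1 : kap <= 1 :> R.
Proof.
have /= := @Phi_tail_ge R 0; rewrite maxxx expr0n/= oppr0 mul0r expR0 mulr1 addr0 divr1 => /le_trans; apply.
by rewrite lerBlDr lerDl Phi_ge0.
Qed.

(** The case of interest is [u < w]: there [Phi_tail_shift] leaves a factor [1 - r], whose inverse
    is at most [1 + 2 r] when [r <= 1 / 2]. *)
Lemma Phi_tail_near u w r H (th : R) : `|u - w| <= th -> u <= H -> 0 <= H ->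
  th * (1 + H) / kap <= r -> r <= 2^-1 -> 1 - Phi u <= (1 + 2 * r) * (1 - Phi w).
Proof.
move=> uw uH H0 thr r2; have th0 : 0 <= th by exact: le_trans uw.
have Qw := Phi_tail_gt0 w; have Qu := Phi_tail_gt0 u.
have r0 : 0 <= r by apply: le_trans thr; rewrite divr_ge0 ?(ltW kap_gt0)// mulr_ge0// addr_ge0.
have [wu|uw'] := leP w u.
  have := Phi_nondecreasing wu; nra.
have := Phi_tail_shift (ltW uw').
set z := (w - u) * _ / _ => zE.
have zr : z <= r.
  apply: le_trans thr; rewrite /z ler_wpM2r ?invr_ge0 ?(ltW kap_gt0)//.
  apply: ler_pM; first by rewrite subr_ge0 ltW.
  - by rewrite addr_ge0// le_max lexx orbT.
  - by rewrite (le_trans _ uw)// distrC ler_norm.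
  - by rewrite lerD2l ge_max uH.
move: zE zr; move: z => z zE zr.
have h1 : (1 - Phi u) * (1 - r) <= 1 - Phi w.
  by apply: le_trans zE; rewrite ler_wpM2l ?(ltW Qu)// lerB.
have : (1 - Phi u) <= (1 + 2 * r) * ((1 - Phi u) * (1 - r)).
  have : 0 <= (1 - Phi u) * (r * (1 - 2 * r)) by rewrite !mulr_ge0 ?(ltW Qu)//; lra.
  lra.
move=> /le_trans; apply; rewrite ler_wpM2l//; lra.
Qed.

Lemma Phi_tail_ge_le x H : `|x| <= H ->
  kap * expR (- (H ^+ 2) / 2) / (1 + H) <= 1 - Phi x.
Proof.
move=> xH; have H0 : 0 <= H by exact: le_trans xH.
apply: le_trans (Phi_tail_ge x).
have hH : Num.max x 0 <= H by rewrite ge_max H0 (le_trans (ler_norm x)).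
have h0 : 0 <= Num.max x 0 by rewrite le_max lexx orbT.
apply: ler_pM.
- by rewrite mulr_ge0 ?expR_ge0// ltW// kap_gt0.
- by rewrite invr_ge0 addr_ge0.
- rewrite ler_wpM2l ?(ltW kap_gt0)// ler_expR !mulNr lerN2 ler_wpM2r//.
  by rewrite ler_pXn2r.
- by rewrite lef_pV2 ?posrE ?ltr_pwDl// lerD2l.
Qed.

End tail_comparison.

(** Bookkeeping for the lower bound: [p] is the probability sought, [q] the normal tail at [x], [q']
    at the shifted point, [z] at the shifted point rescaled by the total variance, [E] the smoothed
    expectation, and [1 - v] the leak of the smoothing. *)
Lemma tail_lower_arith (R : realFieldType) (r q q' z E p v : R) : 0 < r <= 4^-1 -> 0 < q -> 0 < z ->
  - (r * q') <= E - z -> q' <= q -> q <= (1 + 2 * r) * z -> 1 - v <= r * q -> E <= p + (1 - v) ->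
  (1 - 4 * r) * q <= p.
Proof.
move=> /andP[r0 r4] q0 z0 Ez q'q qz vq Ep.
have : r * q' <= r * q by rewrite ler_wpM2l// ltW.
have : (1 - 2 * r) * q <= z by nra.
lra.
Qed.

(** Same roles as in [tail_lower_arith]; the leak now enters as the factor [v] in front of [p]. *)
Lemma tail_upper_arith (R : realFieldType) (r q q' z E p v : R) : 0 < r <= 4^-1 -> 0 < q <= 1 -> 0 <= p ->
  E - z <= r * q' -> q' <= (1 + 2 * r) * q -> z <= (1 + 2 * r) * q -> 1 - v <= r * q -> v * p <= E ->
  p <= (1 + 8 * r) * q.
Proof.
move=> /andP[r0 r4] /andP[q0 q1] p0 Ez q'q zq vq vp.
have rq : r * q <= r by rewrite ler_piMr// ltW.
have : (1 - r) * p <= v * p by rewrite ler_wpM2r//; lra.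
have : r * q' <= r * ((1 + 2 * r) * q) by rewrite ler_wpM2l// ltW.
move=> h1 h2; have {h1 h2}h : (1 - r) * p <= (1 + r) * (1 + 2 * r) * q by lra.
have : (1 + r) * (1 + 2 * r) * q <= (1 - r) * (1 + 8 * r) * q.
  by rewrite ler_wpM2r ?ltW//; nra.
by move=> /(le_trans h); rewrite -mulrA ler_pM2l//; lra.
Qed.

Section moderate_deviations_fixed.
Context d {T : measurableType d} {R : realType} (P : probability T R).
Implicit Types x s h e u : R.
Variables (X : nat -> T -> R) (g : R -> R) (b : R).
Hypotheses (mX : forall i, measurable_fun setT (X i)) (mg : measurable_fun setT g).
Hypothesis Xindep : mutually_independent P X.
Hypothesis gb : forall x, `|g x| <= b.
Hypothesis Eg : forall i, \int[P]_w g (X i w) = 0.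
Local Notation E f := (\int[P]_w f w).
(** [e2] is the smoothing variance, [t] the number of smoothing deviations by which the threshold is
    moved, [H] an upper bound of [|x| + 1], and [r] the relative error aimed at. Each of the three
    error hypotheses already contains the division by the lower bound of the normal tail. *)
Variables (n : nat) (e2 t H r : R).
Hypotheses (n0 : (0 < n)%N) (e01 : 0 < e2 <= 1) (t1 : 1 <= t) (r14 : 0 < r <= 4^-1).
Hypothesis Eg2 : forall i, E (fun w => g (X i w) ^+ 2) = n%:R^-1.
Hypothesis Hb : H * b <= 1.
Hypothesis smoothing_err :
  n%:R * (b ^+ 3 * expR 1 + n%:R^-1 ^+ 2) * ((65 + 72 * H ^+ 4) / e2 ^+ 2) *
  expR (H ^+ 2 * e2 / 2 + n%:R * (expR 1 * (H * b) ^+ 3)) * (1 + H) / kap <= r.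
Hypothesis tail_err : expR (- (t ^+ 2) / 2) * expR (H ^+ 2 / 2) * (1 + H) / kap <= r.
Hypothesis shift_err : (Num.sqrt e2 * t + H * e2) * (1 + H) / kap <= r.

Let b0 : 0 <= b. Proof. by apply: le_trans (gb 0). Qed.

(** [lindeberg_heat] with slope [h = max x 0]: for positive [x] the tilt produces the Gaussian
    factor of the tail itself, for negative [x] the tail is of order one and no tilt is wanted. *)
Let heat_approx x : `|x| <= H ->
  `|E (fun w => heat x e2 (psum X g n w)) - (1 - Phi (x / Num.sqrt (1 + e2)))|
  <= r * (1 - Phi x).
Proof.
move=> xH; have H0 : 0 <= H by exact: le_trans xH.
pose h := Num.max x 0.
have h0 : 0 <= h by rewrite le_max lexx orbT.
have hH : h <= H by rewrite ge_max H0 (le_trans (ler_norm x)).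
have hb : h * b <= 1 by apply: le_trans Hb; rewrite ler_wpM2r.
have := @lindeberg_heat _ _ _ P X g b mX mg Xindep gb Eg x h e2 n n0 h0 e01 hb Eg2.
rewrite mulNr PhiN => /le_trans; apply.
have n0' : 0 <= n%:R^-1 :> R by rewrite invr_ge0.
have C0 (y : R) : 0 <= y -> 0 <= (65 + 72 * y ^+ 4) / e2 ^+ 2.
  by move=> y0; rewrite divr_ge0 ?sqr_ge0// addr_ge0// mulr_ge0// exprn_ge0.
have b3 : 0 <= n%:R * (b ^+ 3 * expR 1 + n%:R^-1 ^+ 2).
  by rewrite mulr_ge0// addr_ge0 ?sqr_ge0// mulr_ge0 ?expR_ge0// exprn_ge0.
(* Since [h x = h^2], the exponent is that of the tail up to [h^2 e2 / 2], which stays bounded. *)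
have hx : - (h * x) + h ^+ 2 * (1 + e2) / 2 = - (h ^+ 2) / 2 + h ^+ 2 * e2 / 2.
  have -> : h * x = h ^+ 2.
    by rewrite /h; case: (leP 0 x) => _; rewrite ?mul0r ?expr0n// expr2.
  by field.
rewrite hx (_ : expR (_ + _ + _) = expR (- h ^+ 2 / 2) *
  expR (h ^+ 2 * e2 / 2 + n%:R * (expR 1 * (h * b) ^+ 3))); last by rewrite -expRD addrA.
apply: (@le_trans _ _ (r * (kap * expR (- h ^+ 2 / 2) / (1 + h)))); last first.
  by apply: ler_wpM2l; [case/andP: r14 => /ltW|exact: Phi_tail_ge].
have h1 : 0 < 1 + h by rewrite ltr_pwDl.
rewrite [leLHS]mulrCA [leRHS](_ : _ = expR (- h ^+ 2 / 2) * (r * kap / (1 + h))); last by ring.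
apply: ler_wpM2l; first exact: expR_ge0.
rewrite ler_pdivlMr//.
move: smoothing_err; rewrite ler_pdivrMr ?kap_gt0//; apply: le_trans.
have E0 (y : R) : 0 <= expR y by exact: expR_ge0.
have e0 : 0 <= e2 by case/andP: e01 => /ltW.
apply: ler_pM; [exact: (mulr_ge0 (mulr_ge0 b3 (C0 _ h0)) (E0 _))|exact: ltW| |by rewrite lerD2l].
apply: ler_pM; [exact: (mulr_ge0 b3 (C0 _ h0))|exact: E0| |].
  rewrite ler_wpM2l// ler_wpM2r ?invr_ge0 ?sqr_ge0// lerD2l ler_wpM2l//.
  by rewrite ler_pXn2r.
rewrite ler_expR; apply: lerD.
  by rewrite ler_wpM2r// ler_wpM2r// ler_pXn2r.
rewrite ler_wpM2l// ler_wpM2l ?expR_ge0// ler_pXn2r ?nnegrE ?mulr_ge0//.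
by rewrite ler_wpM2r.
Qed.

Let sqrt_shift x : `|x| <= H -> `|x / Num.sqrt (1 + e2) - x| <= H * e2.
Proof.
move=> xH; have e0 : 0 < e2 by case/andP: e01.
have s1 : 1 <= Num.sqrt (1 + e2) by rewrite -[leLHS]sqrtr1 ler_wsqrtr// lerDl ltW.
have s2 : Num.sqrt (1 + e2) <= 1 + e2.
  rewrite -ler_sqr ?nnegrE ?sqrtr_ge0 ?addr_ge0 ?(ltW e0)// sqr_sqrtr ?addr_ge0 ?(ltW e0)//.
  by rewrite expr2 ler_peMl ?lerDl ?addr_ge0 ?(ltW e0).
have -> : x / Num.sqrt (1 + e2) - x = - (x * (1 - (Num.sqrt (1 + e2))^-1)) by ring.
rewrite normrN normrM ler_pM// ger0_norm; last first.
  by rewrite subr_ge0 invf_le1// (lt_le_trans _ s1).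
rewrite -[X in X - _](@divff _ (Num.sqrt (1 + e2))) ?gt_eqF ?(lt_le_trans _ s1)//.
rewrite -[X in _ - X]mul1r -mulrBl ler_pdivrMr ?(lt_le_trans _ s1)//.
apply: (@le_trans _ _ (e2 * 1)); first by rewrite mulr1; lra.
by rewrite ler_wpM2l// ltW.
Qed.

Let mW : measurable_fun setT (psum X g n).
Proof. by have [] := bmf_psum mX mg gb n. Qed.

Let mgtW x : measurable [set w | x < psum X g n w].
Proof.
rewrite (_ : [set w | _] = psum X g n @^-1` `]x, +oo[%classic).
  by rewrite -[X in measurable X]setTI; exact: mW.
by apply/seteqP; split => w /=; rewrite in_itv/= andbT.
Qed.

(** The indicator of [psum > x] is compared with [heat] centred at [x + eta] and at [x - eta]: the
    former is at most [1 - Phi t] where [psum <= x], the latter at least [Phi t] where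
    [psum > x]. *)
Lemma moderate_deviation_fixed x : `|x| + 1 <= H ->
  (1 - 4 * r) * (1 - Phi x) <= fine (P [set w | x < psum X g n w]) <=
  (1 + 8 * r) * (1 - Phi x).
Proof.
move=> xH.
have H0 : 0 <= H by apply: le_trans xH; rewrite addr_ge0.
have e0 : 0 < e2 by case/andP: e01.
have r0 : 0 < r by case/andP: r14.
have r4 : r <= 4^-1 by case/andP: r14.
have r2 : r <= 2^-1 by apply: le_trans r4 _; rewrite lef_pV2// ?posrE// ler_nat.
have k0 : 0 < kap :> R := kap_gt0.
have H1 : 1 <= 1 + H by rewrite lerDl.
have H1' : 0 < 1 + H by exact: lt_le_trans H1.
pose eta := Num.sqrt e2 * t.
have eta0 : 0 <= eta by rewrite mulr_ge0 ?sqrtr_ge0// (le_trans _ t1).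
(* The room of 1 in [|x| + 1 <= H] keeps the shifted thresholds in the range of [heat_approx]. *)
have eta1 : eta <= 1.
  have h1 : eta * (1 + H) / kap <= r.
    apply: le_trans shift_err; rewrite ler_wpM2r ?invr_ge0 ?(ltW k0)// ler_wpM2r ?(le_trans _ H1)//.
    by rewrite lerDl mulr_ge0// ltW.
  rewrite ler_pdivrMr// in h1.
  have h2 : r * kap <= 1.
    by rewrite mulr_ile1 ?(ltW r0) ?(ltW k0) ?kap_le1// (le_trans r2)// invf_le1// ler1n.
  by apply: le_trans h2; apply: le_trans h1; rewrite ler_peMr.
have xpH : `|x + eta| <= H.
  by apply: le_trans xH; rewrite (le_trans (ler_normD _ _))// lerD2l ger0_norm.
have xmH : `|x - eta| <= H.
  by apply: le_trans xH; rewrite (le_trans (ler_normB _ _))// lerD2l ger0_norm.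
have xH' : `|x| <= H by rewrite (le_trans _ xH)// lerDl.
have Qx := Phi_tail_gt0 x.
(* The leak must be small relative to the smallest tail considered, at [H]; this is the content of
   [tail_err]. *)
have Qt : 1 - Phi t <= r * (1 - Phi x).
  apply: le_trans (Phi_tail_le t1) _.
  apply: (@le_trans _ _ (r * (kap * expR (- H ^+ 2 / 2) / (1 + H)))); last first.
    by rewrite ler_wpM2l ?(ltW r0)// Phi_tail_ge_le.
  move: tail_err; rewrite [X in _ <= _ * (_ * expR X / _)]mulNr expRN.
  move: (expR _) (expR _) (expR_gt0 (H ^+ 2 / 2)) => a c c0 acr.
  have -> : a = (a * c * (1 + H) / kap) * (kap / c / (1 + H)).
    by field; rewrite !gt_eqF.
  by rewrite ler_wpM2r// ltW// !divr_gt0.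
have near y : `|y| <= H -> `|y - x| <= eta -> let z := y / Num.sqrt (1 + e2) in
    1 - Phi z <= (1 + 2 * r) * (1 - Phi x) /\ 1 - Phi x <= (1 + 2 * r) * (1 - Phi z).
  move=> yH yx z.
  have zx : `|z - x| <= eta + H * e2.
    have -> : z - x = (y - x) + (z - y) by ring.
    by rewrite (le_trans (ler_normD _ _))// lerD// sqrt_shift.
  have s1 : 1 <= Num.sqrt (1 + e2) by rewrite -[leLHS]sqrtr1 ler_wsqrtr// lerDl ltW.
  have zH : z <= H.
    rewrite (le_trans (ler_norm _))// /z normrM (le_trans _ yH)// ler_piMr//.
    by rewrite ger0_norm ?invr_ge0 ?sqrtr_ge0// invf_le1// (lt_le_trans _ s1).
  split; first exact: (Phi_tail_near zx zH H0 shift_err r2).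
  apply: (Phi_tail_near _ _ H0 shift_err r2); first by rewrite distrC.
  by rewrite (le_trans (ler_norm _)).
set pr := fine _.
have pr1 : E (\1_([set w | x < psum X g n w]) : T -> R) = pr by rewrite Ebmf_indic.
have bI : bmf (\1_([set w | x < psum X g n w]) : T -> R) by exact: bmf_indic.
have bh y : bmf (fun w => heat y e2 (psum X g n w)).
  split; last by exists 1 => w; rewrite ger0_norm ?Phi_ge0 ?Phi_le1.
  apply: measurableT_comp => //; apply: continuous_measurable_fun => u.
  have D := is_derive_heat y e2 u.
  exact/differentiable_continuous/derivable1_diffP.
have etaE : eta / Num.sqrt e2 = t.
  by rewrite /eta mulrAC divff ?mul1r// gt_eqF// sqrtr_gt0.
apply/andP; split.
  have := heat_approx xpH; rewrite ler_norml => /andP[lo _].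
  have := near _ xpH; rewrite addrAC subrr add0r ger0_norm// => /(_ (lexx _))[_ nx].
  have Qp : 1 - Phi (x + eta) <= 1 - Phi x by rewrite lerB// Phi_nondecreasing// lerDl.
  have : E (fun w => heat (x + eta) e2 (psum X g n w)) <= pr + (1 - Phi t).
    have -> : pr + (1 - Phi t) = E (fun w => \1_([set w | x < psum X g n w]) w + (1 - Phi t)).
      by rewrite EbmfD//; [rewrite Ebmf_cst pr1|exact: bmf_cst].
    apply: Ebmf_le => //; first by apply: bmfD => //; exact: bmf_cst.
    move=> w; rewrite indicE; case: (boolP (w \in _)) => [_|].
      by rewrite (le_trans (Phi_le1 _))// lerDl subr_ge0 Phi_le1.
    rewrite notin_setE/= => /negP; rewrite -leNgt => Wx.
    rewrite add0r -PhiN; apply: Phi_nondecreasing.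
    by rewrite ler_pdivrMr ?sqrtr_gt0// mulNr mulrC -/eta lerBlDr [leRHS]addrC addrK.
  by move=> Ep; exact: (tail_lower_arith r14 Qx (Phi_tail_gt0 _) lo Qp nx Qt Ep).
have := heat_approx xmH; rewrite ler_norml => /andP[_ hi].
have := near _ xmH; rewrite addrAC subrr add0r normrN ger0_norm// => /(_ (lexx _))[nx _].
have Qm : 1 - Phi (x - eta) <= (1 + 2 * r) * (1 - Phi x).
  apply: (Phi_tail_near (th := eta + H * e2) _ _ H0 shift_err r2).
    by rewrite addrAC subrr add0r normrN ger0_norm// lerDl mulr_ge0// ltW.
  by rewrite (le_trans (ler_norm _)).
have lo : Phi t * pr <= E (fun w => heat (x - eta) e2 (psum X g n w)).
  rewrite -pr1 -(EbmfZ P _ bI)//; apply: Ebmf_le => //; first exact: bmfZ.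
  move=> w; rewrite indicE; case: (boolP (w \in _)) => [|_]; last by rewrite mulr0 Phi_ge0.
  rewrite inE/= mulr1 => Wx; apply: Phi_nondecreasing.
  by rewrite ler_pdivlMr ?sqrtr_gt0// mulrC -/eta opprB addrCA lerDl subr_ge0 ltW.
have pr0 : 0 <= pr by exact: fine_ge0.
have Qx1 : 1 - Phi x <= 1 by rewrite lerBlDr lerDl Phi_ge0.
have Qx01 : 0 < 1 - Phi x <= 1 by rewrite Qx.
exact: (tail_upper_arith r14 Qx01 pr0 hi Qm nx Qt lo).
Qed.

End moderate_deviations_fixed.

(** * Choice of the smoothing parameters as powers of the square root of [ln n] *)

Section asymptotics.
Context {R : realType}.
Implicit Types L r k B : R.

(** With [L^2 = ln n] the left-hand side is [n^(-1/2)]. It is the twelfth power of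
    [exp (- L^2 / 24)], which is at most [24 / L^2]. The exponent 24 leaves room for the factor
    [L^21] met in [parameters_small]. *)
Lemma expR_gauss_le_pow : exists2 K : R, 0 < K &
  forall L, 1 <= L -> expR (- (L ^+ 2) / 2) <= K * (L^-1) ^+ 24.
Proof.
exists (24 ^+ 12); first by rewrite exprn_gt0.
move=> L L1; have L0 : 0 < L by exact: lt_le_trans L1.
rewrite mulNr expRN.
have -> : L ^+ 2 / 2 = 12%:R * (L ^+ 2 / 24) by field.
rewrite expRM_natl -exprVn.
have -> : 24 ^+ 12 * L^-1 ^+ 24 = (24 / L ^+ 2) ^+ 12 :> R.
  by rewrite exprMn -exprVn -exprM.
rewrite ler_pXn2r ?nnegrE ?invr_ge0 ?expR_ge0 ?divr_ge0 ?exprn_ge0 ?(ltW L0)//.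
rewrite -[leRHS]invrK lef_pV2 ?posrE ?expR_gt0 ?invr_gt0 ?divr_gt0 ?exprn_gt0//.
rewrite invf_div; apply: le_trans (expR_ge1Dx _).
by rewrite lerDr.
Qed.

Lemma pow_inv_le L n : 1 <= L -> (0 < n)%N -> (L^-1) ^+ n <= L^-1.
Proof.
move=> L1; case: n => // n _; have L0 : 0 < L by exact: lt_le_trans L1.
rewrite exprS ler_piMr ?invr_ge0 ?(ltW L0)// exprn_ile1 ?invr_ge0 ?(ltW L0)//.
by rewrite invf_le1.
Qed.

(** The hypotheses of [moderate_deviation_fixed] for summands bounded by [B E], with [E] standing
    for [n^(-1/2)], [H = k L], [t = (k + 1) L] and [e2 = L^-8]. The smoothing error is [E] times
    [L^4 * L^16 * L]; the leak is at most [E L] as [(k + 1)^2 - k^2 >= 1]; the shift error is of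
    order [L^-2]. *)
Lemma parameters_small k B r : 1 <= k -> 0 <= B -> 0 < r ->
  exists2 M : R, 1 <= M & forall L, M <= L ->
  let E := expR (- (L ^+ 2) / 2) in let e2 := (L^-1 ^+ 4) ^+ 2 in
  [/\ k * L * (B * E) <= 1,
   (B ^+ 3 * expR 1 * E + E ^+ 2) * ((65 + 72 * (k * L) ^+ 4) / e2 ^+ 2) *
     expR ((k * L) ^+ 2 * e2 / 2 + expR 1 * (k * L * B) ^+ 3 * E) * (1 + k * L) / kap <= r,
   expR (- (((k + 1) * L) ^+ 2) / 2) * expR ((k * L) ^+ 2 / 2) * (1 + k * L) / kap <= r &
   (L^-1 ^+ 4 * ((k + 1) * L) + k * L * e2) * (1 + k * L) / kap <= r].
Proof.
move=> k1 B0 r0; have [K K0 EK] := expR_gauss_le_pow.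
have k0 : 0 < k by exact: lt_le_trans k1.
have [C0 C0E] : {C : R | C = 65 + 72 * k ^+ 4} by eexists.
have C0p : 0 <= C0 by rewrite C0E addr_ge0// mulr_ge0// exprn_ge0// ltW.
have e0 (y : R) : 0 <= expR y by exact: expR_ge0.
have kp0 : 0 < kap :> R := kap_gt0.
(* Each of the four quantities turns out to be at most its constant divided by [L]. *)
pose c1 := k * B * K.
pose c2 := (B ^+ 3 * expR 1 + 1) * K * C0 * expR (k ^+ 2 / 2 + expR 1 * (k * B) ^+ 3 * K) * (1 + k) / kap.
pose c3 := K * (1 + k) / kap.
pose c4 := (k + 1 + k) * (1 + k) / kap.
pose M := Num.max 1 (Num.max (Num.max c1 (c2 / r)) (Num.max (c3 / r) (c4 / r))).
exists M; first by rewrite le_max lexx.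
move=> L ML E e2; move: ML; rewrite /M !ge_max => /andP[L1 /andP[/andP[Lc1 Lc2] /andP[Lc3 Lc4]]].
have L0 : 0 < L by exact: lt_le_trans L1.
pose q := L^-1; have q0 : 0 < q by rewrite invr_gt0.
have q1 : q <= 1 by rewrite invf_le1.
have qL : q * L = 1 by rewrite mulVf// gt_eqF.
have qX n : q ^+ n * L ^+ n = 1 by rewrite -exprMn qL expr1n.
have qn n : 0 <= q ^+ n by rewrite exprn_ge0// ltW.
have Ln n : 0 <= L ^+ n by rewrite exprn_ge0// ltW.
have EKq : E <= K * q ^+ 24 by exact: EK.
have E0 : 0 <= E by exact: e0.
have E1 : E <= 1 by rewrite /E -expR0 ler_expR mulNr oppr_le0 divr_ge0.
have kL : 0 <= k * L by rewrite mulr_ge0// ltW.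
have kL1 : 1 + k * L <= (1 + k) * L by rewrite mulrDl mul1r lerD2r.
have fin c : c / r <= L -> c * q <= r.
  by rewrite ler_pdivrMr// => H; rewrite /q ler_pdivrMr// mulrC.
have k10 : 0 <= 1 + k by rewrite addr_ge0// ltW.
have EL m : (m <= 23)%N -> L ^+ m * E <= K * q.
  move=> m23; apply: (@le_trans _ _ (L ^+ m * (K * q ^+ 24))); first by rewrite ler_wpM2l.
  rewrite mulrCA ler_wpM2l ?(ltW K0)//.
  have -> : 24%N = (m + (24 - m))%N by rewrite subnKC// (leq_trans m23).
  rewrite exprD mulrA [L ^+ m * _]mulrC qX mul1r pow_inv_le// subn_gt0.
  exact: leq_ltn_trans m23 _.
have kapV : 0 <= kap^-1 :> R by rewrite invr_ge0 ltW.
split.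
- have := EL 1%N isT; rewrite expr1 => H.
  have -> : k * L * (B * E) = k * B * (L * E) by ring.
  apply: (@le_trans _ _ (k * B * (K * q))).
    by rewrite ler_wpM2l// mulr_ge0// ltW.
  by rewrite mulrA -/c1 /q ler_pdivrMr// mul1r.
- apply: le_trans (fin _ Lc2); rewrite /c2.
  have hE2 : B ^+ 3 * expR 1 * E + E ^+ 2 <= (B ^+ 3 * expR 1 + 1) * E.
    by rewrite mulrDl mul1r lerD2l expr2 ler_piMl.
  have hC : (65 + 72 * (k * L) ^+ 4) / e2 ^+ 2 <= C0 * L ^+ 20.
    have -> : (65 + 72 * (k * L) ^+ 4) / e2 ^+ 2 = (65 + 72 * (k * L) ^+ 4) * L ^+ 16.
      by rewrite /e2 -!exprM exprVn invrK.
    rewrite (exprD L 4 16) [leRHS]mulrA ler_wpM2r// C0E [leRHS]mulrDl; apply: lerD.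
      by rewrite ler_peMr// exprn_ege1.
    by rewrite exprMn mulrA.
  have hexp : (k * L) ^+ 2 * e2 / 2 + expR 1 * (k * L * B) ^+ 3 * E <=
      k ^+ 2 / 2 + expR 1 * (k * B) ^+ 3 * K.
    apply: lerD.
      rewrite ler_wpM2r// exprMn -mulrA ler_piMr ?sqr_ge0//.
      rewrite /e2 -exprM (exprD _ 2 6) mulrA [L ^+ 2 * _]mulrC qX mul1r.
      by rewrite exprn_ile1// ltW.
    have -> : expR 1 * (k * L * B) ^+ 3 * E = expR 1 * (k * B) ^+ 3 * (L ^+ 3 * E) by ring.
    rewrite ler_wpM2l//; first by rewrite mulr_ge0// exprn_ge0// mulr_ge0// ltW.
    apply: le_trans (EL 3%N isT) _; by rewrite ler_piMr// ltW.
  have hEL : E * L ^+ 21 <= K * q by rewrite mulrC EL.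
  pose X := expR (k ^+ 2 / 2 + expR 1 * (k * B) ^+ 3 * K).
  have X0 : 0 <= X by exact: e0.
  have B30 : 0 <= B ^+ 3 * expR 1 + 1 by rewrite addr_ge0// mulr_ge0// exprn_ge0.
  apply: (@le_trans _ _ ((B ^+ 3 * expR 1 + 1) * E * (C0 * L ^+ 20) * X * ((1 + k) * L) / kap)).
    rewrite ler_wpM2r//; apply: ler_pM.
    + rewrite mulr_ge0// mulr_ge0//.
        by rewrite addr_ge0 ?sqr_ge0// mulr_ge0// mulr_ge0// exprn_ge0.
      by rewrite divr_ge0 ?sqr_ge0// addr_ge0// mulr_ge0// exprn_ge0.
    + by rewrite addr_ge0.
    + apply: ler_pM => //; last by rewrite ler_expR.
        rewrite mulr_ge0//.
          by rewrite addr_ge0 ?sqr_ge0// mulr_ge0// mulr_ge0// exprn_ge0.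
        by rewrite divr_ge0 ?sqr_ge0// addr_ge0// mulr_ge0// exprn_ge0.
      apply: ler_pM => //.
        by rewrite addr_ge0 ?sqr_ge0// mulr_ge0// mulr_ge0// exprn_ge0.
      by rewrite divr_ge0 ?sqr_ge0// addr_ge0// mulr_ge0// exprn_ge0.
    + exact: kL1.
  have -> : (B ^+ 3 * expR 1 + 1) * E * (C0 * L ^+ 20) * X * ((1 + k) * L) / kap =
     (B ^+ 3 * expR 1 + 1) * C0 * X * (1 + k) / kap * (E * L ^+ 21) by rewrite (exprS L 20); ring.
  have -> : (B ^+ 3 * expR 1 + 1) * K * C0 * X * (1 + k) / kap * q =
     (B ^+ 3 * expR 1 + 1) * C0 * X * (1 + k) / kap * (K * q) by ring.
  by rewrite ler_wpM2l// divr_ge0 ?(ltW kp0)// !mulr_ge0.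
- apply: le_trans (fin _ Lc3); rewrite /c3 -expRD.
  have h1 : expR (- ((k + 1) * L) ^+ 2 / 2 + (k * L) ^+ 2 / 2) <= E.
    rewrite ler_expR.
    have : 0 <= k * L ^+ 2 by rewrite mulr_ge0// ltW.
    rewrite !exprMn; lra.
  have h2 : E * L <= K * q by have := EL 1%N isT; rewrite expr1 mulrC.
  apply: (@le_trans _ _ (E * ((1 + k) * L) / kap)).
    by rewrite ler_wpM2r// ler_pM// addr_ge0.
  have -> : E * ((1 + k) * L) / kap = (1 + k) / kap * (E * L) by ring.
  have -> : K * (1 + k) / kap * q = (1 + k) / kap * (K * q) by ring.
  by rewrite ler_wpM2l// mulr_ge0.
- apply: le_trans (fin _ Lc4); rewrite /c4.
  have h1 : L^-1 ^+ 4 * ((k + 1) * L) <= (k + 1) * q ^+ 2.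
    rewrite mulrCA ler_wpM2l//; first by rewrite addr_ge0// ltW.
    rewrite -/q (exprD q 2 2) -mulrA ler_piMr//.
    by rewrite expr2 -mulrA qL mulr1.
  have h2 : k * L * e2 <= k * q ^+ 2.
    rewrite -mulrA ler_wpM2l ?(ltW k0)// /e2 -/q -exprM (exprD q 2 6) mulrCA ler_piMr//.
    by rewrite (exprS q 5) mulrA [L * _]mulrC qL mul1r exprn_ile1// ltW.
  have h3 : q ^+ 2 * L <= q by rewrite expr2 -mulrA qL mulr1.
  apply: (@le_trans _ _ ((k + 1 + k) * q ^+ 2 * ((1 + k) * L) / kap)).
    rewrite ler_wpM2r//; apply: ler_pM => //.
    + rewrite addr_ge0//; first by rewrite mulr_ge0// mulr_ge0 ?(ltW L0)// addr_ge0// ltW.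
      by rewrite mulr_ge0// sqr_ge0.
    + by rewrite addr_ge0.
    + by rewrite [leRHS]mulrDl lerD.
  have -> : (k + 1 + k) * q ^+ 2 * ((1 + k) * L) / kap = (k + 1 + k) * (1 + k) / kap * (q ^+ 2 * L) by ring.
  by rewrite ler_wpM2l// divr_ge0 ?(ltW kp0)// mulr_ge0// !addr_ge0// ltW.
Qed.

Lemma sqrt_ln_large (M : R) : exists2 N : nat, (0 < N)%N & forall n : nat, (N <= n)%N ->
  M <= Num.sqrt (ln n%:R).
Proof.
exists (Num.bound (expR (M ^+ 2))).+1 => // n Nn.
have nM : expR (M ^+ 2) <= n%:R.
  apply: le_trans (_ : (Num.bound (expR (M ^+ 2)))%:R <= n%:R); last by rewrite ler_nat ltnW.
  by apply/ltW/archi_boundP; exact: expR_ge0.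
have := nM; rewrite -ler_ln ?posrE ?expR_gt0//; last by rewrite (lt_le_trans _ nM)// expR_gt0.
rewrite expRK => lnM; rewrite (le_trans (ler_norm M))// -sqrtr_sqr ler_wsqrtr//.
Qed.

End asymptotics.

Section moderate_deviations.
Context d {T : measurableType d} {R : realType} (P : probability T R).
Variables (X : nat -> T -> R) (g : R -> R) (B : R).
Hypotheses (mX : forall i, measurable_fun setT (X i)) (mg : measurable_fun setT g).
Hypothesis Xindep : mutually_independent P X.
Hypothesis gB : forall x, `|g x| <= B.
Hypothesis Eg : forall i, \int[P]_w g (X i w) = 0.
Hypothesis Eg2 : forall i, \int[P]_w (g (X i w) ^+ 2) = 1.

Lemma moderate_deviation (C r : R) : 0 <= C -> 0 < r <= 4^-1 ->
  exists2 N : nat, (0 < N)%N & forall n : nat, (N <= n)%N -> forall x,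
  `|x| <= C * (1 + Num.sqrt (ln n%:R)) ->
  (1 - 4 * r) * (1 - Phi x) <=
    fine (P [set w | x < (Num.sqrt n%:R)^-1 * \sum_(i < n) g (X i w)]) <=
  (1 + 8 * r) * (1 - Phi x).
Proof.
move=> C0 r14; have r0 : 0 < r by case/andP: r14.
(* For [L >= 1] this gives [C (1 + L) + 1 <= k L], so that [H = k L] is admissible. *)
pose k := 2 * C + 1; have k1 : 1 <= k by rewrite lerDr mulr_ge0.
have B0 : 0 <= B by apply: le_trans (gB 0).
have [M M1 HM] := parameters_small k1 B0 r0.
have [N N0 HN] := sqrt_ln_large M; exists N => // n Nn x xC.
have n0 : (0 < n)%N by exact: leq_trans Nn.
set L := Num.sqrt (ln n%:R) in xC *.
have ML : M <= L by exact: HN.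
have L1 : 1 <= L by exact: le_trans ML.
have L0 : 0 < L by exact: lt_le_trans L1.
have ln0 : 0 <= ln (n%:R : R) by rewrite ln_ge0// ler1n.
have L2 : L ^+ 2 = ln n%:R by rewrite sqr_sqrtr.
(* [E] is [n^(-1/2)], the normalization of the summands, in the form in which [parameters_small] is
   stated. *)
pose E := expR (- L ^+ 2 / 2).
have n0' : 0 < n%:R :> R by rewrite ltr0n.
have E2 : E ^+ 2 = n%:R^-1.
  by rewrite -expRM_natl (_ : 2%:R * _ = - ln n%:R) ?expRN ?lnK// L2; field.
have EE : (Num.sqrt n%:R)^-1 = E.
  apply/eqP; rewrite -(@eqrXn2 _ 2) ?invr_ge0 ?sqrtr_ge0 ?expR_ge0//.
  by rewrite exprVn sqr_sqrtr ?ler0n// E2.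
have [] := HM _ ML; rewrite -/E => h1 h2 h3 h4.
pose gn y := E * g y.
have mgn : measurable_fun setT gn by exact: measurable_funM.
have gnb y : `|gn y| <= B * E.
  by rewrite /gn normrM ger0_norm ?expR_ge0// mulrC ler_wpM2r ?expR_ge0.
have bg i : bmf (fun w => g (X i w)) by split; [exact: measurableT_comp|exists B => w].
have Egn i : \int[P]_w gn (X i w) = 0 by rewrite /gn EbmfZ// Eg mulr0.
have Egn2 i : \int[P]_w (gn (X i w) ^+ 2) = n%:R^-1.
  under eq_Rintegral do rewrite /gn exprMn.
  by rewrite EbmfZ ?Eg2 ?mulr1//; exact: bmfM.
have q01 : 0 < (L^-1 ^+ 4) ^+ 2 <= 1.
  by rewrite !exprn_gt0 ?invr_gt0// !exprn_ile1 ?exprn_ge0 ?invr_ge0 ?(ltW L0)// invf_le1.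
have nE : n%:R * E ^+ 2 = 1 by rewrite E2 divff// gt_eqF.
have := @moderate_deviation_fixed _ _ _ P X gn (B * E) mX mgn Xindep gnb Egn n
  ((L^-1 ^+ 4) ^+ 2) ((k + 1) * L) (k * L) r n0 q01 _ r14 Egn2 h1.
move=> /(_ _ _ h3).
rewrite sqrtr_sqr ger0_norm ?exprn_ge0 ?invr_ge0 ?(ltW L0)// => /(_ _ _ h4 x).
have -> : [set w | x < psum X gn n w] = [set w | x < (Num.sqrt n%:R)^-1 * \sum_(i < n) g (X i w)].
  by apply/seteqP; split => w /=; rewrite /psum /gn EE mulr_sumr.
apply.
- by rewrite -[leLHS]mulr1 ler_pM// lerDr (le_trans _ k1).
- apply: le_trans h2; rewrite le_eqVlt; apply/orP; left; apply/eqP.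
  congr (_ * _ * expR (_ + _) * _ / _).
    transitivity (n%:R * E ^+ 2 * (B ^+ 3 * expR 1 * E + E ^+ 2)).
      by rewrite -E2; ring.
    by rewrite nE mul1r.
  transitivity (n%:R * E ^+ 2 * (expR 1 * (k * L * B) ^+ 3 * E)); first by ring.
  by rewrite nE mul1r.
- apply: le_trans (_ : C * (1 + L) + 1 <= _); first by rewrite lerD2r.
  rewrite /k; nra.
Qed.

End moderate_deviations.

(** * The quantile function and the empirical distribution function *)

Section cdf.
Context d {T : measurableType d} {R : realType} (P : probability T R).
Variables (X : nat -> T -> R) (F : R -> R).
Hypotheses (mX : forall i, measurable_fun setT (X i)) (XF : common_cdf P X F).

Let X0 : {RV P >-> R} := mfun_Sub (mem_set (mX 0%N)).

Let FE : F = fine \o cdf X0.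
Proof.
apply/funext => x; rewrite (XF 0%N)/= /cdf /distribution /pushforward.
by congr (fine (P _)); apply/seteqP; split => w /=; rewrite in_itv.
Qed.

Let cdfE x : cdf X0 x = (F x)%:E.
Proof. by rewrite FE/= fineK// fin_num_measure. Qed.

Lemma common_cdf_homo : {homo F : x y / x <= y}.
Proof. by move=> x y xy; rewrite -lee_fin -!cdfE cdf_nondecreasing. Qed.

Lemma common_cdf_ge0 x : 0 <= F x.
Proof. by rewrite -lee_fin -cdfE cdf_ge0. Qed.

Lemma common_cdf_le1 x : F x <= 1.
Proof. by rewrite -lee_fin -cdfE cdf_le1. Qed.

Lemma measurable_common_cdf : measurable_fun setT F.
Proof. by apply: nondecreasing_measurable => //; exact: common_cdf_homo. Qed.

Let F_right_cont x : F y @[y --> x^'+] --> F x.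
Proof.
have := @cdf_right_continuous _ _ _ P X0 x; rewrite cdfE.
by move=> /fine_cvgP[_]; rewrite FE.
Qed.

Let levelset u := [set x | u <= F x].

Let levelset_lb u : 0 < u -> has_lbound (levelset u).
Proof.
move=> u0; have /fine_cvgP[_] := cvg_cdfNy0 X0; rewrite -FE => F0.
have /cvgrPdist_lt/(_ _ u0)[M [_ MP]] := F0.
exists (M - 1) => x /= ux; rewrite leNgt; apply/negP => xM.
have /MP : x < M by rewrite (lt_trans xM)// ltrBlDr ltrDl.
by rewrite sub0r normrN ger0_norm ?common_cdf_ge0// ltNge ux.
Qed.

Let levelset_neq0 u : u < 1 -> levelset u !=set0.
Proof.
move=> u1; have /fine_cvgP[_] := cvg_cdfy1 X0; rewrite -FE => F1.
have u10 : 0 < 1 - u by rewrite subr_gt0.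
have /cvgrPdist_lt/(_ _ u10)[M [_ MP]] := F1.
exists (M + 1) => /=; have /MP : M < M + 1 by rewrite ltrDl.
rewrite ger0_norm ?subr_ge0 ?common_cdf_le1// /levelset/=; lra.
Qed.

(** The Galois connection between [F] and its inverse. Right continuity of [F] makes the infimum a
    minimum, which gives the direction from left to right. *)
Lemma Finv_le u x : 0 < u < 1 -> (Finv F u <= x) = (u <= F x).
Proof.
move=> /andP[u0 u1]; apply/idP/idP => [ux|ux]; last first.
  by apply: ge_inf => //; exact: levelset_lb.
rewrite leNgt; apply/negP => Fu.
have Fq : F (Finv F u) < u by apply: le_lt_trans Fu; exact: common_cdf_homo.
have [y yq Fy] : exists2 y, Finv F u < y & F y < u.
  have nq : \forall y \near (Finv F u)^'+, F y < u.
    by have /cvgr_lt := @F_right_cont (Finv F u); apply.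
  near (Finv F u)^'+ => y; exists y; first by near: y; exact: nbhs_right_gt.
  by near: y.
have [z [/= uz zy]] := inf_lt (levelset_neq0 u1) yq.
by have := le_lt_trans (common_cdf_homo (ltW zy)) Fy; rewrite ltNge uz.
Unshelve. all: by end_near. Qed.

Lemma Finv_gt u x : 0 < u < 1 -> (x < Finv F u) = (F x < u).
Proof. by move=> u01; rewrite !ltNge Finv_le. Qed.

Lemma Finv_homo u v : 0 < u -> u <= v -> v < 1 -> Finv F u <= Finv F v.
Proof.
move=> u0 uv v1.
have v01 : 0 < v < 1 by rewrite v1 (lt_le_trans u0 uv).
have u01 : 0 < u < 1 by rewrite u0 (le_lt_trans uv v1).
by rewrite (Finv_le _ u01) (le_trans uv)// -(Finv_le _ v01).
Qed.

(** The left limit of [F] at [x], needed because [F] may have atoms. *)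
Definition Flt (x : R) : R := fine (P [set w | X 0%N w < x]).

Let cdf_lt_cvg j x :
  F (x - m.+1%:R^-1) @[m --> \oo] --> fine (P [set w | X j w < x]).
Proof.
  have mle y : measurable [set w | X j w <= y].
    rewrite (_ : [set w | _] = X j @^-1` `]-oo, y]%classic).
      by rewrite -[Z in measurable Z]setTI; exact: mX.
    by apply/seteqP; split => w /=; rewrite in_itv.
  pose A m := [set w | X j w <= x - m.+1%:R^-1].
  have AU : \bigcup_m A m = [set w | X j w < x].
    apply/seteqP; split => w /=.
      by move=> [m _ /= /le_lt_trans]; apply; rewrite ltrBlDr ltrDl invr_gt0.
    move=> Xx; have x0 : 0 < x - X j w by rewrite subr_gt0.
    pose m := Num.bound (x - X j w)^-1; exists m => //=.
    rewrite /A/= lerBrDr -lerBrDl -[leRHS]invrK lef_pV2 ?posrE ?invr_gt0//.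
    apply: (@le_trans _ _ m%:R); last by rewrite ler_nat.
    by apply/ltW/archi_boundP; rewrite invr_ge0 ltW.
  have : P (A m) @[m --> \oo] --> P (\bigcup_m A m).
    apply: nondecreasing_cvg_mu.
    - by move=> m; exact: mle.
    - by apply: bigcup_measurable => m _; exact: mle.
    move=> m m' mm'; apply/subsetPset => w /= /le_trans; apply.
    by rewrite lerD2l lerN2 lef_pV2 ?posrE// ler_nat.
  rewrite AU -[X in _ --> X -> _]fineK; last first.
    by rewrite -AU fin_num_measure//; apply: bigcup_measurable => m _; exact: mle.
  move=> /fine_cvgP[_]; apply: cvg_trans; apply: near_eq_cvg.
  by near=> m; rewrite /= (XF j).
Unshelve. all: by end_near. Qed.

(** Equality in law is given through the values of [F] only; both strict probabilities are the limit
    of [F (x - 1 / (m + 1))]. *)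
Lemma common_cdf_lt i x : fine (P [set w | X i w < x]) = Flt x.
Proof.
have H1 := @cdf_lt_cvg i x; have H2 := @cdf_lt_cvg 0%N x.
by have -> := cvg_unique (@Rhausdorff R) H1 H2.
Qed.

(** Left of the quantile [F] is below [u]; the inequality passes to the left limit. *)
Lemma Flt_Finv_le u : 0 < u < 1 -> Flt (Finv F u) <= u.
Proof.
move=> u01; have H := @cdf_lt_cvg 0%N (Finv F u).
rewrite /Flt -(cvg_lim (@Rhausdorff R) H); apply: limr_le; first by apply/cvg_ex; eexists; exact: H.
by apply: nearW => m; rewrite ltW// -Finv_gt// ltrBlDr ltrDl invr_gt0.
Qed.

End cdf.

Section hoeffding.
Context d {T : measurableType d} {R : realType} (P : probability T R).
Variables (X : nat -> T -> R) (g : R -> R).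
Hypotheses (mX : forall i, measurable_fun setT (X i)) (mg : measurable_fun setT g).
Hypothesis Xindep : mutually_independent P X.
Hypothesis g1 : forall x, `|g x| <= 1.
Hypothesis Eg : forall i, \int[P]_w g (X i w) = 0.

Lemma hoeffding n (s : R) : 0 <= s <= 1 ->
  fine (P [set w | n%:R * s <= psum X g n w]) <=
  expR (- (n%:R * s ^+ 2 / (4 * (1 + expR 1)))).
Proof.
move=> /andP[s0 s1].
have e1 : 1 <= expR 1 :> R by rewrite -expR0 ler_expR.
(* The minimizer of the Chernoff exponent [n ((1 + e) h^2 - h s)]. *)
pose h := s / (2 * (1 + expR 1)).
have D1 : 1 <= 2 * (1 + expR 1) :> R by lra.
have D0 : 0 < 2 * (1 + expR 1) :> R by exact: lt_le_trans D1.
have h0 : 0 <= h by rewrite divr_ge0// ltW.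
have h1 : h <= 1 by rewrite ler_pdivrMr// mul1r (le_trans s1).
have bS := bmf_psum mX mg g1 n.
have [hp|hn] := ltP 0 s; last first.
  have -> : s = 0 by apply/eqP; rewrite eq_le hn.
  have mA : measurable [set w | n%:R * 0 <= psum X g n w].
    by rewrite -[Z in measurable Z]setTI; apply: measurable_fun_le => //; case: bS.
  rewrite mulr0 in mA; rewrite expr0n/= mulr0 mul0r oppr0 expR0 -lee_fin.
  by rewrite fineK ?fin_num_measure// probability_le1.
have hgt0 : 0 < h by rewrite divr_gt0.
have -> : [set w | n%:R * s <= psum X g n w] = [set w | h * (n%:R * s) <= h * psum X g n w].
  by apply/seteqP; split => w /=; rewrite ler_pM2l.
apply: le_trans (chernoff P (bmfZ h bS) _) _; first by rewrite !mulr_ge0.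
rewrite ler_pdivrMr ?expR_gt0// -expRD.
apply: le_trans (mgf_psum_subgauss mX mg Xindep g1 Eg n _) _.
  by rewrite mulr1 ger0_norm.
rewrite ler_expR mulr1 le_eqVlt; apply/orP; left; apply/eqP.
by rewrite /h; field; rewrite gt_eqF//; lra.
Qed.

End hoeffding.

Section empirical_cdf.
Context d {T : measurableType d} {R : realType} (P : probability T R).
Variables (X : nat -> T -> R) (F : R -> R).
Hypotheses (mX : forall i, measurable_fun setT (X i)) (XF : common_cdf P X F).
Hypothesis Xindep : mutually_independent P X.

Definition ecount n (w : T) (x : R) : nat := \sum_(i < n) (X i w <= x)%R.
Definition ecdf n w x : R := (ecount n w x)%:R / n%:R.

Let mle x : measurable_fun setT (fun y : R => (y <= x)%R%:R : R).
Proof.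
rewrite (_ : (fun y => _) = \1_(`]-oo, x]%classic)); first exact: measurable_indic.
by apply/funext => y; rewrite indicE mem_setE in_itv.
Qed.

Let mlt x : measurable_fun setT (fun y : R => (y < x)%R%:R : R).
Proof.
rewrite (_ : (fun y => _) = \1_(`]-oo, x[%classic)); first exact: measurable_indic.
by apply/funext => y; rewrite indicE mem_setE in_itv.
Qed.

Lemma Eindic_le i x : \int[P]_w ((X i w <= x)%R%:R : R) = F x.
Proof.
rewrite (XF i) -(@Ebmf_indic _ _ _ P).
  by apply: eq_Rintegral => w _; rewrite indicE; congr (nat_of_bool _)%:R; apply/idP/idP; rewrite inE.
rewrite (_ : [set w | _] = X i @^-1` `]-oo, x]%classic).
  by rewrite -[Z in measurable Z]setTI; exact: mX.
by apply/seteqP; split => w /=; rewrite in_itv.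
Qed.

Let Eindic_lt i x : \int[P]_w ((X i w < x)%R%:R : R) = Flt P X x.
Proof.
rewrite -(common_cdf_lt mX XF i) -(@Ebmf_indic _ _ _ P).
  by apply: eq_Rintegral => w _; rewrite indicE; congr (nat_of_bool _)%:R; apply/idP/idP; rewrite inE.
rewrite (_ : [set w | _] = X i @^-1` `]-oo, x[%classic).
  by rewrite -[Z in measurable Z]setTI; exact: mX.
by apply/seteqP; split => w /=; rewrite in_itv.
Qed.

Definition hoeffding_bound (n : nat) (s : R) : R := expR (- (n%:R * s ^+ 2 / (4 * (1 + expR 1)))).

Let deviation (I : R -> bool) (p : R) n s : measurable_fun setT (fun y => (I y)%:R : R) ->
  0 <= p <= 1 -> (forall i, \int[P]_w ((I (X i w))%:R : R) = p) -> 0 <= s <= 1 ->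
  exists A : set T, [/\ measurable A, fine (P A) <= 2 * hoeffding_bound n s &
    forall w, ~ A w -> `|\sum_(i < n) (I (X i w))%:R - n%:R * p| <= n%:R * s].
Proof.
move=> mI /andP[p0 p1] Ip s01.
pose g y := (I y)%:R - p; pose g' y := p - (I y)%:R.
have mg : measurable_fun setT g by exact: measurable_funB.
have mg' : measurable_fun setT g' by exact: measurable_funB.
have g1 y : `|g y| <= 1 by rewrite ler_norml /g; case: (I y) => /=; apply/andP; split; lra.
have g1' y : `|g' y| <= 1 by rewrite /g' distrC; exact: g1.
have bI i : bmf (fun w => (I (X i w))%:R : R).
  split; first exact: (measurableT_comp mI).
  by exists 1 => w; case: (I _); rewrite ?normr1 ?normr0.
have Eg i : \int[P]_w g (X i w) = 0.
  by rewrite /g EbmfB//; [rewrite Ip Ebmf_cst subrr|exact: bmf_cst].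
have Eg' i : \int[P]_w g' (X i w) = 0.
  by rewrite /g' EbmfB//; [rewrite Ip Ebmf_cst subrr|exact: bmf_cst].
have mA (f : R -> R) : measurable_fun setT f -> (forall y, `|f y| <= 1) ->
    measurable [set w | n%:R * s <= psum X f n w].
  move=> mf f1; rewrite -[Z in measurable Z]setTI.
  by apply: measurable_fun_le => //; case: (bmf_psum mX mf f1 n).
have mA1 := mA _ mg g1; have mA2 := mA _ mg' g1'.
exists ([set w | n%:R * s <= psum X g n w] `|` [set w | n%:R * s <= psum X g' n w]); split.
- exact: measurableU.
- have H1 := hoeffding mX mg Xindep g1 Eg n s01.
  have H2 := hoeffding mX mg' Xindep g1' Eg' n s01.
  apply: (@le_trans _ _ (hoeffding_bound n s + hoeffding_bound n s)); last by lra.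
  apply: le_trans (lerD H1 H2).
  rewrite -fineD ?fin_num_measure// fine_le ?fin_numD ?fin_num_measure//.
    exact: measurableU.
  exact: measureU2.
- move=> w /not_orP[/negP/=]; rewrite -ltNge => h1 /negP/=; rewrite -ltNge => h2.
  have E1 : psum X g n w = \sum_(i < n) (I (X i w))%:R - n%:R * p.
    by rewrite /psum /g sumrB sumr_const card_ord mulr_natl.
  have E2 : psum X g' n w = n%:R * p - \sum_(i < n) (I (X i w))%:R.
    by rewrite /psum /g' sumrB sumr_const card_ord mulr_natl.
  by rewrite ler_norml; move: h1 h2; rewrite E1 E2 => h1 h2; apply/andP; split; lra.
Qed.

(** Monotonicity reduces the supremum to the quantiles [q j] of order [j / n]: for [F x] between
    [j / n] and [(j + 1) / n], the empirical value at [x] lies between the count of [X i <= q j] and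
    that of [X i < q (j + 1)], and the corresponding probabilities are at least [j / n] and at most
    [(j + 1) / n]. The strict count takes care of atoms; two counts with two sides each give the
    factor 4. *)
Lemma ecdf_uniform n s : (0 < n)%N -> 0 <= s <= 1 ->
  exists A : set T, [/\ measurable A, fine (P A) <= n%:R * (4 * hoeffding_bound n s) &
    forall w x, ~ A w -> `|ecdf n w x - F x| <= s + n%:R^-1].
Proof.
move=> n0 s01.
have F01 y : 0 <= F y <= 1 by rewrite (common_cdf_ge0 mX XF) (common_cdf_le1 mX XF).
have Fhomo := common_cdf_homo mX XF.
have Flt01 y : 0 <= Flt P X y <= 1.
  have mX0 : measurable [set w | X 0%N w < y].
    rewrite (_ : [set w | _] = X 0%N @^-1` `]-oo, y[%classic).
      by rewrite -[Z in measurable Z]setTI; exact: mX.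
    by apply/seteqP; split => w /=; rewrite in_itv.
  by rewrite fine_ge0//= -lee_fin fineK ?fin_num_measure// probability_le1.
have n0' : 0 < n%:R :> R by rewrite ltr0n.
have tail0 : 0 <= hoeffding_bound n s by exact: expR_ge0.
pose q j := Finv F (j%:R / n%:R).
have dev j : exists A : set T, [/\ measurable A, fine (P A) <= 4 * hoeffding_bound n s &
    forall w, ~ A w -> `|ecdf n w (q j) - F (q j)| <= s /\
      `|(\sum_(i < n) (X i w < q j)%R%:R) / n%:R - Flt P X (q j)| <= s].
  have [A1 [mA1 PA1 A1P]] := deviation n (mle (q j)) (F01 (q j)) (fun i => Eindic_le i (q j)) s01.
  have [A2 [mA2 PA2 A2P]] := deviation n (mlt (q j)) (Flt01 (q j)) (fun i => Eindic_lt i (q j)) s01.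
  exists (A1 `|` A2); split; first exact: measurableU.
    apply: (@le_trans _ _ (fine (P A1) + fine (P A2))); last by lra.
    rewrite -fineD ?fin_num_measure// fine_le ?fin_numD ?fin_num_measure//.
      exact: measurableU.
    exact: measureU2.
  move=> w /not_orP[/A1P h1 /A2P h2]; split.
    rewrite /ecdf /ecount natr_sum -(ler_pM2l n0') -[X in X * _](ger0_norm (ltW n0')) -normrM.
    by rewrite mulrBr mulrCA divff ?mulr1// gt_eqF.
  rewrite -(ler_pM2l n0') -[X in X * _](ger0_norm (ltW n0')) -normrM.
  by rewrite mulrBr mulrCA divff ?mulr1// gt_eqF.
have [A Aj] := choice dev.
exists (\big[setU/set0]_(j < n) A j); split.
- by apply: bigsetU_measurable => j _; have [] := Aj j.
- have mA j : measurable (A j) by have [] := Aj j.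
  have mU : measurable (\big[setU/set0]_(j < n) A j) by apply: bigsetU_measurable.
  rewrite -lee_fin fineK ?fin_num_measure//.
  have Bi := @Boole_inequality _ _ _ P A n (fun i _ => mA i).
  apply: le_trans Bi _.
  apply: (@le_trans _ _ (\sum_(j < n) (4 * hoeffding_bound n s)%:E)%E).
    apply: lee_sum => j _; rewrite -[leLHS]fineK ?fin_num_measure// lee_fin.
    by have [] := Aj j.
  by rewrite sumEFin lee_fin sumr_const card_ord [leRHS]mulr_natl.
move=> w x nA.
have dj j : (j < n)%N -> `|ecdf n w (q j) - F (q j)| <= s /\
      `|(\sum_(i < n) (X i w < q j)%R%:R) / n%:R - Flt P X (q j)| <= s.
  move=> jn; have [_ _] := Aj j; apply => Ajw; apply: nA.
  by rewrite -bigcup_mkord; exists j.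
have /andP[Fx0 Fx1] := F01 x.
have [s0 s1] := andP s01.
have ecdf01 : 0 <= ecdf n w x <= 1.
  rewrite divr_ge0//= ler_pdivrMr// mul1r ler_nat -[leqRHS]card_ord -sum1_card leq_sum// => i _.
  exact: leq_b1.
have /andP[G0 G1] := ecdf01.
have nV : 0 < n%:R^-1 :> R by rewrite invr_gt0.
have nn : n%:R / n%:R = 1 :> R by rewrite divff// gt_eqF.
(* The cell of the grid that contains [F x]; the value [F x = 1] is put in the last cell. *)
have [j [jn ju uj]] : exists j : nat, [/\ (j < n)%N, j%:R / n%:R <= F x &
    F x < j.+1%:R / n%:R \/ (j.+1 = n)%N].
  have nF0 : 0 <= n%:R * F x by rewrite mulr_ge0// ltW.
  pose m := Num.truncn (n%:R * F x).
  have [m1 m2] := andP (truncn_itv nF0).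
  have [mn|nm] := ltnP m n.
    exists m; split => //; first by rewrite ler_pdivrMr// mulrC.
    by left; rewrite ltr_pdivlMr// mulrC.
  exists n.-1; rewrite prednK//; split => //; last by right.
  by rewrite ler_pdivrMr// mulrC (le_trans _ m1)// ler_nat (leq_trans _ nm)// leq_pred.
have j1 : j.+1%:R / n%:R = j%:R / n%:R + n%:R^-1 :> R by rewrite -natr1 mulrDl mul1r.
rewrite ler_norml; apply/andP; split.
  have ux : F x <= j%:R / n%:R + n%:R^-1.
    by case: uj => [/ltW|jE]; rewrite -j1// jE nn.
  (* In the first cell there is no quantile to the left; [F x <= 1 / n] and a nonnegative empirical
     value suffice. *)
  have [j0|j0] := posnP j.
    by move: ux; rewrite j0 mul0r; lra.
  have j01 : 0 < (j%:R / n%:R : R) < 1.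
    by apply/andP; split; [apply: divr_gt0; rewrite ltr0n|rewrite ltr_pdivrMr ?mul1r ?ltr_nat].
  have qx : q j <= x by rewrite (Finv_le mX XF _ j01).
  have [/[!ler_norml]/andP[h1 h2] _] := dj j jn.
  have Gq : ecdf n w (q j) <= ecdf n w x.
    rewrite ler_wpM2r ?(ltW nV)// ler_nat leq_sum// => i _.
    by case: (leP (X i w) (q j)) => // H; rewrite (le_trans H qx).
  have Fq : j%:R / n%:R <= F (q j) by rewrite -(Finv_le mX XF _ j01).
  lra.
(* In the last cell [F x >= 1 - 1 / n], and the empirical value is at most 1. *)
case: uj => [uj|jE]; last first.
  have : 1 - n%:R^-1 <= F x by rewrite lerBlDr; apply: le_trans (lerD ju (lexx _)); rewrite -j1 jE nn.
  lra.
have [jn1|jn1] := ltnP j.+1 n; last first.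
  have : 1 - n%:R^-1 <= F x.
    rewrite lerBlDr; apply: le_trans (lerD ju (lexx _)); rewrite -j1 -[leLHS]nn.
    by rewrite ler_wpM2r ?(ltW nV)// ler_nat.
  lra.
have j01 : 0 < (j.+1%:R / n%:R : R) < 1.
  by apply/andP; split; [apply: divr_gt0; rewrite ltr0n|rewrite ltr_pdivrMr ?mul1r ?ltr_nat].
have xq : x < q j.+1 by rewrite (Finv_gt mX XF _ j01).
have [_ /[!ler_norml]/andP[h1 h2]] := dj j.+1 jn1.
have Gq : ecdf n w x <= (\sum_(i < n) (X i w < q j.+1)%R%:R) / n%:R.
  rewrite -natr_sum ler_wpM2r ?(ltW nV)// ler_nat leq_sum// => i _.
  by case: (leP (X i w) x) => // H; rewrite (le_lt_trans H xq).
have := Flt_Finv_le mX XF j01; rewrite -/(q j.+1); lra.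
Qed.


End empirical_cdf.

(** * Layer-cake representations and linearization *)

Section bounded_fubini.
Context d1 d2 (T1 : measurableType d1) (T2 : measurableType d2) (R : realType).
Variables (m1 : {sigma_finite_measure set T1 -> \bar R}).
Variables (m2 : {sigma_finite_measure set T2 -> \bar R}).
Variables (D1 : set T1) (D2 : set T2) (f : T1 * T2 -> R).
Hypotheses (mD1 : measurable D1) (mD2 : measurable D2).
Hypotheses (D1oo : (m1 D1 < +oo)%E) (D2oo : (m2 D2 < +oo)%E) (bf : bmf f).

Let bf1 y : bmf (fun x => f (x, y)).
Proof.
have [mf [B fB]] := bf; split; last by exists B => x.
exact: measurable_fun_pair1.
Qed.

Let bf2 x : bmf (fun y => f (x, y)).
Proof.
have [mf [B fB]] := bf; split; last by exists B => y.
exact: measurable_fun_pair2.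
Qed.

(** Adding [|B|] makes the integrand nonnegative, so that the measurability part of Tonelli applies;
    the constant is subtracted afterwards. *)
Lemma bmf_section_integral : bmf (fun x => \int[m2]_(y in D2) f (x, y)).
Proof.
have [mf [B fB]] := bf.
have iy x : m2.-integrable D2 (EFin \o (fun y => f (x, y))) by exact: bmf_integrable.
split; last first.
  exists (`|B| * fine (m2 D2)) => x.
  apply: le_trans (le_normr_Rintegral mD2 (iy x)) _.
  rewrite -Rintegral_cst//; apply: le_Rintegral => //.
  - by apply: bmf_integrable => //; exact: bmf_norm.
  - by apply: bmf_integrable => //; exact: bmf_cst.
  - by move=> y _; rewrite (le_trans (fB _))// ler_norm.
have E x : \int[m2]_(y in D2) f (x, y) =
    fine (\int[m2]_y (((f (x, y) + `|B|) * \1_D2 y)%:E))%E - `|B| * fine (m2 D2).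
  apply/eqP; rewrite eq_sym subr_eq; apply/eqP.
  rewrite -Rintegral_cst// -RintegralD//; last by apply: bmf_integrable => //; exact: bmf_cst.
  rewrite [RHS]Rintegral_mkcond /Rintegral; congr fine; apply: eq_integral => y _.
  by rewrite patchE indicE; case: ifPn => _; rewrite ?mulr1 ?mulr0.
rewrite (_ : (fun x => _) =
  (fun x => fine (\int[m2]_y (((f (x, y) + `|B|) * \1_D2 y)%:E))%E - `|B| * fine (m2 D2))); last first.
  by apply/funext => x; exact: E.
apply: measurable_funB => //.
apply: measurableT_comp; first exact: fine_measurable.
apply: (@measurable_fun_fubini_tonelli_F _ _ _ _ _ m2
  (fun z => (((f z + `|B|) * \1_D2 z.2)%:E))) => /=.
  apply/measurable_EFinP; apply: measurable_funM; first exact: measurable_funD.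
  by apply: measurableT_comp => //; exact: measurable_indic.
move=> z; rewrite lee_fin mulr_ge0// -lerBlDr sub0r.
by have := fB z; rewrite ler_norml => /andP[+ _]; apply: le_trans; rewrite lerN2 ler_norm.
Qed.

Lemma fubini_bmf : \int[m1]_(x in D1) \int[m2]_(y in D2) f (x, y) =
  \int[m2]_(y in D2) \int[m1]_(x in D1) f (x, y).
Proof.
have [mf [B fB]] := bf.
pose fD := (EFin \o f) \_ (D1 `*` D2).
have iD : (m1 \x m2)%E.-integrable setT fD.
  apply/(integrable_mkcond _ _).1; first exact: measurableX.
  apply: bmf_integrable => //; first exact: measurableX.
  apply: (@le_lt_trans _ _ (m1 D1 * m2 D2)%E); last by rewrite lte_mul_pinfty// ge0_fin_numE.
  by have <- := product_measure1E m1 m2 mD1 mD2.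
have i2 x : m2.-integrable D2 (EFin \o (fun y => f (x, y))) by exact: bmf_integrable.
have i1 y : m1.-integrable D1 (EFin \o (fun x => f (x, y))) by exact: bmf_integrable.
have := Fubini iD.
have -> : (\int[m1]_x \int[m2]_y fD (x, y) =
    \int[m1]_(x in D1) (\int[m2]_(y in D2) f (x, y))%:E)%E.
  rewrite [RHS]integral_mkcond; apply: eq_integral => x _.
  rewrite patchE; case: ifPn => xD.
    rewrite /Rintegral fineK; last exact: (integrable_fin_num mD2 (i2 x)).
    rewrite [RHS]integral_mkcond; apply: eq_integral => y _.
    by rewrite /fD !patchE in_setX/= xD.
  apply: integral0_eq => y _; rewrite /fD patchE in_setX/= (negbTE xD)//.
have -> : (\int[m2]_y \int[m1]_x fD (x, y) =
    \int[m2]_(y in D2) (\int[m1]_(x in D1) f (x, y))%:E)%E.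
  rewrite [RHS]integral_mkcond; apply: eq_integral => y _.
  rewrite patchE; case: ifPn => yD.
    rewrite /Rintegral fineK; last exact: (integrable_fin_num mD1 (i1 y)).
    rewrite [RHS]integral_mkcond; apply: eq_integral => x _.
    by rewrite /fD !patchE in_setX/= yD andbT.
  by apply: integral0_eq => x _; rewrite /fD patchE in_setX/= (negbTE yD) andbF.
by rewrite /Rintegral => ->.
Qed.

End bounded_fubini.

Section clamp.
Context {R : realType}.
Implicit Types a b x y : R.

Definition clamp a b y := Num.max a (Num.min y b).

Lemma clamp_ge a b y : a <= clamp a b y.
Proof. by rewrite le_max lexx. Qed.

Lemma clamp_le a b y : a <= b -> clamp a b y <= b.
Proof. by move=> ab; rewrite ge_max ab ge_min lexx orbT. Qed.

Lemma clamp_id a b y : a <= y -> y <= b -> clamp a b y = y.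
Proof. by move=> ay yb; rewrite /clamp min_l// max_r. Qed.

Lemma clamp_lt a b y : a <= b -> y <= a -> clamp a b y = a.
Proof. by move=> ab ya; rewrite /clamp max_l// ge_min ya. Qed.

Lemma clamp_gt a b y : a <= b -> b <= y -> clamp a b y = b.
Proof. by move=> ab yb; rewrite /clamp min_r// max_r. Qed.

Lemma clamp_lip a b x y : a <= b -> `|clamp a b x - clamp a b y| <= `|x - y|.
Proof.
move=> ab; wlog xy : x y / x <= y.
  move=> H; have [/H//|/ltW/H] := leP x y.
  by rewrite distrC (distrC x).
have [xa|xa] := leP x a; have [yb|yb] := leP y b.
- rewrite (clamp_lt ab xa); have [ya|ya] := leP y a.
    by rewrite (clamp_lt ab ya) subrr normr0.
  rewrite (clamp_id (ltW ya) yb) !ler0_norm ?subr_le0 ?(ltW ya)//; lra.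
- rewrite (clamp_lt ab xa) (clamp_gt ab (ltW yb)) !ler0_norm ?subr_le0//; lra.
- rewrite (clamp_id (ltW xa) (le_trans xy yb)) (clamp_id (le_trans (ltW xa) xy) yb)//.
- rewrite (clamp_gt ab (ltW yb)); have [bx|bx] := leP b x.
    by rewrite (clamp_gt ab bx) subrr normr0.
  rewrite (clamp_id (ltW xa) (ltW bx)) !ler0_norm ?subr_le0 ?(ltW bx)//; lra.
Qed.

Lemma measurable_clamp a b : measurable_fun setT (clamp a b).
Proof. by apply: measurable_maxr => //; exact: measurable_minr. Qed.

End clamp.

Section finite_integral_sums.
Context d (T : measurableType d) (R : realType) (mu : {measure set T -> \bar R}) (D : set T).
Hypotheses (mD : measurable D) (Doo : (mu D < +oo)%E).

Lemma Rintegral_sum_bmf (s : seq nat) (f : nat -> T -> R) : (forall i, bmf (f i)) ->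
  bmf (fun x => \sum_(i <- s) f i x) /\
  \int[mu]_(x in D) (\sum_(i <- s) f i x) = \sum_(i <- s) \int[mu]_(x in D) f i x.
Proof.
move=> bf; elim: s => [|i s [IHb IH]].
  rewrite (_ : (fun x => _) = cst 0); last by apply/funext => x; rewrite big_nil.
  by split; [exact: bmf_cst|rewrite big_nil Rintegral_cst// mul0r].
rewrite (_ : (fun x => _) = (fun x => f i x + \sum_(i <- s) f i x)); last first.
  by apply/funext => x; rewrite big_cons.
split; first exact: bmfD.
by rewrite big_cons -IH RintegralD//; exact: bmf_integrable.
Qed.

End finite_integral_sums.

Section antiderivative.
Context {R : realType}.
Notation leb := (@lebesgue_measure R).
Variables (h : R -> R) (C B : R).
Hypotheses (mh : measurable_fun setT h) (hB : forall u, `|h u| <= B).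
Hypothesis (hC : forall u v, `|h u - h v| <= C * `|u - v|).

Lemma lebesgue_itv_fin (a b : itv_bound R) : (exists u v : R, [set` Interval a b] `<=` `[u, v]) ->
  (leb [set` Interval a b] < +oo)%E.
Proof.
move=> [u [v uv]]; apply: (@le_lt_trans _ _ (leb `[u, v])).
  by apply: le_measure => //; rewrite inE; exact: measurable_itv.
by rewrite lebesgue_measure_itv/=; case: ifPn => _; rewrite ?ltry// -EFinB ltry.
Qed.

Let bh : bmf h. Proof. by split => //; exists B. Qed.

Lemma cc_fin (a b : R) : (leb `[a, b] < +oo)%E.
Proof. by apply: lebesgue_itv_fin; exists a, b. Qed.

Lemma co_fin (a b : R) : (leb `[a, b[ < +oo)%E.
Proof. by apply: lebesgue_itv_fin; exists a, b => x /=; rewrite !in_itv/= => /andP[-> /ltW]. Qed.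

Lemma oc_fin (a b : R) : (leb `]a, b] < +oo)%E.
Proof. by apply: lebesgue_itv_fin; exists a, b => x /=; rewrite !in_itv/= => /andP[/ltW -> ->]. Qed.

Definition primitive (u : R) : R := \int[leb]_(t in `[0, u]) h t.

Lemma integral_primitive_oc u v : 0 <= u -> u <= v ->
  \int[leb]_(t in `]u, v]) h t = primitive v - primitive u.
Proof.
move=> u0 uv; rewrite -(@Rintegral_itvB R h (BLeft 0) (BRight v) u) ?bnd_simp//.
by apply: bmf_integrable => //; exact: cc_fin.
Qed.

Lemma integral_primitive u v : 0 <= u -> u <= v ->
  \int[leb]_(t in `[u, v]) h t = primitive v - primitive u.
Proof.
move=> u0 uv; rewrite -integral_primitive_oc// Rintegral_itv_obnd_cbnd//.
by apply: bmf_integrable => //; exact: oc_fin.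
Qed.

(** The base point [w] is free in [[u, v]], so that expansions at the left and at the right endpoint
    come from the same estimate. *)
Let taylor_right u v w : 0 <= u -> u <= v -> u <= w <= v ->
  `|primitive v - primitive u - h w * (v - u)| <= C * (v - u) ^+ 2.
Proof.
move=> u0 uv /andP[uw wv]; rewrite -integral_primitive//.
have len : fine (leb `[u, v]) = v - u.
  rewrite lebesgue_measure_itv/= lte_fin; case: ifPn => [//|].
  by rewrite -leNgt => vu; rewrite (@le_anti _ _ u v) ?uv// subrr.
rewrite -len -Rintegral_cst// -RintegralB//; last 2 first.
- by apply: bmf_integrable => //; exact: cc_fin.
- by apply: bmf_integrable => //; [exact: cc_fin|exact: bmf_cst].
have bd : bmf (fun t => h t - h w) by apply: bmfB => //; exact: bmf_cst.
apply: le_trans (le_normr_Rintegral _ _) _ => //.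
  by apply: bmf_integrable => //; exact: cc_fin.
rewrite len expr2 mulrA -[X in _ <= _ * X]len -Rintegral_cst//; apply: le_Rintegral => //.
- by apply: bmf_integrable => //; [exact: cc_fin|exact: bmf_norm].
- by apply: bmf_integrable => //; [exact: cc_fin|exact: bmf_cst].
move=> t /=; rewrite in_itv/= => /andP[ut tv].
have C0 : 0 <= C.
  by have := hC 1 0; rewrite subr0 normr1 mulr1; apply: le_trans.
apply: le_trans (hC _ _) _; rewrite ler_wpM2l// ler_norml; apply/andP; split; lra.
Qed.

Lemma primitive_taylor u v : 0 <= u -> 0 <= v ->
  `|primitive v - primitive u - h u * (v - u)| <= C * (v - u) ^+ 2.
Proof.
move=> u0 v0; have [uv|/ltW vu] := leP u v; first by apply: taylor_right => //; rewrite lexx.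
have := @taylor_right v u u v0 vu; rewrite lexx vu => /(_ isT).
rewrite -normrN; rewrite -[X in _ <= _ * X]sqrrN opprB.
by congr (`|_| <= _); ring.
Qed.

Lemma primitive_lip u v : 0 <= u -> 0 <= v -> `|primitive v - primitive u| <= B * `|v - u|.
Proof.
wlog uv : u v / u <= v.
  move=> H u0 v0; have [uv|/ltW vu] := leP u v; first exact: H.
  by rewrite distrC (distrC v) H.
move=> u0 v0; rewrite -integral_primitive//.
have len : fine (leb `[u, v]) = v - u.
  rewrite lebesgue_measure_itv/= lte_fin; case: ifPn => [//|].
  by rewrite -leNgt => vu; rewrite (@le_anti _ _ u v) ?uv// subrr.
apply: le_trans (le_normr_Rintegral _ _) _ => //.
  by apply: bmf_integrable => //; exact: cc_fin.
rewrite ger0_norm ?subr_ge0// -len -Rintegral_cst//; apply: le_Rintegral => //.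
- by apply: bmf_integrable => //; [exact: cc_fin|exact: bmf_norm].
- by apply: bmf_integrable => //; [exact: cc_fin|exact: bmf_cst].
Qed.

(** The inner integral that appears once a layer-cake formula has been exchanged with the integral
    over levels, with [y = F x]. *)
Lemma integral_above (a b y : R) : 0 <= a -> a <= b ->
  \int[leb]_(u in `[a, b]) (h u * (y < u)%R%:R) = primitive b - primitive (clamp a b y).
Proof.
move=> a0 ab; have [ya|ay] := ltP y a.
  rewrite (clamp_lt ab (ltW ya)) -integral_primitive//; apply: eq_Rintegral => u.
  by rewrite inE/= in_itv/= => /andP[au _]; rewrite (lt_le_trans ya)// mulr1.
have [yb|yb] := leP y b; last first.
  rewrite (clamp_gt ab (ltW yb)) subrr (@eq_Rintegral _ _ _ _ _ (fun=> 0)).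
    by rewrite Rintegral_cst// mul0r.
  by move=> u; rewrite inE/= in_itv/= => /andP[_ ub]; rewrite ltNge (le_trans ub (ltW yb)) mulr0.
rewrite (clamp_id ay yb) -integral_primitive_oc ?(le_trans a0)// [RHS]Rintegral_mkcond [LHS]Rintegral_mkcond.
apply: eq_Rintegral => u _; rewrite !patchE !mem_setE !in_itv/=.
have [yu|uy] := ltP y u => /=; first by rewrite (le_trans ay (ltW yu))/= mulr1.
by rewrite mulr0 if_same.
Qed.

(** A finite window [[- M, M)] replaces the improper integrals; [M] cancels in the end. *)
Lemma layer_cake (q M : R) : - M <= q <= M ->
  q = - M + \int[leb]_(x in `[- M, M[) (x < q)%R%:R.
Proof.
move=> /andP[Mq qM].
rewrite (_ : \int[leb]_(x in `[- M, M[) (x < q)%R%:R = \int[leb]_(x in `[-M, q[) 1).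
  have len : fine (leb `[- M, q[) = q + M.
    rewrite lebesgue_measure_itv/= lte_fin; case: ifPn => [_ /=|]; first by rewrite opprK.
    by rewrite -leNgt /= => qM'; apply/le_anti; lra.
  have E : \int[leb]_(x in `[-M, q[) 1 = 1 * (q + M) by rewrite -len -Rintegral_cst.
  by rewrite E; ring.
rewrite [RHS]Rintegral_mkcond [LHS]Rintegral_mkcond.
apply: eq_Rintegral => x _; rewrite !patchE !mem_setE !in_itv/=.
have [xq|qx] := ltP x q; first by rewrite (lt_le_trans xq qM).
by rewrite andbF if_same.
Qed.

(** Discrete counterpart of [integral_above], with the number [N] of observations up to [x] as the
    level. *)
Lemma sum_above (f : nat -> R) (k p N : nat) : (k <= p)%N ->
  \sum_(k.+1 <= i < p.+1) (f i - f i.-1) * (N < i)%N%:R = f p - f (maxn k (minn N p)).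
Proof.
elim: p => [|p IH]; first by rewrite leqn0 => /eqP ->; rewrite big_geq// minn0 max0n subrr.
rewrite leq_eqVlt => /predU1P[->|kp].
  by rewrite big_geq// (maxn_idPl (geq_minr _ _)) subrr.
rewrite ltnS in kp; rewrite big_nat_recr//= IH//.
have [Np|pN] := ltnP N p.+1.
  have -> : minn N p = N by apply/minn_idPl; rewrite -ltnS.
  by rewrite mulr1; ring.
have -> : minn N p = p by apply/minn_idPr; exact: ltnW.
by rewrite (maxn_idPr kp) (maxn_idPr (leqW kp)) mulr0 subrr addr0 subrr.
Qed.

End antiderivative.

(** * Order statistics and counts of observations *)

Section order_statistics.
Context d {T : measurableType d} {R : realType} (X : nat -> T -> R).

Lemma sorted_nth_gt (s : seq R) (x : R) i : sorted <=%O s -> (i < size s)%N ->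
  (x < nth 0 s i) = (count (fun y => y <= x)%R s <= i)%N.
Proof.
elim: s i => [|y s IH] i //= ys si; have ss := path_sorted ys.
have [yx|xy] := leP y x.
  case: i si => [|i] si /=; first by rewrite ltNge yx.
  by rewrite add1n ltnS IH.
have all_gt : all (fun z => y <= z) s by move: ys; rewrite (path_sortedE le_trans) => /andP[].
have c0 : count (fun z => z <= x)%R s = 0%N.
  apply/eqP; rewrite eqn0Ngt -has_count; apply/hasPn => z zs.
  by rewrite -ltNge (lt_le_trans xy)// (allP all_gt).
rewrite c0; case: i si => [|i] si /=; first by rewrite xy.
by rewrite (lt_le_trans xy)// (allP all_gt)// mem_nth.
Qed.

(** The empirical version of [Finv_gt]: order statistics are the quantiles of the empirical
    distribution function. *)
Lemma ostat_gt n i w x : (0 < i <= n)%N -> (x < ostat X n i w) = (ecount X n w x < i)%N.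
Proof.
case: i => // i /= ni; rewrite /ostat sorted_nth_gt/=; last 2 first.
- exact: sort_le_sorted.
- by rewrite size_sort size_map size_iota.
rewrite ltnS; congr (_ <= _)%N.
rewrite (permP (permEl (perm_sort _ _))) count_map -sum1_count /ecount.
rewrite -(big_mkord xpredT (fun i => nat_of_bool (X i w <= x)%R)) /index_iota subn0.
by rewrite big_mkcond/=; apply: eq_bigr => j _; case: (_ <= _).
Qed.

Lemma ecount_homo n w : {homo ecount X n w : x y / x <= y >-> (x <= y)%N}.
Proof.
by move=> x y xy; apply: leq_sum => i _; case: (leP (X i w) x) => // H; rewrite (le_trans H xy).
Qed.

Lemma ecdf_homo n w : {homo ecdf X n w : x y / x <= y}.
Proof. by move=> x y xy; rewrite ler_wpM2r ?invr_ge0// ler_nat ecount_homo. Qed.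

Lemma ecdf_ge0 n w x : 0 <= ecdf X n w x.
Proof. by rewrite divr_ge0. Qed.

End order_statistics.

Lemma clamp_natr (R : realType) (k p N : nat) (c : R) : 0 <= c ->
  (maxn k (minn N p))%:R * c = clamp (k%:R * c) (p%:R * c) (N%:R * c).
Proof.
move=> c0.
have mono (i j : nat) : (i <= j)%N -> i%:R * c <= j%:R * c by move=> ij; rewrite ler_wpM2r// ler_nat.
rewrite /clamp; have -> : Num.min (N%:R * c) (p%:R * c) = (minn N p)%:R * c.
  by have [Np|pN] := leqP N p; [rewrite min_l// mono|rewrite min_r// mono// ltnW].
by have [kq|qk] := leqP k (minn N p); [rewrite max_r// mono|rewrite max_l// mono// ltnW].
Qed.

Section integral_representations.
Context {R : realType}.
Notation leb := (@lebesgue_measure R).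
Variables (h : R -> R) (C B : R).
Hypotheses (mh : measurable_fun setT h) (hB : forall u, `|h u| <= B).
Hypothesis (hC : forall u v, `|h u - h v| <= C * `|u - v|).

Let bh : bmf h. Proof. by split => //; exists B. Qed.

Lemma bmf_primitive_clamp (a b : R) (G : R -> R) : 0 <= a -> a <= b -> measurable_fun setT G ->
  bmf (fun x => primitive h (clamp a b (G x))).
Proof.
move=> a0 ab mG.
have B0 : 0 <= B by apply: le_trans (hB 0).
have pc : continuous (fun y => primitive h (clamp a b y)).
  move=> y; apply/cvgrPdist_le => e e0; near=> z.
  apply: le_trans (primitive_lip mh hB _ _) _; rewrite ?(le_trans a0) ?clamp_ge//.
  apply: (@le_trans _ _ ((B + 1) * `|y - z|)).
    apply: ler_pM => //; first by rewrite lerDl.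
    exact: clamp_lip.
  rewrite -ler_pdivlMl ?ltr_pwDr//.
  near: z; apply/nbhs_ballP; exists ((B + 1)^-1 * e) => /=.
    by rewrite mulr_gt0// invr_gt0 ltr_pwDr.
  by move=> z /ltW.
split.
  exact: (measurableT_comp (continuous_measurable_fun pc)).
exists (B * b) => x.
have := primitive_lip mh hB (lexx 0) (le_trans a0 (clamp_ge a b (G x))).
have -> : primitive h 0 = 0 by rewrite /primitive set_itv1 Rintegral_set1.
rewrite !subr0 => /le_trans; apply; rewrite ler_wpM2l//.
by rewrite ger0_norm ?clamp_le// (le_trans a0)// clamp_ge.
Unshelve. all: by end_near. Qed.

(** Layer cake for each [Q u], exchange of the two integrals, then [integral_above] at the level
    [F x]. *)
Lemma integral_quantile_layer (a b M : R) (F Q : R -> R) : 0 <= a -> a <= b -> 0 <= M ->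
  measurable_fun setT F ->
  (forall u x, a <= u <= b -> (x < Q u) = (F x < u)) ->
  (forall u, a <= u <= b -> - M <= Q u <= M) ->
  \int[leb]_(u in `[a, b]) (h u * Q u) = - M * (primitive h b - primitive h a)
    + \int[leb]_(x in `[- M, M[) (primitive h b - primitive h (clamp a b (F x))).
Proof.
move=> a0 ab M0 mF QF QM.
pose f (z : R * R) := h z.1 * (F z.2 < z.1)%R%:R.
have mf : measurable_fun setT f.
  apply: measurable_funM; first exact: measurableT_comp.
  rewrite (_ : (fun z : R * R => _) = \1_[set z : R * R | F z.2 < z.1]); last first.
    by apply/funext => z; rewrite indicE mem_setE.
  apply: measurable_indic.
  rewrite (_ : [set z | _] = (fun z : R * R => z.1 - F z.2) @^-1` `]0, +oo[%classic).
    rewrite -[Z in measurable Z]setTI.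
    have mm : measurable_fun setT (fun z : R * R => z.1 - F z.2).
      by apply: measurable_funB => //; exact: measurableT_comp.
    exact: mm.
  by apply/seteqP; split => z /=; rewrite in_itv/= andbT subr_gt0.
have bf : bmf f.
  split => //; exists B => z; rewrite /f normrM (le_trans _ (hB z.1))//.
  by rewrite ler_piMr//; case: (_ < _); rewrite ?normr1 ?normr0.
transitivity (\int[leb]_(u in `[a, b]) (- M * h u + \int[leb]_(x in `[- M, M[) f (u, x))).
  apply: eq_Rintegral => u; rewrite inE/= in_itv/= => uab.
  rewrite {1}(layer_cake (QM u uab)) mulrDr mulrC; congr (_ + _).
  rewrite -RintegralZl//.
    by apply: eq_Rintegral => x _; rewrite /f/= QF.
  apply: bmf_integrable => //; first exact: co_fin.
  rewrite (_ : (fun x => _) = \1_(`]-oo, Q u[%classic)); first by apply: bmf_indic.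
  by apply/funext => x; rewrite indicE mem_setE in_itv.
have fin_ab := cc_fin a b; have fin_M := co_fin (- M) M.
rewrite [LHS]RintegralD//; last 2 first.
- by apply: bmf_integrable => //; exact: (bmfZ (- M) bh).
- apply: bmf_integrable => //.
  exact: (@bmf_section_integral _ _ _ _ R leb).
rewrite RintegralZl//; last exact: bmf_integrable.
rewrite (integral_primitive mh hB)//; congr (_ + _).
rewrite (@fubini_bmf _ _ _ _ R leb leb)//; apply: eq_Rintegral => x _.
by rewrite -(integral_above mh hB (F x) a0 ab).
Qed.

(** The same computation with the empirical distribution function. The right-hand side has the shape
    of [integral_quantile_layer], so the constant terms cancel in the difference. *)
Lemma sum_ostat_layer d (T : measurableType d) (X : nat -> T -> R) n k p w (M : R) :
  (0 < n)%N -> (k <= p <= n)%N -> 0 <= M ->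
  (forall i, (0 < i <= n)%N -> - M <= ostat X n i w <= M) ->
  \sum_(k.+1 <= i < p.+1) (primitive h (i%:R / n%:R) - primitive h (i.-1%:R / n%:R)) * ostat X n i w =
  - M * (primitive h (p%:R / n%:R) - primitive h (k%:R / n%:R)) +
  \int[leb]_(x in `[- M, M[) (primitive h (p%:R / n%:R) -
     primitive h (clamp (k%:R / n%:R) (p%:R / n%:R) (ecdf X n w x))).
Proof.
move=> n0 /andP[kp pn] M0 oM.
pose f i : R := primitive h (i%:R / n%:R).
have fin_M := co_fin (- M) M.
have bI i : bmf (fun x : R => (f i - f i.-1) * (ecount X n w x < i)%N%:R).
  apply: bmfZ; split; last by exists 1 => x; case: (_ < _)%N; rewrite ?normr1 ?normr0.
  rewrite (_ : (fun x => _) = (fun x => 1 - (i%:R <= (ecount X n w x)%:R :> R)%R%:R)); last first.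
    by apply/funext => x; rewrite ler_nat ltnNge; case: (_ <= _)%N => /=; rewrite ?subr0 ?subrr.
  apply: measurable_funB => //; apply: nondecreasing_measurable => // x y xy.
  rewrite ler_nat; case: (leP i%:R (ecount X n w x)%:R) => // H.
  by rewrite (le_trans H)// ler_nat ecount_homo.
rewrite (eq_big_nat _ _ (F2 := fun i => - M * (f i - f i.-1) +
   \int[leb]_(x in `[- M, M[) ((f i - f i.-1) * (ecount X n w x < i)%N%:R))); last first.
  move=> i /andP[ki ip]; have i0n : (0 < i <= n)%N by rewrite (leq_trans _ ki)//= (leq_trans _ pn).
  rewrite {1}(layer_cake (oM i i0n)) mulrDr mulrC; congr (_ + _).
  rewrite -RintegralZl//; last first.
    apply: bmf_integrable => //.
    rewrite (_ : (fun x => _) = \1_(`]-oo, ostat X n i w[%classic)); first by apply: bmf_indic.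
    by apply/funext => x; rewrite indicE mem_setE in_itv.
  by apply: eq_Rintegral => x _; rewrite ostat_gt.
rewrite big_split/= -mulr_sumr; congr (- M * _ + _).
  (* With [N = 0] the indicator is always 1 and [sum_above] is the telescoping sum. *)
  have := @sum_above R f k p 0 kp; rewrite min0n maxn0 => <-.
  by apply: eq_big_nat => i /andP[ki _]; rewrite (leq_trans _ ki)// mulr1.
have [_ <-] := @Rintegral_sum_bmf _ _ _ leb `[- M, M[ (measurable_itv _) fin_M (index_iota k.+1 p.+1) _ bI.
apply: eq_Rintegral => x _; rewrite (sum_above f)//.
by rewrite /f clamp_natr ?invr_ge0.
Qed.

End integral_representations.

Section linearization.
Context {R : realType}.
Notation leb := (@lebesgue_measure R).
Variables (h : R -> R) (C B : R).
Hypotheses (mh : measurable_fun setT h) (hB : forall u, `|h u| <= B).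
Hypothesis (hC : forall u v, `|h u - h v| <= C * `|u - v|).
Implicit Types (a b al be dl f g : R).

Let B0 : 0 <= B. Proof. by apply: le_trans (hB 0). Qed.
Let C0 : 0 <= C. Proof. by have := hC 1 0; rewrite subr0 normr1 mulr1; apply: le_trans. Qed.

(** Here [f = F x] and [g] is the empirical value. If [f] is at least about [2 dl] away from [al]
    and [be], then [f] and [g] lie on the same side of both [a] and [b]: either the clamps coincide,
    or neither acts and [primitive_taylor] applies. On the two strips left over, only the Lipschitz
    bound is available. The width [2 dl] is [dl] for [g - f] plus [dl] for the endpoints. *)
Lemma linearization_pointwise a b al be dl f g :
  0 <= a -> a <= b -> al <= be -> 0 <= f -> 0 <= g -> `|g - f| <= dl -> `|a - al| <= dl -> `|b - be| <= dl ->
  `|primitive h (clamp a b g) - primitive h (clamp a b f) - (al <= f < be)%R%:R * (h f * (g - f))| <=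
  2 * B * dl * ((al - 2 * dl <= f < al + 2 * dl)%R%:R + (be - 2 * dl <= f < be + 2 * dl)%R%:R) +
  C * dl ^+ 2 * (al <= f < be)%R%:R.
Proof.
move=> a0 ab albe f0 g0 gf aal bbe.
have /andP[a1 a2] : - dl <= a - al <= dl by rewrite -ler_norml.
have /andP[b1 b2] : - dl <= b - be <= dl by rewrite -ler_norml.
have dl0 : 0 <= dl by exact: le_trans gf.
have /andP[g1 g2] : - dl <= g - f <= dl by rewrite -ler_norml.
have R0 : 0 <= C * dl ^+ 2 * (al <= f < be)%R%:R by rewrite !mulr_ge0.
have Bd : 0 <= 2 * B * dl by rewrite !mulr_ge0.
have gen :
    `|primitive h (clamp a b g) - primitive h (clamp a b f) - (al <= f < be)%R%:R * (h f * (g - f))| <= 2 * B * dl.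
  apply: le_trans (ler_normB _ _) _.
  have h1 : `|primitive h (clamp a b g) - primitive h (clamp a b f)| <= B * dl.
    apply: le_trans (primitive_lip mh hB _ _) _; rewrite ?(le_trans a0) ?clamp_ge//.
    by rewrite ler_wpM2l// (le_trans (clamp_lip _ _ ab)).
  have h2 : `|(al <= f < be)%R%:R * (h f * (g - f))| <= B * dl.
    rewrite normrM -[leRHS]mul1r ler_pM//; first by case: (_ && _); rewrite ?normr1 ?normr0.
    by rewrite normrM ler_pM.
  lra.
have [i1|/negbTE i1] := boolP (al - 2 * dl <= f < al + 2 * dl).
  apply: le_trans gen _; rewrite -[leLHS]addr0 lerD// ler_peMr// lerDl; exact: ler0n.
have [i2|/negbTE i2] := boolP (be - 2 * dl <= f < be + 2 * dl).
  by apply: le_trans gen _; rewrite -[leLHS]addr0 lerD// add0r mulr1.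
rewrite add0r mulr0 add0r; clear gen R0 Bd.
have [f1|f1] := ltP f (al - 2 * dl).
  have -> : (al <= f < be) = false by apply/negbTE; rewrite negb_and -!ltNge; apply/orP; left; lra.
  rewrite mul0r subr0 mulr0 !clamp_lt ?subrr ?normr0//; lra.
have [f2|f2] := leP (be + 2 * dl) f.
  have -> : (al <= f < be) = false by apply/negbTE; rewrite negb_and -leNgt; apply/orP; right; lra.
  rewrite mul0r subr0 mulr0 !clamp_gt ?subrr ?normr0//; lra.
have f3 : al + 2 * dl <= f by rewrite leNgt; apply/negP => f3; rewrite f1 f3 in i1.
have f4 : f < be - 2 * dl by rewrite ltNge; apply/negP => f4; rewrite f4 f2 in i2.
have -> : (al <= f < be) by apply/andP; split; lra.
rewrite mul1r mulr1 !clamp_id; try lra.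
apply: le_trans (primitive_taylor mh hB hC f0 g0) _.
by rewrite ler_wpM2l// -real_normK ?num_real// ler_pXn2r// nnegrE.
Qed.

Variables (F Q : R -> R).
Hypotheses (Fhomo : {homo F : x y / x <= y}) (F0 : forall x, 0 <= F x).
Hypothesis QF : forall u x, 0 < u < 1 -> (x < Q u) = (F x < u).

Let mF : measurable_fun setT F. Proof. exact: nondecreasing_measurable. Qed.

Let QF' u x : 0 < u < 1 -> (Q u <= x) = (u <= F x).
Proof. by move=> u01; rewrite !leNgt QF. Qed.

Let Qhomo p q : 0 < p -> p <= q -> q < 1 -> Q p <= Q q.
Proof.
move=> p0 pq q1.
have p01 : 0 < p < 1 by rewrite p0 (le_lt_trans pq).
have q01 : 0 < q < 1 by rewrite q1 (lt_le_trans p0).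
by rewrite QF'// (le_trans pq)// -QF'.
Qed.

Let levelE p q x : 0 < p < 1 -> 0 < q < 1 ->
  (p <= F x < q)%R%:R = \1_(`[Q p, Q q[%classic) x :> R.
Proof. by move=> p01 q01; rewrite indicE mem_setE in_itv/= -QF'// -QF. Qed.

Lemma bmf_level p q : 0 < p < 1 -> 0 < q < 1 -> bmf (fun x => (p <= F x < q)%R%:R : R).
Proof.
move=> p01 q01; under eq_fun do rewrite levelE//.
by apply: bmf_indic.
Qed.

Lemma integral_level (p q M : R) : 0 < p -> p <= q -> q < 1 -> - M <= Q p -> Q q <= M ->
  \int[leb]_(x in `[- M, M[) ((p <= F x < q)%R%:R : R) = Q q - Q p.
Proof.
move=> p0 pq q1 Mp Mq.
have p01 : 0 < p < 1 by rewrite p0 (le_lt_trans pq).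
have q01 : 0 < q < 1 by rewrite q1 (lt_le_trans p0).
have len : fine (leb `[Q p, Q q[) = Q q - Q p.
  rewrite lebesgue_measure_itv/= lte_fin; case: ifPn => [//|].
  by rewrite -leNgt => qp; rewrite (@le_anti _ _ (Q p) (Q q)) ?subrr// Qhomo.
have E : \int[leb]_(x in `[Q p, Q q[) 1 = 1 * (Q q - Q p) by rewrite -len -Rintegral_cst.
rewrite -[RHS]mul1r -E [RHS]Rintegral_mkcond [LHS]Rintegral_mkcond.
apply: eq_Rintegral => x _; rewrite !patchE levelE// indicE !mem_setE !in_itv/=.
have [H|H] := boolP (Q p <= x < Q q); last by rewrite if_same.
move: H => /andP[px xq].
by rewrite (le_trans Mp px)/= (lt_le_trans xq Mq).
Qed.

Lemma linearization_integral a b al be dl (M : R) (G : R -> R) :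
  0 <= a -> a <= b -> al <= be -> measurable_fun setT G -> (forall x, 0 <= G x) ->
  (forall x, `|G x - F x| <= dl) -> `|a - al| <= dl -> `|b - be| <= dl ->
  0 < al - 2 * dl -> be + 2 * dl < 1 -> - M <= Q (al - 2 * dl) -> Q (be + 2 * dl) <= M ->
  bmf (fun x => h (F x) * (G x - F x)) ->
  `|\int[leb]_(x in `[- M, M[) (primitive h (clamp a b (G x)) - primitive h (clamp a b (F x))) -
    \int[leb]_(x in `[Q al, Q be[) (h (F x) * (G x - F x))| <=
  2 * B * dl * ((Q (al + 2 * dl) - Q (al - 2 * dl)) + (Q (be + 2 * dl) - Q (be - 2 * dl))) +
  C * dl ^+ 2 * (Q be - Q al).
Proof.
move=> a0 ab albe mG G0 GF aal bbe al0 be1 Mal Mbe bhF.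
have dl0 : 0 <= dl by exact: le_trans (GF 0).
have Qle p q : al - 2 * dl <= p -> p <= q -> q <= be + 2 * dl ->
    [/\ 0 < p < 1, 0 < q < 1, - M <= Q p & Q q <= M].
  move=> p1 pq q1.
  have p0 : 0 < p by exact: lt_le_trans p1.
  have q1' : q < 1 by exact: le_lt_trans be1.
  split; first by rewrite p0 (le_lt_trans pq).
  - by rewrite q1' (lt_le_trans p0).
  - by apply: le_trans Mal _; apply: Qhomo => //; exact: le_lt_trans q1'.
  - by apply: le_trans Mbe; apply: Qhomo => //; exact: lt_le_trans pq.
have [||| p1 q1 M1 N1] := Qle (al - 2 * dl) (al + 2 * dl); [lra|lra|lra|].
have [||| p2 q2 M2 N2] := Qle (be - 2 * dl) (be + 2 * dl); [lra|lra|lra|].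
have [||| p3 q3 M3 N3] := Qle al be; [lra|lra|lra|].
have fin_M := co_fin (- M) M.
have -> : \int[leb]_(x in `[Q al, Q be[) (h (F x) * (G x - F x)) =
   \int[leb]_(x in `[- M, M[) ((al <= F x < be)%R%:R * (h (F x) * (G x - F x))).
  rewrite [RHS]Rintegral_mkcond [LHS]Rintegral_mkcond.
  apply: eq_Rintegral => x _; rewrite !patchE levelE// indicE !mem_setE !in_itv/=.
  have [/andP[px xq]|H] := boolP (Q al <= x < Q be); last by rewrite mul0r if_same.
  by rewrite mul1r (le_trans M3 px)/= (lt_le_trans xq N3).
have b1 := bmf_primitive_clamp mh hB a0 ab mG.
have b2 := bmf_primitive_clamp mh hB a0 ab mF.
have b3 : bmf (fun x => (al <= F x < be)%R%:R * (h (F x) * (G x - F x))).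
  by apply: bmfM => //; exact: bmf_level.
have int (f' : R -> R) : bmf f' -> leb.-integrable `[- M, M[ (EFin \o f').
  by move=> bf; apply: bmf_integrable.
rewrite -RintegralB//; [|by apply: int; exact: bmfB|exact: int].
apply: le_trans (le_normr_Rintegral _ _) _ => //.
  by apply: int; apply: bmfB => //; exact: bmfB.
have l1 := bmf_level p1 q1; have l2 := bmf_level p2 q2; have l3 := bmf_level p3 q3.
rewrite -(integral_level _ _ _ M1 N1); [|by case/andP: p1|lra|by case/andP: q1].
rewrite -(integral_level _ _ _ M2 N2); [|by case/andP: p2|lra|by case/andP: q2].
rewrite -(integral_level _ _ _ M3 N3); [|by case/andP: p3|lra|by case/andP: q3].
rewrite -RintegralD//; [|exact: int|exact: int].
rewrite -RintegralZl//; last by apply: int; exact: bmfD.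
rewrite -RintegralZl//; last exact: int.
rewrite -RintegralD//; [|by apply: int; apply: bmfZ; exact: bmfD|by apply: int; exact: bmfZ].
apply: le_Rintegral => //.
- by apply: int; apply: bmf_norm; apply: bmfB => //; exact: bmfB.
- by apply: int; apply: bmfD; [apply: bmfZ; exact: bmfD|exact: bmfZ].
by move=> x _; apply: linearization_pointwise.
Qed.

End linearization.

(** * The influence function *)

Section influence.
Context d {T : measurableType d} {R : realType} (P : probability T R).
Notation leb := (@lebesgue_measure R).
Variables (X : nat -> T -> R) (F : R -> R) (h : R -> R) (B : R).
Hypotheses (mX : forall i, measurable_fun setT (X i)) (XF : common_cdf P X F).
Hypotheses (mh : measurable_fun setT h) (hB : forall u, `|h u| <= B).
Variables (p q : R).
Local Notation E f := (\int[P]_w f w).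
Local Notation S := (`[p, q[%classic : set R).

Definition influence_kernel (z x : R) : R := h (F x) * ((z <= x)%R%:R - F x).

Definition influence (z : R) : R := - \int[leb]_(x in `[p, q[) influence_kernel z x.

Let mF : measurable_fun setT F. Proof. exact: (measurable_common_cdf mX XF). Qed.

Let bF : bmf F.
Proof.
split => //; exists 1 => x.
by rewrite ger0_norm ?(common_cdf_ge0 mX XF)// (common_cdf_le1 mX XF).
Qed.

Let bhF : bmf (fun x => h (F x)).
Proof. by split; [exact: measurableT_comp|exists B]. Qed.

Let ble : bmf (fun z : R * R => (z.1 <= z.2)%R%:R : R).
Proof.
rewrite (_ : (fun z : R * R => _) = \1_[set z : R * R | z.1 <= z.2]); last first.
  by apply/funext => z; rewrite indicE mem_setE.
apply: bmf_indic; rewrite -[Z in measurable Z]setTI.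
by apply: measurable_fun_le.
Qed.

Let bker : bmf (fun z : R * R => influence_kernel z.1 z.2).
Proof.
have [m1 [B1 h1]] := bhF; have [m2 [B2 h2]] := bF.
apply: bmfM.
  by split; [exact: (measurableT_comp m1 measurable_snd)|exists B1 => z].
apply: bmfB => //.
by split; [exact: (measurableT_comp m2 measurable_snd)|exists B2 => z].
Qed.

Let bkerx x : bmf (fun z => influence_kernel z x).
Proof.
have [m [C hC]] := bker; split; last by exists C => z; exact: (hC (z, x)).
exact: (measurable_fun_pair1 x m).
Qed.

Let bkerz z : bmf (fun x => influence_kernel z x).
Proof.
have [m [C hC]] := bker; split; last by exists C => x; exact: (hC (z, x)).
exact: (measurable_fun_pair2 z m).
Qed.

Lemma bmf_influence : bmf influence.
Proof.
apply: bmfN.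
apply: (@bmf_section_integral _ _ _ _ R leb S (fun z => influence_kernel z.1 z.2)) => //.
exact: co_fin.
Qed.

Let bXk i : bmf (fun z : T * R => influence_kernel (X i z.1) z.2).
Proof.
have [m [C hC]] := bker; split; last by exists C => z; exact: (hC (X i z.1, z.2)).
have mp : measurable_fun setT (fun z : T * R => (X i z.1, z.2)).
  apply: measurable_fun_pair => //.
  exact: (measurableT_comp (mX i) measurable_fst).
exact: (measurableT_comp m mp).
Qed.

Let bX i (f : R -> R) : bmf f -> bmf (fun w => f (X i w)).
Proof.
move=> [m [C hC]]; split; last by exists C => w.
exact: (measurableT_comp m).
Qed.

Let bXle i x : bmf (fun w => (X i w <= x)%R%:R : R).
Proof.
apply: (bX i (f := fun z => (z <= x)%R%:R)).
have [m [C hC]] := ble; split; last by exists C => z; exact: (hC (z, x)).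
exact: (measurable_fun_pair1 x m).
Qed.

Let Ekernel i x : E (fun w => influence_kernel (X i w) x) = 0.
Proof.
rewrite /influence_kernel EbmfZ; last by apply: bmfB => //; exact: bmf_cst.
rewrite EbmfB//; last exact: bmf_cst.
by rewrite Ebmf_cst (Eindic_le mX XF) subrr mulr0.
Qed.

(** The Brownian bridge covariance: a product of two indicators is the indicator at the minimum, and
    [F] commutes with minima. *)
Let Ekernel2 i x y : E (fun w => influence_kernel (X i w) x * influence_kernel (X i w) y) =
  h (F x) * h (F y) * (Order.min (F x) (F y) - F x * F y).
Proof.
have minE : Order.min (F x) (F y) = F (Order.min x y).
  have [xy|/ltW yx] := leP x y; [rewrite min_l//|rewrite min_r//].
    exact: (common_cdf_homo mX XF).
  exact: (common_cdf_homo mX XF).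
have E1 : (fun w => influence_kernel (X i w) x * influence_kernel (X i w) y) =
   (fun w => h (F x) * h (F y) * (((X i w <= Order.min x y)%R%:R - F x * (X i w <= y)%R%:R)
      - (F y * (X i w <= x)%R%:R - F x * F y))).
  apply/funext => w; rewrite /influence_kernel le_min.
  by case: (X i w <= x); case: (X i w <= y) => /=; ring.
rewrite E1 EbmfZ; last first.
  apply: bmfB; first by apply: bmfB => //; exact: bmfZ.
  by apply: bmfB; [exact: bmfZ|exact: bmf_cst].
rewrite EbmfB; last 2 first.
- by apply: bmfB => //; exact: bmfZ.
- by apply: bmfB; [exact: bmfZ|exact: bmf_cst].
rewrite EbmfB//; last exact: bmfZ.
rewrite EbmfB; [|exact: bmfZ|exact: bmf_cst].
rewrite (Ebmf_cst P (F x * F y)) !EbmfZ// !(Eindic_le mX XF) minE; ring.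
Qed.

Lemma E_influence i : E (fun w => influence (X i w)) = 0.
Proof.
have bI := bmf_influence.
have -> : E (fun w => influence (X i w)) = - E (fun w => \int[leb]_(x in S) influence_kernel (X i w) x).
  rewrite -mulN1r -EbmfZ; last first.
    by have := bmfN (bX i bI); congr bmf; apply/funext => w; rewrite /influence opprK.
  by apply: eq_Rintegral => w _; rewrite mulN1r.
have PT : (P setT < +oo)%E by apply: (@le_lt_trans _ _ 1%E); [exact: probability_le1|exact: ltry].
rewrite (@fubini_bmf _ _ _ _ R P leb setT S _ measurableT (measurable_itv _) PT (co_fin p q) (bXk i)).
under eq_Rintegral => x _ do rewrite /= Ekernel.
by rewrite Rintegral_cst// mul0r oppr0.
Qed.

(** The square is opened one factor at a time, each exchange of expectation and integral being a
    two-variable Fubini; the two minus signs cancel. *)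
Lemma E_influence2 i : E (fun w => influence (X i w) ^+ 2) =
  \int[leb]_(y in S) \int[leb]_(x in S)
    (h (F x) * h (F y) * (Order.min (F x) (F y) - F x * F y)).
Proof.
have PT : (P setT < +oo)%E by apply: (@le_lt_trans _ _ 1%E); [exact: probability_le1|exact: ltry].
have SF := co_fin p q.
have bI := bX i bmf_influence.
have int_S z : leb.-integrable S (EFin \o influence_kernel z).
  by apply: bmf_integrable => //; exact: (bkerz z).
have b1 : bmf (fun z : T * R => influence (X i z.1) * influence_kernel (X i z.1) z.2).
  apply: bmfM => //; have [m [C hC]] := bI; split; last by exists C => z.
  exact: (measurableT_comp m measurable_fst).
have b2 y : bmf (fun z : T * R => influence_kernel (X i z.1) y * influence_kernel (X i z.1) z.2).
  apply: bmfM => //; have [m [C hC]] := bX i (bkerx y); split; last by exists C => z.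
  exact: (measurableT_comp m measurable_fst).
have inner y : E (fun w => influence (X i w) * influence_kernel (X i w) y) =
    - \int[leb]_(x in S) (h (F x) * h (F y) * (Order.min (F x) (F y) - F x * F y)).
  transitivity (E (fun w => -1 * \int[leb]_(x in S) (influence_kernel (X i w) y * influence_kernel (X i w) x))).
    apply: eq_Rintegral => w _; rewrite RintegralZl//.
    by rewrite /influence; ring.
  rewrite EbmfZ; last exact: (@bmf_section_integral _ _ _ _ R leb S _ _ SF (b2 y)).
  rewrite (@fubini_bmf _ _ _ _ R P leb setT S _ _ _ PT SF (b2 y))// mulN1r; congr (- _).
  apply: eq_Rintegral => x _; rewrite /= -(Ekernel2 i).
  by apply: eq_Rintegral => w _; rewrite mulrC.
transitivity (E (fun w => -1 * \int[leb]_(y in S) (influence (X i w) * influence_kernel (X i w) y))).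
  apply: eq_Rintegral => w _; rewrite RintegralZl//.
  by rewrite expr2 {2}/influence; ring.
rewrite EbmfZ; last exact: (@bmf_section_integral _ _ _ _ R leb S _ _ SF b1).
rewrite (@fubini_bmf _ _ _ _ R P leb setT S _ _ _ PT SF b1)// mulN1r.
under eq_Rintegral => y _ do rewrite /= inner.
have b3 : bmf (fun z : R * R => h (F z.2) * h (F z.1) * (Order.min (F z.2) (F z.1) - F z.2 * F z.1)).
  have c1 (f : R -> R) : bmf f -> bmf (fun z : R * R => f z.1).
    by move=> [m [C hC]]; split; [exact: (measurableT_comp m measurable_fst)|exists C => z].
  have c2 (f : R -> R) : bmf f -> bmf (fun z : R * R => f z.2).
    by move=> [m [C hC]]; split; [exact: (measurableT_comp m measurable_snd)|exists C => z].
  have [m1 _] := c1 _ bF; have [m2 _] := c2 _ bF.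
  apply: bmfM; first by apply: bmfM; [exact: (c2 _ bhF)|exact: (c1 _ bhF)].
  apply: bmfB; last by apply: bmfM; [exact: (c2 _ bF)|exact: (c1 _ bF)].
  split; first exact: measurable_minr.
  by exists 1 => z; rewrite /Order.min; case: ifP => _;
    rewrite ger0_norm ?(common_cdf_ge0 mX XF)// (common_cdf_le1 mX XF).
have b4 := @bmf_section_integral _ _ _ _ R leb S _ (measurable_itv _) SF b3.
rewrite -mulN1r -RintegralZl//; last first.
  by apply: bmf_integrable => //; exact: (bmfN b4).
by apply: eq_Rintegral => y _; rewrite mulN1r opprK.
Qed.

Lemma sum_influence n w : (0 < n)%N ->
  n%:R^-1 * \sum_(i < n) influence (X i w) =
  - \int[leb]_(x in S) (h (F x) * (ecdf X n w x - F x)).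
Proof.
move=> n0; have SF := co_fin p q.
have n0' : n%:R != 0 :> R by rewrite pnatr_eq0 -lt0n.
rewrite -(big_mkord xpredT (fun i => influence (X i w))) sumrN mulrN; congr (- _).
have bk i : bmf (influence_kernel (X i w)) by exact: bkerz.
have [b1 <-] := @Rintegral_sum_bmf _ _ _ leb S (measurable_itv _) SF (index_iota 0 n) _ bk.
rewrite -RintegralZl//; last exact: bmf_integrable.
apply: eq_Rintegral => x _; rewrite big_mkord /influence_kernel -mulr_sumr mulrCA; congr (_ * _).
rewrite sumrB sumr_const card_ord -natr_sum /ecdf -/(ecount X n w x) mulrBr mulrC -[F x *+ n]mulr_natl.
by rewrite mulrA mulVf// mul1r.
Qed.

Variables (nu : {measure set R -> \bar R}).
Let Q := Finv F.
Hypothesis nuQ : forall a b : R, 0 < a -> a <= b -> b < 1 -> nu `[a, b[%classic = (Q b - Q a)%:E.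
Variables (al be : R).
Hypotheses (al0 : 0 < al) (albe : al <= be) (be1 : be < 1).
Hypotheses (pE : p = Q al) (qE : q = Q be).

Let D : set R := `[al, be[%classic.
Let mD : measurable D. Proof. exact: measurable_itv. Qed.
Let mS : measurable S. Proof. exact: measurable_itv. Qed.
Let al01 : 0 < al < 1. Proof. by rewrite al0 (le_lt_trans albe). Qed.
Let be01 : 0 < be < 1. Proof. by rewrite be1 (lt_le_trans al0). Qed.

Let preimD : F @^-1` D = S.
Proof.
apply/seteqP; split => x; rewrite /D /= !in_itv/= pE qE;
  by rewrite (Finv_le mX XF _ al01) (Finv_gt mX XF _ be01).
Qed.

Let push : {measure set R -> \bar R} :=
  measure_function_pushforward__canonical__measure_function_Measure (mrestr leb mS) mF.

(** Both measures are finite on [D] and agree on the half-lines [[x, +oo)], a family stable under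
    intersection: the preimage under [F] of [[max x al, be)] is an interval between quantiles, of
    length the increment that [nu] assigns. *)
Let nu_push A : measurable A -> A `<=` D -> nu A = push A.
Proof.
have key A' : measurable A' -> mrestr nu mD A' = push A'.
  have nuD : nu D = (Q be - Q al)%:E by exact: nuQ.
  apply: (measure_unique (@RGenCInfty.G R) (fun n => `[(- n%:R), +oo[%classic)) => //.
  - exact: RGenCInfty.measurableE.
  - move=> _ _ [x ->] [y ->]; exists (Num.max x y).
    by apply/seteqP; split => z /=; rewrite !in_itv/= !andbT ge_max => /andP.
  - by move=> n; exists (- n%:R).
  - apply/seteqP; split => // z _; exists (Num.bound `|z|) => //=.
    rewrite in_itv/= andbT lerNl; apply/ltW.
    by apply: le_lt_trans (ler_norm _) _; rewrite normrN; exact: archi_boundP.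
  - move=> _ [x ->]; rewrite /mrestr /push/= /pushforward /mrestr -preimD -preimage_setI.
    have [xbe|bex] := leP x be; last first.
      have -> : `[x, +oo[ `&` D = set0.
        apply/seteqP; split => z //= []; rewrite /D /= !in_itv/= andbT => xz /andP[_ zb].
        by have := lt_trans (le_lt_trans xz zb) bex; rewrite ltxx.
      by rewrite preimage_set0 !measure0.
    have mxb : Num.max x al <= be by rewrite ge_max xbe.
    have mx0 : 0 < Num.max x al by rewrite lt_max al0 orbT.
    have -> : `[x, +oo[ `&` D = `[Num.max x al, be[%classic.
      apply/seteqP; split => z /=; rewrite /D /= !in_itv/= ?andbT ge_max.
        by move=> [-> /andP[-> ->]].
      by move=> /andP[/andP[-> ->] ->].
    rewrite nuQ//.
    have mx01 : 0 < Num.max x al < 1 by rewrite mx0 (le_lt_trans mxb).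
    have -> : F @^-1` `[Num.max x al, be[ = `[Q (Num.max x al), Q be[%classic.
      by apply/seteqP; split => z; rewrite /= !in_itv/= (Finv_le mX XF _ mx01) (Finv_gt mX XF _ be01).
    have Qmb : Q (Num.max x al) <= Q be by apply: (Finv_homo mX XF).
    rewrite lebesgue_measure_itv/= lte_fin; case: ifPn => [_|]; first by rewrite EFinB.
    by rewrite -leNgt => bm; rewrite (@le_anti _ _ (Q be) (Q (Num.max x al))) ?subrr// bm.
  - move=> k; apply: (@le_lt_trans _ _ (nu D)); last by rewrite nuD ltry.
    apply: le_measure => //; rewrite inE; last exact: mD.
    by apply: measurableI => //; exact: measurable_itv.
move=> mA AD; rewrite -key//= /mrestr; congr (nu _).
by apply/esym/setIidPl.
Qed.

Lemma integral_nu (f : R -> R) : measurable_fun setT f ->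
  (exists K, forall u, D u -> `|f u| <= K) ->
  \int[nu]_(u in D) f u = \int[leb]_(x in S) f (F x).
Proof.
move=> mf [K fK]; rewrite /Rintegral; congr fine.
rewrite (eq_measure_integral push); last by move=> A mA AD; exact: nu_push.
have E : (\int[push]_(u in D) (f u)%:E =
  \int[mrestr leb mS]_(x in F @^-1` D) ((EFin \o f) \o F) x)%E.
  apply: integral_pushforward => //; first exact/measurable_EFinP.
  rewrite preimD; apply/integrableP; split.
    by apply/measurable_EFinP; apply: measurable_funTS; exact: measurableT_comp.
  apply: (@le_lt_trans _ _ (\int[mrestr leb mS]_(x in S) (`|K|)%:E)%E).
    apply: ge0_le_integral => //.
    - by apply/measurable_EFinP; apply: measurable_funTS; do 2 apply: measurableT_comp => //.
    - move=> x Sx /=; rewrite lee_fin (le_trans (fK _ _))// ?ler_norm//.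
      by have : (F @^-1` D) x by rewrite preimD.
  rewrite integral_cst//= /mrestr setIid lte_mul_pinfty//.
  exact: co_fin.
rewrite E preimD; apply: eq_measure_integral => A mA AS.
by rewrite /= /mrestr; congr (leb _); apply/setIidPl.
Qed.

Lemma E_influence2_sigma2 i (J : R -> R) : (forall u, D u -> J u = h u) ->
  E (fun w => influence (X i w) ^+ 2) = sigma2 nu J al be.
Proof.
move=> Jh; rewrite E_influence2 /sigma2.
have B0 : 0 <= B by apply: le_trans (hB 0).
have D01 u : D u -> 0 <= u <= 1.
  rewrite /D /= in_itv/= => /andP[u1 u2].
  by rewrite (le_trans (ltW al0) u1)/= (le_trans (ltW u2) (ltW be1)).
pose f v u := h u * h v * (Order.min u v - u * v).
have mf v : measurable_fun setT (f v).
  apply: measurable_funM; first exact: measurable_funM.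
  apply: measurable_funB; last exact: measurable_funM.
  exact: measurable_minr.
have fb u v : D u -> D v -> `|f v u| <= B * B.
  move=> /D01/andP[u0 u1] /D01/andP[v0 v1].
  rewrite /f normrM -[leRHS]mulr1 ler_pM//; first by rewrite normrM ler_pM.
  rewrite ler_norml /Order.min; case: ltP => uv; apply/andP; split; nra.
have step v : D v -> \int[nu]_(u in D) (J u * J v * (Order.min u v - u * v)) =
    \int[leb]_(x in S) f v (F x).
  move=> Dv; rewrite -integral_nu//; last by exists (B * B) => u Du; exact: fb.
  by apply: eq_Rintegral => u /[!inE] Du; rewrite /f !Jh.
transitivity (\int[nu]_(v in D) \int[leb]_(x in S) f v (F x)); last first.
  by apply: eq_Rintegral => v /[!inE] Dv; rewrite -step.
have F01 x : 0 <= F x <= 1 by rewrite (common_cdf_ge0 mX XF) (common_cdf_le1 mX XF).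
(* [f v] is unbounded in [v]; clamping [v] to [[0, 1]] changes nothing on [D] and makes the
   integrand bounded on the whole plane, as [bmf_section_integral] requires. *)
have cl01 (v : R) : 0 <= clamp 0 1 v <= 1 by rewrite clamp_ge clamp_le.
have clid (v : R) : 0 <= v <= 1 -> clamp 0 1 v = v by move=> /andP[v0 v1]; exact: clamp_id.
have bfc : bmf (fun z : R * R => f (clamp 0 1 z.1) (F z.2)).
  have c1 (g : R -> R) : bmf g -> bmf (fun z : R * R => g z.1).
    by move=> [m [C hC]]; split; [exact: (measurableT_comp m measurable_fst)|exists C => z].
  have c2 (g : R -> R) : bmf g -> bmf (fun z : R * R => g z.2).
    by move=> [m [C hC]]; split; [exact: (measurableT_comp m measurable_snd)|exists C => z].
  have bcl : bmf (clamp 0 1 : R -> R).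
    split; first exact: measurable_clamp.
    by exists 1 => v; case/andP: (cl01 v) => v0 v1; rewrite ger0_norm.
  have bhcl : bmf (fun v => h (clamp 0 1 v)).
    by split; [case: bcl => m _; exact: (measurableT_comp mh m)|exists B].
  have [m1 _] := c1 _ bcl; have [m2 _] := c2 _ bF.
  apply: bmfM; first by apply: bmfM; [exact: (c2 _ bhF)|exact: (c1 _ bhcl)].
  apply: bmfB; last by apply: bmfM; [exact: (c2 _ bF)|exact: (c1 _ bcl)].
  split; first exact: measurable_minr.
  exists 1 => z; case/andP: (cl01 z.1) => v0 v1; case/andP: (F01 z.2) => u0 u1.
  by rewrite /Order.min; case: ifP => _; rewrite ger0_norm.
have [mI [K hK]] := @bmf_section_integral _ _ _ _ R leb S _ (measurable_itv _) (co_fin p q) bfc.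
transitivity (\int[nu]_(v in D) \int[leb]_(x in S) f (clamp 0 1 v) (F x)); last first.
  by apply: eq_Rintegral => v /[!inE] /D01 v01; rewrite clid.
rewrite (integral_nu mI); last by exists K => u _.
by apply: eq_Rintegral => y _ /=; apply: eq_Rintegral => x _; rewrite clid.
Qed.

End influence.

(** * The remainder *)

Section measurable_order_statistics.
Context d {T : measurableType d} {R : realType} (X : nat -> T -> R).
Hypothesis mX : forall i, measurable_fun setT (X i).

Lemma measurable_ostat n i : (0 < i <= n)%N -> measurable_fun setT (ostat X n i).
Proof.
move=> i0n; apply: (measurability _ (RGenOInfty.measurableE R)) => //.
move=> _ [_ [x ->] <-]; rewrite setTI.
have mc : measurable_fun setT (fun w => (ecount X n w x)%:R : R).
  rewrite /ecount (_ : (fun w => _) = (fun w => \sum_(j < n) (X j w <= x)%R%:R)); last first.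
    by apply/funext => w; rewrite natr_sum.
  apply: measurable_sum => j.
  rewrite (_ : (fun w => _) = \1_(X j @^-1` `]-oo, x]%classic)).
    by apply: measurable_indic; rewrite -[Z in measurable Z]setTI; exact: mX.
  by apply/funext => w; rewrite indicE; congr (nat_of_bool _)%:R; apply/idP/idP; rewrite inE/= in_itv.
rewrite (_ : _ @^-1` _ = (fun w => (ecount X n w x)%:R : R) @^-1` `]-oo, (i%:R : R)[%classic).
  by rewrite -[Z in measurable Z]setTI; exact: mc.
by apply/seteqP; split => w /=; rewrite !in_itv/= andbT ostat_gt// ltr_nat.
Qed.

Lemma measurable_Lstat (c : nat -> nat -> R) (k m : nat -> nat) n :
  measurable_fun setT (Lstat X c k m n).
Proof.
apply: measurable_funM => //.
rewrite (_ : (fun w => _) = (fun w => \sum_(i <- index_iota (k n + 1) (n - m n).+1)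
   (if (0 < i <= n)%N then c i n * ostat X n i w else 0))); last first.
  apply/funext => w; rewrite big_nat [RHS]big_nat; apply: eq_bigr => i /andP[ki im].
  by rewrite (leq_trans _ ki) ?addn1//= (leq_trans (_ : i <= n - m n)%N) ?leq_subr.
apply: measurable_sum => i; have [i0n|_] := boolP (0 < i <= n)%N; last exact: measurable_cst.
by apply: measurable_funM => //; exact: measurable_ostat.
Qed.

Lemma ostat_abs_le n i w : (0 < i <= n)%N -> `|ostat X n i w| <= \sum_(j < n) `|X j w|.
Proof.
move=> /andP[i0 ni]; have : ostat X n i w \in [seq X j w | j <- iota 0 n].
  rewrite -(mem_sort <=%O) mem_nth// size_sort size_map size_iota prednK//.
move=> /mapP[j]; rewrite mem_iota/= add0n => jn ->.
rewrite (bigD1 (Ordinal jn))//= lerDl sumr_ge0//.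
Qed.

End measurable_order_statistics.

Lemma norm_between (R : realDomainType) (lo hi x : R) :
  lo <= x <= hi -> `|x| <= `|lo| + `|hi|.
Proof.
move=> /andP[lx xh]; have := ler_norm (- lo); rewrite normrN.
have := ler_norm hi; have := normr_ge0 hi; have := normr_ge0 lo.
by rewrite ler_norml => *; apply/andP; split; lra.
Qed.

Section remainder.
Context d {T : measurableType d} {R : realType} (P : probability T R).
Notation leb := (@lebesgue_measure R).
Variables (X : nat -> T -> R) (F : R -> R) (h : R -> R) (C B : R).
Hypotheses (mX : forall i, measurable_fun setT (X i)) (XF : common_cdf P X F).
Hypotheses (mh : measurable_fun setT h) (hB : forall u, `|h u| <= B).
Hypothesis (hC : forall u v, `|h u - h v| <= C * `|u - v|).
Variables (k m : nat -> nat) (c : nat -> nat -> R) (J : R -> R) (n : nat) (al be dl : R).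
Local Notation Q := (Finv F).
Local Notation a := ((k n)%:R / n%:R : R).
Local Notation b := (1 - (m n)%:R / n%:R : R).
Hypotheses (n0 : (0 < n)%N) (kmn : (k n < n - m n)%N).
Hypotheses (albe : al <= be) (aal : `|a - al| <= dl) (bbe : `|b - be| <= dl).
Hypotheses (al0 : 0 < al - 2 * dl) (be1 : be + 2 * dl < 1).
Hypothesis Jh : forall u, a <= u <= b -> J u = h u.
Variable w : T.
Hypothesis Gw : forall x, `|ecdf X n w x - F x| <= dl.

Let dl0 : 0 <= dl. Proof. exact: le_trans (Gw 0). Qed.
Let n0' : 0 < n%:R :> R. Proof. by rewrite ltr0n. Qed.
Let mn : (m n <= n)%N.
Proof. by rewrite ltnW// -subn_gt0; exact: leq_ltn_trans kmn. Qed.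
Let bE : b = (n - m n)%:R / n%:R.
Proof. by rewrite natrB// mulrBl divff// gt_eqF. Qed.
Let ab : a <= b.
Proof. by rewrite bE ler_wpM2r ?invr_ge0 ?ler0n// ler_nat ltnW. Qed.
Let a0 : 0 <= a. Proof. by rewrite divr_ge0. Qed.
Let aab : al - dl <= a /\ b <= be + dl.
Proof.
move: aal bbe; rewrite !ler_norml => /andP[h1 _] /andP[_ h2]; split; lra.
Qed.
Let lo01 : 0 < al - 2 * dl < 1.
Proof. by rewrite al0/=; have := dl0; have := albe; have := be1; lra. Qed.
Let hi01 : 0 < be + 2 * dl < 1.
Proof. by rewrite be1 andbT; have := dl0; have := albe; have := al0; lra. Qed.

(** The level [i / n] lies in [[a, b]], within [dl] of [[al, be]], and the empirical function within
    [dl] of [F]. This bounds the order statistics that multiply [c - c0], without any moment of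
    [X]. *)
Lemma ostat_trimmed i : (k n < i <= n - m n)%N ->
  Q (al - 2 * dl) <= ostat X n i w <= Q (be + 2 * dl).
Proof.
move=> /andP[ki im]; have [a1 b1] := aab.
have i0n : (0 < i <= n)%N by rewrite (leq_trans _ ki)//= (leq_trans im)// leq_subr.
apply/andP; split; rewrite leNgt; apply/negP => H.
  (* An order statistic does not exceed itself; [ostat_gt] reads this as: at least [i] observations
     are at most the [i]-th one. *)
  have := ltxx (ostat X n i w); rewrite ostat_gt// => /negbT; rewrite -leqNgt => iN.
  have : i%:R / n%:R <= ecdf X n w (ostat X n i w) by rewrite ler_wpM2r ?invr_ge0 ?ler0n// ler_nat.
  have : a <= i%:R / n%:R by rewrite ler_wpM2r ?invr_ge0 ?ler0n// ler_nat ltnW.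
  have := Gw (ostat X n i w); rewrite ler_norml => /andP[_].
  by move: H; rewrite (Finv_gt mX XF _ lo01); lra.
have := H; rewrite ostat_gt// => Ni.
have : ecdf X n w (Q (be + 2 * dl)) < b.
  by rewrite bE ltr_pM2r ?invr_gt0// ltr_nat (leq_trans Ni).
have := Gw (Q (be + 2 * dl)); rewrite ler_norml => /andP[+ _].
have : be + 2 * dl <= F (Q (be + 2 * dl)) by rewrite -(Finv_le mX XF _ hi01).
lra.
Qed.

Let c0E i : (k n < i <= n - m n)%N ->
  n%:R^-1 * c0 J i n = primitive h (i%:R / n%:R) - primitive h (i.-1%:R / n%:R).
Proof.
move=> /andP[ki im]; rewrite /c0 mulrA mulVf ?gt_eqF// mul1r.
have ii : i.-1%:R / n%:R <= i%:R / n%:R :> R by rewrite ler_wpM2r ?invr_ge0 ?ler0n// ler_nat leq_pred.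
have p0 : 0 <= i.-1%:R / n%:R :> R by rewrite divr_ge0 ?ler0n.
rewrite -(integral_primitive mh hB p0 ii).
apply: eq_Rintegral => u; rewrite inE/= in_itv/= => /andP[u1 u2]; apply: Jh.
rewrite (le_trans _ u1)/=; last by rewrite ler_wpM2r ?invr_ge0 ?ler0n// ler_nat -ltnS (ltn_predK ki).
by rewrite (le_trans u2)// bE ler_wpM2r ?invr_ge0 ?ler0n// ler_nat.
Qed.

Lemma remainder_bound :
  `|Lstat X c k m n w - mu_n J F k m n
     - n%:R^-1 * \sum_(i < n) influence F h (Q al) (Q be) (X i w)| <=
  n%:R^-1 * (\sum_(k n + 1 <= i < (n - m n).+1) `|c i n - c0 J i n|) *
    (`|Q (al - 2 * dl)| + `|Q (be + 2 * dl)|) +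
  (2 * B * dl * ((Q (al + 2 * dl) - Q (al - 2 * dl)) + (Q (be + 2 * dl) - Q (be - 2 * dl))) +
   C * dl ^+ 2 * (Q be - Q al)).
Proof.
have [a1 b1] := aab.
(* A window containing all order statistics and all quantiles involved. It may depend on [w], as its
   contributions to [Lstat] and [mu_n] cancel. *)
pose M := \sum_(j < n) `|X j w| + (`|Q (al - 2 * dl)| + `|Q (be + 2 * dl)|).
have s0 : 0 <= \sum_(j < n) `|X j w| by rewrite sumr_ge0.
have M0 : 0 <= M by rewrite !addr_ge0.
have lowM : - M <= Q (al - 2 * dl).
  by have := ler_norm (- Q (al - 2 * dl)); rewrite normrN /M; have := normr_ge0 (Q (be + 2 * dl)); lra.
have hiM : Q (be + 2 * dl) <= M.
  by have := ler_norm (Q (be + 2 * dl)); rewrite /M; have := normr_ge0 (Q (al - 2 * dl)); lra.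
have oM i : (0 < i <= n)%N -> - M <= ostat X n i w <= M.
  move=> i0n; rewrite -ler_norml (le_trans (ostat_abs_le _ _ i0n))//.
  by rewrite lerDl addr_ge0.
have u01 u : a <= u <= b -> 0 < u < 1.
  move=> /andP[au ub]; have [+ +] := (al0, be1); have := dl0.
  by move=> *; apply/andP; split; lra.
have QM u : a <= u <= b -> - M <= Q u <= M.
  move=> uab; have /andP[u0 u1] := u01 _ uab; move: uab => /andP[au ub]; have := dl0 => d0.
  apply/andP; split.
    by apply: le_trans lowM _; apply: (Finv_homo mX XF) => //; lra.
  by apply: le_trans hiM; apply: (Finv_homo mX XF) => //; lra.
have mF := measurable_common_cdf mX XF.
have muE : mu_n J F k m n = - M * (primitive h b - primitive h a)
    + \int[leb]_(x in `[- M, M[) (primitive h b - primitive h (clamp a b (F x))).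
  rewrite -(integral_quantile_layer mh hB (Q := Q) a0 ab M0 mF)//.
    rewrite /mu_n; apply: eq_Rintegral => u; rewrite inE/= in_itv/= => uab.
    by rewrite Jh.
  by move=> u x /u01 H; rewrite (Finv_gt mX XF).
have LE : Lstat X c k m n w =
    n%:R^-1 * (\sum_(k n + 1 <= i < (n - m n).+1) (c i n - c0 J i n) * ostat X n i w) +
    \sum_((k n).+1 <= i < (n - m n).+1) (primitive h (i%:R / n%:R) - primitive h (i.-1%:R / n%:R)) * ostat X n i w.
  rewrite /Lstat addn1 !mulr_sumr -big_split/=; apply: eq_big_nat => i ki.
  by rewrite -c0E//; ring.
have kpn : (k n <= n - m n <= n)%N by rewrite ltnW//= leq_subr.
have := sum_ostat_layer h n0 kpn M0 oM; rewrite -bE => sE.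
rewrite (sum_influence mX XF mh hB)// LE sE muE.
have mG : measurable_fun setT (ecdf X n w).
  by apply: nondecreasing_measurable => // x y; exact: ecdf_homo.
have fin_M := co_fin (- M) M.
have intB (f1 f2 : R -> R) : bmf f1 -> bmf f2 -> \int[leb]_(x in `[- M, M[) (f1 x - f2 x) =
    \int[leb]_(x in `[- M, M[) f1 x - \int[leb]_(x in `[- M, M[) f2 x.
  by move=> b1' b2'; rewrite RintegralB//; exact: bmf_integrable.
have bG := bmf_primitive_clamp mh hB a0 ab mG.
have bF := bmf_primitive_clamp mh hB a0 ab mF.
have bc : bmf (fun _ : R => primitive h b) by exact: bmf_cst.
have bhF : bmf (fun x => h (F x) * (ecdf X n w x - F x)).
  apply: bmfM; first by split; [exact: (measurableT_comp mh mF)|exists B].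
  split; first exact: measurable_funB.
  by exists dl.
have Fg x : 0 <= F x by exact: (common_cdf_ge0 mX XF).
have Gg x : 0 <= ecdf X n w x by exact: ecdf_ge0.
have lin := linearization_integral mh hB hC (common_cdf_homo mX XF) Fg (Q := Q)
  (fun u x u01 => Finv_gt mX XF x u01) a0 ab albe mG Gg Gw aal bbe al0 be1 lowM hiM bhF.
pose I0 : R := \int[leb]_(x in `[- M, M[) primitive h b.
pose I1 : R := \int[leb]_(x in `[- M, M[) primitive h (clamp a b (ecdf X n w x)).
pose I2 : R := \int[leb]_(x in `[- M, M[) primitive h (clamp a b (F x)).
have e1 : \int[leb]_(x in `[- M, M[) (primitive h b - primitive h (clamp a b (ecdf X n w x))) = I0 - I1.
  exact: (intB _ _ bc bG).
have e2 : \int[leb]_(x in `[- M, M[) (primitive h b - primitive h (clamp a b (F x))) = I0 - I2.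
  exact: (intB _ _ bc bF).
have e3 : \int[leb]_(x in `[- M, M[) (primitive h (clamp a b (ecdf X n w x)) - primitive h (clamp a b (F x))) =
    I1 - I2.
  exact: (intB _ _ bG bF).
rewrite e3 in lin; rewrite e1 e2; move: lin.
set I3 := \int[leb]_(x in `[Q al, Q be[) _ => lin; set A := n%:R^-1 * _.
rewrite (_ : A + _ - _ - _ = A - (I1 - I2 - I3)); last by ring.
apply: le_trans (ler_normB _ _) _; apply: lerD; last exact: lin.
rewrite /A normrM ger0_norm ?invr_ge0 ?ler0n// -mulrA; apply: ler_wpM2l; first by rewrite invr_ge0 ler0n.
apply: le_trans (ler_norm_sum _ _ _) _; rewrite mulr_suml.
rewrite [leLHS]big_nat [leRHS]big_nat; apply: ler_sum => i /andP[ki im].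
rewrite normrM ler_wpM2l//.
apply: norm_between.
by apply: ostat_trimmed; rewrite -addn1 ki.
Qed.

End remainder.

(** * Asymptotics *)

Section lipschitz_extension.
Context {R : realType}.

Lemma lipschitz_measurable (h : R -> R) (C : R) :
  (forall u v, `|h u - h v| <= C * `|u - v|) -> measurable_fun setT h.
Proof.
move=> hC; have C0 : 0 <= C.
  by have := hC 1 0; rewrite subr0 normr1 mulr1; apply: le_trans.
apply: continuous_measurable_fun => y; apply/cvgrPdist_le => e e0; near=> z.
apply: le_trans (hC _ _) _.
apply: (@le_trans _ _ ((C + 1) * `|y - z|)); first by rewrite ler_wpM2r// lerDl.
rewrite -ler_pdivlMl ?ltr_pwDr//.
near: z; apply/nbhs_ballP; exists ((C + 1)^-1 * e) => /=.
  by rewrite mulr_gt0// invr_gt0 ltr_pwDr.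
by move=> z /ltW.
Unshelve. all: by end_near. Qed.

(** Composing [J] with the projection onto [[al - r, be + r]] gives a bounded Lipschitz function on
    the line. The margin [r] is there because [k_n / n] and [1 - m_n / n] may fall slightly outside
    [[al, be]]. *)
Lemma lipschitz_extension (J : R -> R) (I : set R) (al be C : R) :
  open I -> `[al, be] `<=` I -> I `<=` `]0, 1[ -> al <= be -> 0 <= C ->
  (forall u v, I u -> I v -> `|J u - J v| <= C * `|u - v|) ->
  exists h B r, [/\ 0 < r, (forall u, `|h u| <= B),
    (forall u v, `|h u - h v| <= C * `|u - v|) &
    forall u, al - r <= u <= be + r -> J u = h u].
Proof.
move=> oI abI I01 albe C0 JC.
have Ial : I al by apply: abI; rewrite /= in_itv/= lexx.
have Ibe : I be by apply: abI; rewrite /= in_itv/= lexx andbT.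
have /nbhs_ballP[r1 /= r10 H1] := open_nbhs_nbhs (conj oI Ial).
have /nbhs_ballP[r2 /= r20 H2] := open_nbhs_nbhs (conj oI Ibe).
pose r := Num.min r1 r2 / 2.
have m1 : Num.min r1 r2 <= r1 by rewrite ge_min lexx.
have m2 : Num.min r1 r2 <= r2 by rewrite ge_min lexx orbT.
have rr1 : r < r1 by rewrite /r; lra.
have rr2 : r < r2 by rewrite /r; lra.
have r0 : 0 < r by rewrite divr_gt0// lt_min r10.
have inI u : al - r <= u <= be + r -> I u.
  move=> /andP[u1 u2]; have [ua|ua] := ltP u al.
    by apply: H1; rewrite /ball/= ger0_norm ?subr_ge0 ?ltW//; lra.
  have [ub|ub] := leP u be; first by apply: abI; rewrite /= in_itv/= ua.
  by apply: H2; rewrite /ball/= ltr0_norm ?subr_lt0//; lra.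
have ab : al - r <= be + r by lra.
have cI u : I (clamp (al - r) (be + r) u) by apply: inI; rewrite clamp_ge clamp_le.
exists (J \o clamp (al - r) (be + r)), (`|J al| + C), r; split => //=.
- move=> u; rewrite -[X in `|X|](subrK (J al)) (le_trans (ler_normD _ _))// addrC lerD2l.
  apply: le_trans (JC _ _ (cI u) Ial) _; rewrite ler_piMr//.
  have := I01 _ (cI u); have := I01 _ Ial; rewrite /= !in_itv/= => /andP[p1 p2] /andP[p3 p4].
  by rewrite ler_norml; apply/andP; split; lra.
- move=> u v; apply: le_trans (JC _ _ (cI u) (cI v)) _.
  by rewrite ler_wpM2l// clamp_lip.
- by move=> u /andP[u1 u2]; rewrite clamp_id.
Qed.

End lipschitz_extension.

Section sandwich.
Context d {T : measurableType d} {R : realType} (P : probability T R).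
Implicit Types (x th r H : R).

(** Off [Bad] the event [A] lies between two events about the approximation [W], with thresholds
    moved by [th]; moderate deviations for [W] and [Phi_tail_near] then transfer to [A]. *)
Lemma tail_sandwich (W : T -> R) (A Bad : set T) x th r H :
  measurable_fun setT W -> measurable A -> measurable Bad ->
  0 <= th -> `|x| + th <= H -> th * (1 + H) / kap <= r -> 0 < r <= 4^-1 ->
  fine (P Bad) <= r * (1 - Phi x) ->
  (forall y, `|y - x| <= th -> (1 - 4 * r) * (1 - Phi y) <= fine (P [set w | y < W w]) <=
     (1 + 8 * r) * (1 - Phi y)) ->
  (forall w, ~ Bad w -> A w -> x - th < W w) ->
  (forall w, ~ Bad w -> x + th < W w -> A w) ->
  `|fine (P A) / (1 - Phi x) - 1| <= 15 * r.
Proof.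
move=> mW mA mB th0 xH thr /andP[r0 r4] PB md i1 i2.
have H0 : 0 <= H by apply: le_trans xH; rewrite addr_ge0.
have r2 : r <= 2^-1 by apply: le_trans r4 _; rewrite lef_pV2// ?posrE// ler_nat.
have Qx := Phi_tail_gt0 x.
have mgt y : measurable [set w | y < W w].
  rewrite (_ : [set w | _] = W @^-1` `]y, +oo[%classic).
    by rewrite -[X in measurable X]setTI; exact: mW.
  by apply/seteqP; split => w /=; rewrite in_itv/= andbT.
have PU (U V : set T) : measurable U -> measurable V -> U `<=` V `|` Bad ->
    fine (P U) <= fine (P V) + fine (P Bad).
  move=> mU mV UV; rewrite -fineD ?fin_num_measure// fine_le ?fin_numD ?fin_num_measure//.
  apply: le_trans (measureU2 P mV mB).
  by apply: le_measure => //; rewrite inE//; exact: measurableU.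
have up : fine (P A) <= fine (P [set w | x - th < W w]) + fine (P Bad).
  apply: PU => // w Aw; have [Bw|Bw] := pselect (Bad w); first by right.
  by left; exact: i1.
have lo : fine (P [set w | x + th < W w]) <= fine (P A) + fine (P Bad).
  apply: PU => // w Aw; have [Bw|Bw] := pselect (Bad w); first by right.
  by left; exact: i2.
have d1 : `|x - th - x| <= th by rewrite addrAC subrr add0r normrN ger0_norm.
have d2 : `|x + th - x| <= th by rewrite addrAC subrr add0r ger0_norm.
have := md _ d1; move=> /andP[_ up'].
have := md _ d2; move=> /andP[lo' _].
have xH' : x <= H by rewrite (le_trans (ler_norm x))// (le_trans _ xH)// lerDl.
have n1 : 1 - Phi (x - th) <= (1 + 2 * r) * (1 - Phi x).
  apply: (Phi_tail_near d1 _ H0 thr r2).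
  by rewrite (le_trans (ler_norm _))// (le_trans (ler_normB _ _))// (ger0_norm th0).
have n2 : 1 - Phi x <= (1 + 2 * r) * (1 - Phi (x + th)).
  by apply: (Phi_tail_near _ xH' H0 thr r2); rewrite distrC.
move: (fine (P A)) (fine (P Bad)) (fine (P [set w | x - th < W w])) (fine (P [set w | x + th < W w]))
  up lo up' lo' PB => pA pB p1 p2 up lo up' lo' PB.
move: (1 - Phi (x - th)) (1 - Phi (x + th)) n1 n2 up' lo' => q1 q2 n1 n2 up' lo'.
move: (1 - Phi x) Qx PB n1 n2 => q q0 PB n1 n2.
have n3 : (1 - 2 * r) * q <= q2.
  have h1 : (1 - 2 * r) * q <= (1 - 2 * r) * ((1 + 2 * r) * q2) by rewrite ler_wpM2l//; lra.
  apply: le_trans h1 _; rewrite mulrA ler_piMl//; last by nra.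
  have : 0 <= (1 + 2 * r) * q2 by exact: le_trans (ltW q0) n2.
  by rewrite pmulr_rge0//; lra.
(* [(1 + 8 r) (1 + 2 r) + r = 1 + 11 r + 16 r^2], and [16 r^2 <= 4 r]: this is the 15. *)
have u1 : pA <= (1 + 15 * r) * q.
  have : (1 + 8 * r) * q1 <= (1 + 8 * r) * ((1 + 2 * r) * q) by rewrite ler_wpM2l//; lra.
  have : r * (r * q) <= 4^-1 * (r * q) by rewrite ler_wpM2r// mulr_ge0// ltW.
  lra.
have l1 : (1 - 15 * r) * q <= pA.
  have r41 : 0 <= 1 - 4 * r by lra.
  have : (1 - 4 * r) * ((1 - 2 * r) * q) <= (1 - 4 * r) * q2 by rewrite ler_wpM2l.
  have : 0 <= r * (r * q) by rewrite !mulr_ge0// ltW.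
  have : 0 <= r * q by rewrite mulr_ge0// ltW.
  lra.
rewrite ler_norml; apply/andP; split.
  by rewrite lerBrDr ler_pdivlMr//; apply: le_trans l1; rewrite addrC.
by rewrite lerBlDr ler_pdivrMr//; apply: le_trans u1 _; rewrite addrC.
Qed.

End sandwich.

Section asymptotic_estimates.
Context {R : realType}.
Implicit Types e ep t : R.
Local Notation L n := (Num.sqrt (ln n%:R) : R).

Lemma near_sqrt_ln (M : R) : \forall n \near \oo, M <= L n.
Proof. by have [N _ HN] := sqrt_ln_large M; exists N. Qed.

Lemma near_gt0 : \forall n \near \oo, (0 < n)%N.
Proof. by exists 1%N. Qed.

Lemma sqr_sqrt_ln n : (0 < n)%N -> L n ^+ 2 = ln n%:R.
Proof. by move=> n0; rewrite sqr_sqrtr// ln_ge0// ler1n. Qed.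

Lemma near_powR_ln ep e : 0 < ep -> 0 < e -> \forall n \near \oo, (ln (n%:R : R)) `^ (- ep) <= e.
Proof.
move=> ep0 e0; near=> n.
have n0 : (0 < n)%N by near: n; exact: near_gt0.
pose M := (e^-1) `^ (ep^-1).
have M0 : 0 < M by rewrite powR_gt0 ?invr_gt0.
have LM : M + 1 <= L n by near: n; exact: near_sqrt_ln.
have Mln : M <= ln n%:R.
  rewrite -sqr_sqrt_ln// (le_trans _ (_ : L n <= _))//; first by rewrite (le_trans _ LM)// lerDl.
  by rewrite expr2 ler_peMl ?(le_trans _ LM)// ?lerDr ?addr_ge0 ?(ltW M0).
have h : e^-1 <= ln n%:R `^ ep.
  have -> : e^-1 = M `^ ep by rewrite /M -powRrM mulVf ?gt_eqF// powRr1// invr_ge0 ltW.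
  by apply: ge0_ler_powR; rewrite ?nnegrE ?(ltW ep0) ?(ltW M0)// (le_trans (ltW M0)).
rewrite powRN -[leRHS]invrK lef_pV2 ?posrE ?invr_gt0// powR_gt0//.
exact: lt_le_trans Mln.
Unshelve. all: by end_near. Qed.

Lemma near_ln_pow_over_sqrt e : 0 < e -> \forall n \near \oo, L n ^+ 3 / Num.sqrt n%:R <= e.
Proof.
move=> e0; have [K K0 EK] := @expR_gauss_le_pow R.
near=> n; have n0 : (0 < n)%N by near: n; exact: near_gt0.
have n0' : 0 < n%:R :> R by rewrite ltr0n.
have L1 : 1 <= L n by near: n; exact: near_sqrt_ln.
have LK : K / e <= L n by near: n; exact: near_sqrt_ln.
have L0 : 0 < L n by exact: lt_le_trans L1.
have EE : (Num.sqrt n%:R)^-1 = expR (- L n ^+ 2 / 2).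
  apply/eqP; rewrite -(@eqrXn2 _ 2) ?invr_ge0 ?sqrtr_ge0 ?expR_ge0//.
  rewrite exprVn sqr_sqrtr ?ler0n// -expRM_natl sqr_sqrt_ln//.
  by rewrite (_ : 2%:R * _ = - ln n%:R) ?expRN ?lnK//; field.
rewrite EE; apply: le_trans (ler_wpM2l _ (EK _ L1)) _; first by rewrite exprn_ge0// ltW.
have -> : L n ^+ 3 * (K * (L n)^-1 ^+ 24) = K * (L n)^-1 ^+ 21.
  rewrite (exprD _ 3 21) mulrCA [L n ^+ 3 * _]mulrA -exprMn divff ?gt_eqF//.
  by rewrite expr1n mul1r.
apply: le_trans (ler_wpM2l (ltW K0) (pow_inv_le L1 (isT : (0 < 21)%N))) _.
by rewrite ler_pdivrMr// mulrC -ler_pdivrMr.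
Unshelve. all: by end_near. Qed.

Lemma sqrt_ratio n : (0 < n)%N -> Num.sqrt (ln n%:R / n%:R) = L n / Num.sqrt n%:R.
Proof. by move=> n0; rewrite sqrtrM ?sqrtrV// ln_ge0// ler1n. Qed.

End asymptotic_estimates.

Section tail_equivalence.
Context d {T : measurableType d} {R : realType} (P : probability T R).
Variables (X : nat -> T -> R) (g : R -> R) (B : R).
Hypotheses (mX : forall i, measurable_fun setT (X i)) (mg : measurable_fun setT g).
Hypothesis Xindep : mutually_independent P X.
Hypothesis gB : forall x, `|g x| <= B.
Hypothesis Eg : forall i, \int[P]_w g (X i w) = 0.
Hypothesis Eg2 : forall i, \int[P]_w (g (X i w) ^+ 2) = 1.
Local Notation L n := (Num.sqrt (ln n%:R) : R).
Let W n w : R := (Num.sqrt n%:R)^-1 * \sum_(i < n) g (X i w).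

Let mW n : measurable_fun setT (W n).
Proof.
apply: measurable_funM => //; apply: measurable_sum => i.
exact: measurableT_comp.
Qed.

(** With [l^2 = ln n] and [l >= 1], [(C (1 + l))^2 / 2 <= 2 C^2 l^2], so [n^(- 2 C^2)] is below the
    Gaussian factor; the additional [1 / n] beats the polynomial denominator. *)
Lemma polynomial_tail_le (C r : R) : 0 <= C -> 0 < r ->
  \forall n \near \oo, 4 * expR (- ((2 * C ^+ 2 + 1) * ln n%:R)) <=
    r * (kap * expR (- (C * (1 + L n)) ^+ 2 / 2) / (1 + C * (1 + L n))).
Proof.
move=> C0 r0; have kp := @kap_gt0 R.
near=> n; have n0 : (0 < n)%N by near: n; exact: near_gt0.
have L1 : 1 <= L n by near: n; exact: near_sqrt_ln.
have LM : 4 * (1 + 2 * C) / (r * kap) <= L n by near: n; exact: near_sqrt_ln.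
have := sqr_sqrt_ln (R := R) n0; move: (L n) L1 LM => l L1 LM <-.
have l0 : 0 < l by exact: lt_le_trans L1.
have Hl : C * (1 + l) <= 2 * C * l by rewrite -mulrA mulrCA ler_wpM2l//; lra.
have H0 : 0 <= C * (1 + l) by rewrite mulr_ge0// addr_ge0// ltW.
have e1 : expR (- (2 * C ^+ 2 * l ^+ 2)) <= expR (- (C * (1 + l)) ^+ 2 / 2).
  rewrite ler_expR mulNr lerN2 ler_pdivrMr// (_ : 2 * _ * _ * _ = (2 * C * l) ^+ 2); last by ring.
  by rewrite lerXn2r// ?nnegrE// !mulr_ge0// ltW.
have e2 : expR (- l ^+ 2) <= (l ^+ 2)^-1.
  by rewrite expRN lef_pV2 ?posrE ?expR_gt0 ?exprn_gt0// (le_trans _ (expR_ge1Dx _))// lerDr.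
have -> : - ((2 * C ^+ 2 + 1) * l ^+ 2) = - (2 * C ^+ 2 * l ^+ 2) + - l ^+ 2 by ring.
rewrite expRD.
have h1 : 1 + C * (1 + l) <= (1 + 2 * C) * l by rewrite mulrDl mul1r lerD.
have p1 : 0 < 1 + C * (1 + l) by rewrite ltr_wpDr.
have h2 : 4 * expR (- l ^+ 2) * (1 + C * (1 + l)) <= r * kap.
  apply: (@le_trans _ _ (4 * (l ^+ 2)^-1 * ((1 + 2 * C) * l))).
    by apply: ler_pM => //; rewrite ?mulr_ge0 ?expR_ge0 ?(ltW p1)// ler_wpM2l.
  rewrite (_ : 4 * _ * _ = (4 * (1 + 2 * C)) / l); last by field; rewrite gt_eqF.
  by move: LM; rewrite (ler_pdivrMr _ _ (mulr_gt0 r0 kp)) => LM; rewrite ler_pdivrMr// (mulrC _ l).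
move: (expR (- _ ^+ 2 / 2)) (expR (- (2 * _ * _))) (expR (- l ^+ 2)) (1 + C * (1 + l))
  (expR_ge0 (- (2 * C ^+ 2 * l ^+ 2))) e1 h2 p1 (expR_ge0 (- l ^+ 2)).
move=> E a b D a0 aE h2 D0 b0.
rewrite (_ : r * _ = E * (r * kap) / D); last by ring.
rewrite ler_pdivlMr// (_ : 4 * _ * D = a * (4 * b * D)); last by ring.
by apply: ler_pM => //; rewrite !mulr_ge0// ltW.
Unshelve. all: by end_near. Qed.

(** [S] is any event between [x < Y] and [x <= Y], so that one statement serves both the strict
    upper tail and, after a change of sign, the distribution function at [- x]. *)
Lemma tail_equivalence (Y : nat -> T -> R) :
  (forall M eta, 0 < M -> 0 < eta -> \forall n \near \oo, exists Bad : set T,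
     [/\ measurable Bad, fine (P Bad) <= 4 * expR (- (M * ln n%:R)) &
       forall w, ~ Bad w -> `|Y n w - W n w| <= eta / L n]) ->
  forall cc A e : R, 0 < cc -> 0 < A -> 0 < e -> \forall n \near \oo, forall x S,
    - A <= x -> x <= cc * L n -> measurable S ->
    (forall w, x < Y n w -> S w) -> (forall w, S w -> x <= Y n w) ->
    `|fine (P S) / (1 - Phi x) - 1| <= e.
Proof.
move=> approx cc A e cc0 A0 e0; have kp := @kap_gt0 R; have kp1 := @kap_le1 R.
(* Chosen so that [|x| + 1 <= A + cc L + 1 <= C (1 + L)] on the whole range. *)
pose C := A + cc + 1; have C0 : 0 < C by rewrite !addr_gt0.
have [r rE] : {r | r = Num.min 4^-1 (e / 15)} by eexists.
have r0 : 0 < r by rewrite rE lt_min invr_gt0 divr_gt0 ?andbT// ?ltr0n.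
have r4 : r <= 4^-1 by rewrite rE ge_min lexx.
have re : 15 * r <= e.
  by rewrite mulrC -ler_pdivlMr// rE ge_min lexx orbT.
have r14 : 0 < r <= 4^-1 by rewrite r0.
(* As [1 + C (1 + L) < 2 (1 + 2 C) L] for [L >= 1], this makes [eta / L] smaller than the admissible
   shift [th] below. *)
pose eta := r * kap / (2 * (1 + 2 * C)).
have eta0 : 0 < eta by rewrite divr_gt0 ?(mulr_gt0 r0 kp)// mulr_gt0// addr_gt0// mulr_gt0.
have M0 : 0 < 2 * C ^+ 2 + 1 by rewrite ltr_wpDl// mulr_ge0// exprn_ge0// ltW.
have [N1 N10 md] := moderate_deviation mX mg Xindep gB Eg Eg2 (ltW C0) r14.
near=> n.
have n0 : (0 < n)%N by near: n; exact: near_gt0.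
have L1 : 1 <= L n by near: n; exact: near_sqrt_ln.
have N1n : (N1 <= n)%N by near: n; exists N1.
have [Bad [mBad PBad offBad]] : exists Bad : set T,
  [/\ measurable Bad, fine (P Bad) <= 4 * expR (- ((2 * C ^+ 2 + 1) * ln n%:R)) &
       forall w, ~ Bad w -> `|Y n w - W n w| <= eta / L n].
  by near: n; exact: approx.
have small : 4 * expR (- ((2 * C ^+ 2 + 1) * ln n%:R)) <=
    r * (kap * expR (- (C * (1 + L n)) ^+ 2 / 2) / (1 + C * (1 + L n))).
  by near: n; apply: polynomial_tail_le => //; exact: ltW.
move=> x S Ax xcc mS YS SY; apply: le_trans re.
have L0 : 0 < L n by exact: lt_le_trans L1.
have [H HE] : {H | H = C * (1 + L n)} by eexists.
have H0 : 0 < H by rewrite HE mulr_gt0// addr_gt0.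
have H1 : 0 < 1 + H by rewrite addr_gt0.
pose th := r * kap / (1 + H).
have th0 : 0 <= th by rewrite divr_ge0 ?(ltW H1)// ltW// mulr_gt0.
have rk1 : r * kap <= 1.
  by rewrite mulr_ile1 ?(ltW r0) ?(ltW kp)//; apply: le_trans r4 _; rewrite invf_le1// ler1n.
have th1 : th <= 1.
  by rewrite ler_pdivrMr// mul1r (le_trans rk1)// lerDl ltW.
have xA : `|x| <= A + cc * L n.
  rewrite ler_norml; apply/andP; split; last by rewrite (le_trans xcc)// lerDr ltW.
  by rewrite (le_trans _ Ax)// lerN2 lerDl mulr_ge0// ltW.
have xH : `|x| + th <= H.
  apply: le_trans (lerD xA th1) _; rewrite HE /C.
  have : 0 <= A * L n by rewrite mulr_ge0// ltW.
  by lra.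
have etath : eta / L n < th.
  rewrite /eta /th -(mulrA _ (2 * _)^-1) -invfM ltr_pM2l ?(mulr_gt0 r0 kp)//.
  rewrite ltf_pV2 ?posrE// ?(mulr_gt0 _ L0) ?mulr_gt0 ?addr_gt0 ?mulr_gt0//.
  rewrite HE; have : 0 <= C * (L n - 1) by rewrite mulr_ge0// ?subr_ge0// ltW.
  by move: (L n) L1 => l L1; lra.
apply: (@tail_sandwich _ _ _ P (W n) S Bad x th r H) => //.
- by rewrite /th divfK ?gt_eqF// mulfK ?gt_eqF.
- apply: le_trans PBad (le_trans small _); rewrite ler_wpM2l ?(ltW r0)//.
  rewrite -HE; apply: Phi_tail_ge_le; apply: le_trans xH; by rewrite lerDl.
- move=> y yx; apply: md => //; rewrite -HE; apply: le_trans xH.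
  by rewrite -[y](subrK x) addrC (le_trans (ler_normD _ _))// lerD2l.
- move=> w /offBad/le_lt_trans/(_ etath); rewrite ltr_distl => /andP[_ YW] Sw.
  by rewrite ltrBlDr (le_lt_trans (SY _ Sw)).
- move=> w /offBad/le_lt_trans/(_ etath); rewrite ltr_distl => /andP[WY _] xW.
  by apply: YS; rewrite (lt_trans _ WY)// ltrBrDr.
Unshelve. all: by end_near. Qed.

End tail_equivalence.

(** Powers counted in the abstract: [s] is [sqrt n], [l] is [sqrt (ln n)], [S] the sum of
    [|c - c0|], [G] the quantile bound, [V] the quantile increments of the strips, [pe] and [pe']
    the powers of [ln n] with exponents [- eps] and [- eps']. Multiplied by [s l], the terms from
    (iv) and (ii) leave [pe'] and [pe], the quadratic one [l^3 / s]. *)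
Lemma scaled_remainder_le (R : realType) (s l S G V D B C K2 K4 M t pe pe' eta x y N dl : R) :
  N = s ^+ 2 -> dl = t * (l / s) ->
  0 < s -> 0 < l -> 0 <= S -> 0 <= B -> 0 <= t -> 0 <= M ->
  S <= K4 * (pe' * (s / l)) -> 0 <= G <= M -> V <= 4 * K2 * (l ^- 2 * pe) ->
  K4 * M * pe' + 8 * B * t * K2 * pe + C * t ^+ 2 * D * (l ^+ 3 / s) <= eta ->
  `|x - N^-1 * y| <= N^-1 * S * G + (2 * B * dl * V + C * dl ^+ 2 * D) ->
  `|s * x - s^-1 * y| <= eta / l.
Proof.
move=> -> -> s0 l0 S0 B0 t0 M0 S1 /andP[G0 GM] V1 small bound.
have sn0 : s != 0 by rewrite gt_eqF.
have ln0 : l != 0 by rewrite gt_eqF.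
have -> : s * x - s^-1 * y = s * (x - (s ^+ 2)^-1 * y) by field.
rewrite normrM (gtr0_norm s0) ler_pdivlMr//.
apply: le_trans small; apply: le_trans (ler_wpM2r (ltW l0) (ler_wpM2l (ltW s0) bound)) _.
have -> : s * ((s ^+ 2)^-1 * S * G + (2 * B * (t * (l / s)) * V + C * (t * (l / s)) ^+ 2 * D)) * l =
  l / s * (S * G) + 2 * B * t * l ^+ 2 * V + C * t ^+ 2 * D * (l ^+ 3 / s) by field.
rewrite lerD2r; apply: lerD.
  apply: (@le_trans _ _ (l / s * (K4 * (pe' * (s / l)) * M))).
    by rewrite ler_wpM2l ?divr_ge0 ?(ltW s0) ?(ltW l0)// ler_pM.
  by rewrite le_eqVlt; apply/orP; left; apply/eqP; field; apply/andP.
apply: (@le_trans _ _ (2 * B * t * l ^+ 2 * (4 * K2 * (l ^- 2 * pe)))).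
  by rewrite ler_wpM2l// !mulr_ge0// ltW.
by rewrite le_eqVlt; apply/orP; left; apply/eqP; field.
Qed.

Section near_remainder.
Context d {T : measurableType d} {R : realType} (P : probability T R).
Variables (X : nat -> T -> R) (F h : R -> R) (C B : R).
Hypothesis mX : forall i, measurable_fun setT (X i).
Hypothesis XF : common_cdf P X F.
Hypothesis hB : forall u, `|h u| <= B.
Hypothesis hC : forall u v, `|h u - h v| <= C * `|u - v|.
Variables (k m : nat -> nat) (c : nat -> nat -> R) (J : R -> R) (al be r0 : R).
Hypothesis kmn : forall n, (0 < n)%N -> (k n < n - m n)%N.
Hypotheses (al0 : 0 < al) (albe : al <= be) (be1 : be < 1).
Hypotheses (r00 : 0 < r0) (Jh : forall u, al - r0 <= u <= be + r0 -> J u = h u).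
Local Notation L n := (Num.sqrt (ln n%:R) : R).
Local Notation Q := (Finv F).
Local Notation dist n := (Num.sqrt (ln n%:R / n%:R) : R).
Local Notation infl := (influence F h (Q al) (Q be)).
Variables eps eps' K2 K3 K4 t : R.
Hypotheses (eps0 : 0 < eps) (eps'0 : 0 < eps').
Hypotheses (K20 : 0 <= K2) (K3t : K3 <= t) (K40 : 0 <= K4) (t0 : 0 < t).
Hypothesis Q_al : forall s, `|s| = 2 * t -> \forall n \near \oo,
  `|Q (al + s * dist n) - Q al| <= K2 * (ln n%:R) `^ (- (1 + eps)).
Hypothesis Q_be : forall s, `|s| = 2 * t -> \forall n \near \oo,
  `|Q (be + s * dist n) - Q be| <= K2 * (ln n%:R) `^ (- (1 + eps)).
Hypothesis km : \forall n \near \oo,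
  `|(k n)%:R / n%:R - al| <= K3 * dist n /\ `|1 - (m n)%:R / n%:R - be| <= K3 * dist n.
Hypothesis c_c0 : \forall n \near \oo,
  \sum_(k n + 1 <= i < (n - m n).+1) `|c i n - c0 J i n|
       <= K4 * ((ln n%:R) `^ (- eps') * Num.sqrt (n%:R / ln n%:R)).

Lemma near_dist e : 0 < e -> \forall n \near \oo, dist n <= e.
Proof.
move=> e0; near=> n.
have n0 : (0 < n)%N by near: n; exact: near_gt0.
have L1 : 1 <= L n by near: n; exact: near_sqrt_ln.
rewrite sqrt_ratio//.
apply: (@le_trans _ _ (L n ^+ 3 / Num.sqrt n%:R)).
  by rewrite ler_wpM2r ?invr_ge0 ?sqrtr_ge0// ler_eXnr.
by near: n; exact: near_ln_pow_over_sqrt.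
Unshelve. all: by end_near. Qed.

Lemma near_bound k1 k2 k3 eta : 0 <= k1 -> 0 <= k2 -> 0 <= k3 -> 0 < eta ->
  \forall n \near \oo, k1 * (ln (n%:R : R)) `^ (- eps') + k2 * (ln (n%:R : R)) `^ (- eps) +
    k3 * (L n ^+ 3 / Num.sqrt n%:R) <= eta.
Proof.
move=> k10 k20 k30 eta0.
have small (a : R) : 0 <= a -> 0 < eta / 3 / (a + 1).
  by move=> a0; rewrite !divr_gt0 ?ltr_wpDl.
have mul_small (a b : R) : 0 <= a -> b <= eta / 3 / (a + 1) -> a * b <= eta / 3.
  move=> a0 ab; have a1 : 0 < a + 1 by rewrite ltr_wpDl.
  apply: le_trans (ler_wpM2l a0 ab) _.
  by rewrite mulrCA ler_piMr ?divr_ge0 ?(ltW eta0)// ler_pdivrMr// mul1r lerDl.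
near=> n.
have -> : eta = eta / 3 + eta / 3 + eta / 3 by lra.
apply: lerD; [apply: lerD|]; apply: mul_small => //; near: n.
- exact/near_powR_ln/small.
- exact/near_powR_ln/small.
- exact/near_ln_pow_over_sqrt/small.
Unshelve. all: by end_near. Qed.

(** [remainder_bound] with [dl = t * dist n]. The strips reach [2 dl] to either side, which is why
    (ii) is used at [2 t] and [- 2 t], and [K3 <= t] puts the endpoints within [dl]. *)
Lemma near_remainder eta : 0 < eta -> \forall n \near \oo, forall w,
  (forall x, `|ecdf X n w x - F x| <= t * dist n) ->
  `|Num.sqrt n%:R * (Lstat X c k m n w - mu_n J F k m n) -
     (Num.sqrt n%:R)^-1 * \sum_(i < n) infl (X i w)| <= eta / L n.
Proof.
move=> eta0.
have mh := lipschitz_measurable hC.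
have aux1 (x y : R) : 4 * y <= x -> 0 < x -> 0 < x - 2 * y by lra.
have aux2 (x y : R) : 4 * y <= 1 - x -> x < 1 -> x + 2 * y < 1 by lra.
have aux3 (x y z u v s: R) : - y <= x - z -> v - u <= y -> y <= s -> forall p, x <= p <= v -> z - s <= p <= u + s.
  by move=> ? ? ? p /andP[? ?]; apply/andP; split; lra.
have B0 : 0 <= B by apply: le_trans (hB 0).
have C0 : 0 <= C by have := hC 1 0; rewrite subr0 normr1 mulr1; apply: le_trans.
have D0 : 0 <= Q be - Q al.
  by rewrite subr_ge0; exact: (Finv_homo mX XF).
have aux4 (q q1 q2 q3 p : R) : p <= 1 -> `|q1 - q| <= K2 * p -> `|q3 - q2| <= K2 * p ->
    `|q1| + `|q3| <= `|q| + `|q2| + 2 * K2.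
  move=> p1 h1 h2; have := ler_wpM2l K20 p1; have := ler_normD (q1 - q) q.
  by have := ler_normD (q3 - q2) q2; rewrite !subrK; lra.
have aux5 (q q1 q2 q3 q4 q5 p : R) : `|q1 - q| <= p -> `|q2 - q| <= p -> `|q4 - q3| <= p ->
    `|q5 - q3| <= p -> (q1 - q2) + (q4 - q5) <= 4 * p.
  by rewrite !ler_norml => /andP[? ?] /andP[? ?] /andP[? ?] /andP[? ?]; lra.
have st : `|2 * t| = 2 * t by rewrite ger0_norm// mulr_ge0// ltW.
have st' : `|- (2 * t)| = 2 * t by rewrite normrN.
have M0 : 0 <= `|Q al| + `|Q be| + 2 * K2 by rewrite !addr_ge0// mulr_ge0.
have k10 := mulr_ge0 K40 M0.
have k20 : 0 <= 8 * B * t * K2 by rewrite !mulr_ge0// ltW.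
have k30 : 0 <= C * t ^+ 2 * (Q be - Q al) by rewrite !mulr_ge0// ltW.
near=> n => w Gw.
have n0 : (0 < n)%N by near: n; exact: near_gt0.
have L1 : 1 <= L n by near: n; exact: near_sqrt_ln.
have qa1 : `|Q (al + 2 * t * dist n) - Q al| <= K2 * (ln n%:R) `^ (- (1 + eps)).
  by near: n; exact: Q_al.
have qa2 : `|Q (al + - (2 * t) * dist n) - Q al| <= K2 * (ln n%:R) `^ (- (1 + eps)).
  by near: n; exact: Q_al.
have qb1 : `|Q (be + 2 * t * dist n) - Q be| <= K2 * (ln n%:R) `^ (- (1 + eps)).
  by near: n; exact: Q_be.
have qb2 : `|Q (be + - (2 * t) * dist n) - Q be| <= K2 * (ln n%:R) `^ (- (1 + eps)).
  by near: n; exact: Q_be.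
have [ka ma] : `|(k n)%:R / n%:R - al| <= K3 * dist n /\ `|1 - (m n)%:R / n%:R - be| <= K3 * dist n.
  by near: n.
have cc0 : \sum_(k n + 1 <= i < (n - m n).+1) `|c i n - c0 J i n|
       <= K4 * ((ln n%:R) `^ (- eps') * Num.sqrt (n%:R / ln n%:R)) by near: n.
have small : (K4 * (`|Q al| + `|Q be| + 2 * K2)) * (ln (n%:R : R)) `^ (- eps') +
    (8 * B * t * K2) * (ln (n%:R : R)) `^ (- eps) +
    (C * t ^+ 2 * (Q be - Q al)) * (L n ^+ 3 / Num.sqrt n%:R) <= eta.
  by near: n; exact: near_bound.
have d1 : dist n <= al / (4 * t) by near: n; apply: near_dist; rewrite divr_gt0// mulr_gt0.
have d2 : dist n <= (1 - be) / (4 * t) by near: n; apply: near_dist; rewrite divr_gt0 ?subr_gt0// mulr_gt0.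
have d3 : dist n <= r0 / t by near: n; apply: near_dist; rewrite divr_gt0.
have [dl dlE] : {dl | dl = t * dist n} by eexists.
rewrite -dlE in Gw.
have ds0 : 0 <= dist n by exact: sqrtr_ge0.
have K3dl : K3 * dist n <= dl by rewrite dlE ler_wpM2r.
have aal := le_trans ka K3dl; have bbe := le_trans ma K3dl.
have f1 : 4 * dl <= al by move: d1; rewrite ler_pdivlMr ?mulr_gt0// dlE [_ * (4 * t)]mulrC -mulrA.
have f2 : 4 * dl <= 1 - be by move: d2; rewrite ler_pdivlMr ?mulr_gt0// dlE [_ * (4 * t)]mulrC -mulrA.
have f3 : dl <= r0 by move: d3; rewrite ler_pdivlMr// dlE [_ * t]mulrC.
have a2 := aux1 _ _ f1 al0; have b2 := aux2 _ _ f2 be1.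
have Jhn u : (k n)%:R / n%:R <= u <= 1 - (m n)%:R / n%:R -> J u = h u.
  move: aal bbe; rewrite !ler_norml => /andP[x1 _] /andP[_ x2] u1.
  by apply: Jh; exact: aux3 x1 x2 f3 _ u1.
have Lsq := sqr_sqrt_ln (R := R) n0.
have L0 : 0 < L n by exact: lt_le_trans L1.
have ln0 : 0 < ln (n%:R : R) by rewrite -Lsq exprn_gt0.
have dE : dist n = L n / Num.sqrt n%:R by exact: sqrt_ratio.
have cE : Num.sqrt (n%:R / ln n%:R) = Num.sqrt n%:R / L n by rewrite sqrtrM ?ler0n// sqrtrV ?ltW.
have pE : (ln n%:R) `^ (- (1 + eps)) = (L n)^-2 * (ln (n%:R : R)) `^ (- eps).
  rewrite opprD powRD; last by rewrite (gt_eqF ln0) implybT.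
  by rewrite (powRN _ 1) powRr1 ?(ltW ln0)// Lsq.
have s0 : 0 < Num.sqrt (n%:R : R) by rewrite sqrtr_gt0 ltr0n.
have nE : (n%:R : R) = Num.sqrt n%:R ^+ 2 by rewrite sqr_sqrtr.
have p1 : (ln (n%:R : R)) `^ (- (1 + eps)) <= 1.
  rewrite powRN invf_le1 ?powR_gt0//.
  have := @ge0_ler_powR R (1 + eps) (addr_ge0 ler01 (ltW eps0)) 1 (ln n%:R).
  by rewrite powR1; apply; rewrite ?nnegrE ?(ltW ln0)// -Lsq exprn_ege1.
have p0 : 0 <= (ln (n%:R : R)) `^ (- eps') by exact: powR_ge0.
have p2 : 0 <= (ln (n%:R : R)) `^ (- eps) by exact: powR_ge0.
move: qa1 qa2 qb1 qb2; rewrite !mulNr -!mulrA -dlE => qa1 qa2 qb1 qb2.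
have bound := remainder_bound mX XF mh hB hC c n0 (kmn n0) albe aal bbe a2 b2 Jhn Gw.
apply: (scaled_remainder_le nE _ s0 L0 _ B0 (ltW t0) M0 _ _ _ small bound).
- by rewrite dlE dE.
- exact: sumr_ge0.
- by rewrite -cE.
- rewrite addr_ge0//=; exact: aux4 p1 qa2 qb1.
- by rewrite -pE -[leRHS]mulrA; exact: aux5 qa1 qa2 qb1 qb2.
Unshelve. all: by end_near. Qed.

End near_remainder.

(** [ecdf_uniform] with half of the allowed deviation; the other half covers its error [1 / n]. With
    [s = (t / 2) sqrt (ln n / n)] the exponent is [t^2 / (16 (1 + e)) * ln n], and the [+ 1] in
    [M + 1] pays for the union over [n] quantiles. *)
Lemma near_ecdf_dist d (T : measurableType d) (R : realType) (P : probability T R)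
    (X : nat -> T -> R) (F : R -> R) (M t : R) :
  (forall i, measurable_fun setT (X i)) -> common_cdf P X F -> mutually_independent P X ->
  2 <= t -> 16 * (1 + expR 1) * (M + 1) <= t ^+ 2 ->
  \forall n \near \oo, exists Bad : set T,
    [/\ measurable Bad, fine (P Bad) <= 4 * expR (- (M * ln n%:R)) &
     forall w, ~ Bad w -> forall x, `|ecdf X n w x - F x| <= t * Num.sqrt (ln n%:R / n%:R)].
Proof.
move=> mX XF Xindep t2 tM; have t0 : 0 < t by exact: lt_le_trans t2.
near=> n.
have n0 : (0 < n)%N by near: n; exact: near_gt0.
have n0' : 0 < n%:R :> R by rewrite ltr0n.
have L1 : 1 <= Num.sqrt (ln (n%:R : R)) by near: n; exact: near_sqrt_ln.
have dn : Num.sqrt (ln (n%:R : R) / n%:R) <= 2 / t.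
  by near: n; apply: near_dist; rewrite divr_gt0.
have ln0 : 0 <= ln (n%:R : R) by rewrite ln_ge0// ler1n.
have d2 : Num.sqrt (ln (n%:R : R) / n%:R) ^+ 2 = ln n%:R / n%:R.
  by rewrite sqr_sqrtr// divr_ge0// ltW.
have d0 : 0 <= Num.sqrt (ln (n%:R : R) / n%:R) by exact: sqrtr_ge0.
have dn1 : n%:R^-1 <= Num.sqrt (ln (n%:R : R) / n%:R).
  rewrite -(@ler_pXn2r _ 2) ?nnegrE ?invr_ge0 ?ler0n// d2 expr2.
  rewrite ler_wpM2r ?invr_ge0 ?ler0n// (@le_trans _ _ 1) ?invf_le1 ?ler1n//.
  by rewrite -sqr_sqrt_ln// exprn_ege1.
pose s := t / 2 * Num.sqrt (ln (n%:R : R) / n%:R).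
have s01 : 0 <= s <= 1.
  rewrite mulr_ge0 ?divr_ge0 ?(ltW t0)//=.
  by rewrite -[leRHS](@divff _ (t / 2 : R)) ?gt_eqF ?divr_gt0// ler_wpM2l ?divr_ge0 ?(ltW t0)// invf_div.
have [Bad [mBad PBad off]] := ecdf_uniform mX XF Xindep n0 s01.
exists Bad; split => //.
  apply: le_trans PBad _; rewrite mulrCA ler_wpM2l// /hoeffding_bound.
  rewrite -{1}(lnK (n0' : n%:R \is Num.pos)) -expRD ler_expR.
  have e0 : 0 < 1 + expR 1 :> R by rewrite addr_gt0// expR_gt0.
  rewrite /s exprMn d2.
  have -> : n%:R * ((t / 2) ^+ 2 * (ln n%:R / n%:R)) / (4 * (1 + expR 1)) =
      t ^+ 2 / (16 * (1 + expR 1)) * ln n%:R :> R.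
    by field; rewrite !gt_eqF.
  have a1 : M + 1 <= t ^+ 2 / (16 * (1 + expR 1)).
    by rewrite ler_pdivlMr ?mulr_gt0// mulrC.
  have := ler_wpM2r ln0 a1; rewrite mulrDl mul1r => a2.
  by rewrite lerNr opprD opprK addrC -lerBDr opprK.
move=> w Bw x; apply: le_trans (off w x Bw) _.
apply: le_trans (lerD (lexx _) dn1) _.
rewrite /s -[X in _ + X <= _]mul1r -mulrDl ler_wpM2r//; lra.
Unshelve. all: by end_near. Qed.


Theorem theorem1p1 (R : realType) (d : measure_display) (T : measurableType d)
  (P : probability T R) (X : nat -> T -> R) (F : R -> R)
  (k m : nat -> nat) (alpha beta : R) (c : nat -> nat -> R)
  (J : R -> R) (I : set R) (nu : {measure set R -> \bar R}) :
  (* X 0, X 1, ... (= the paper's X_1, X_2, ...) are i.i.d. with d.f. F *)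
  (forall i, measurable_fun setT (X i)) ->
  mutually_independent P X ->
  common_cdf P X F ->
  (* 0 <= k_n < n - m_n <= n *)
  (forall n, (0 < n)%N -> (k n < n - m n)%N) ->
  (fun n => (k n)%:R / n%:R : R) @ \oo --> alpha ->
  (fun n => (m n)%:R / n%:R : R) @ \oo --> beta ->
  0 < alpha -> alpha < 1 - beta -> 1 - beta < 1 ->
  (* J defined on an open I with [alpha, 1-beta] in I in (0,1) *)
  open I -> `[alpha, 1 - beta] `<=` I -> I `<=` `]0, 1[ ->
  (* (i) Lipschitz *)
  (exists C : R, 0 <= C /\ forall u v, I u -> I v -> `|J u - J v| <= C * `|u - v|) ->
  (* (ii) *)
  (exists eps : R, 0 < eps /\ forall t : R,
     (exists K : R, exists N : nat, forall n : nat, (N <= n)%N ->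
        `|Finv F (alpha + t * Num.sqrt (ln n%:R / n%:R)) - Finv F alpha|
          <= K * (ln n%:R) `^ (- (1 + eps))) /\
     (exists K : R, exists N : nat, forall n : nat, (N <= n)%N ->
        `|Finv F (1 - beta + t * Num.sqrt (ln n%:R / n%:R)) - Finv F (1 - beta)|
          <= K * (ln n%:R) `^ (- (1 + eps)))) ->
  (* (iii) *)
  (exists K : R, exists N : nat, forall n : nat, (N <= n)%N ->
     Num.max `|(k n)%:R / n%:R - alpha| `|(m n)%:R / n%:R - beta|
       <= K * Num.sqrt (ln n%:R / n%:R)) ->
  (* (iv) *)
  (exists eps' : R, 0 < eps' /\ exists K : R, exists N : nat, forall n : nat, (N <= n)%N ->
     \sum_(k n + 1 <= i < (n - m n).+1) `|c i n - c0 J i n|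
       <= K * ((ln n%:R) `^ (- eps') * Num.sqrt (n%:R / ln n%:R))) ->
  (* nu = dF^{-1}, the Lebesgue-Stieltjes measure of the left-continuous F^{-1} on (0,1) *)
  (forall a b : R, 0 < a -> a <= b -> b < 1 -> nu `[a, b[%classic = (Finv F b - Finv F a)%:E) ->
  (* sigma > 0 *)
  0 < sigma2 nu J alpha (1 - beta) ->
  forall cc A : R, 0 < cc -> 0 < A ->
  forall e : R, 0 < e -> exists N : nat, forall n : nat, (N <= n)%N ->
    forall x : R, - A <= x -> x <= cc * Num.sqrt (ln n%:R) ->
      `|(1 - FLn P X c k m J F (Num.sqrt (sigma2 nu J alpha (1 - beta))) n x)
          / (1 - Phi x) - 1| <= e /\
      `|FLn P X c k m J F (Num.sqrt (sigma2 nu J alpha (1 - beta))) n (- x)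
          / Phi (- x) - 1| <= e.
Proof.
move=> mX Xindep XF kmn _ _ al0 albe' be1 oI abI I01 [C [C0 JC]] [eps [eps0 Qlim]] [K3 [N3 HK3]]
  [eps' [eps'0 [K4 [N4 HK4]]]] nuQ sig0 cc A cc0 A0 e e0.
have km : \forall n \near \oo, `|(k n)%:R / n%:R - alpha| <= K3 * Num.sqrt (ln n%:R / n%:R) /\
    `|1 - (m n)%:R / n%:R - (1 - beta)| <= K3 * Num.sqrt (ln n%:R / n%:R).
  exists N3 => // n /HK3; rewrite ge_max => /andP[h1 h2]; split => //.
  by rewrite (_ : _ - (1 - beta) = - ((m n)%:R / n%:R - beta)) ?normrN//; ring.
have c_c0 : \forall n \near \oo, \sum_(k n + 1 <= i < (n - m n).+1) `|c i n - c0 J i n| <=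
    `|K4| * ((ln n%:R) `^ (- eps') * Num.sqrt (n%:R / ln n%:R)).
  exists N4 => // n /HK4/le_trans; apply; rewrite ler_wpM2r ?ler_norm//.
  by rewrite mulr_ge0 ?powR_ge0 ?sqrtr_ge0.
move: (1 - beta) albe' be1 abI Qlim km sig0 => be albe' be1 abI Qlim km sig0.
have albe := ltW albe'.
have [h [B [r0 [r00 hB hC Jh]]]] := lipschitz_extension oI abI I01 albe C0 JC.
have mh := lipschitz_measurable hC.
pose infl := influence F h (Finv F alpha) (Finv F be).
have approx M eta : 0 < M -> 0 < eta -> \forall n \near \oo, exists Bad : set T,
    [/\ measurable Bad, fine (P Bad) <= 4 * expR (- (M * ln n%:R)) &
     forall w, ~ Bad w -> `|Num.sqrt n%:R * (Lstat X c k m n w - mu_n J F k m n) -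
       (Num.sqrt n%:R)^-1 * \sum_(i < n) infl (X i w)| <= eta / Num.sqrt (ln n%:R)].
  move=> M0 eta0.
  (* [K3] accommodates (iii), 2 and the last entry are for [near_ecdf_dist]; since [t >= 1], a lower
     bound on [t] is one on [t^2]. *)
  pose t := Num.max (Num.max 2 K3) (16 * (1 + expR 1) * (M + 1)).
  have t2 : 2 <= t by rewrite !le_max lexx.
  have K3t : K3 <= t by rewrite !le_max lexx orbT.
  have t0 : 0 < t by exact: lt_le_trans t2.
  have tM : 16 * (1 + expR 1) * (M + 1) <= t ^+ 2.
    apply: (@le_trans _ _ t); first by rewrite !le_max lexx orbT.
    by rewrite ler_eXnr// (le_trans _ t2)// ler1n.
  have [[Ka1 [na1 Ha1]] [Kb1 [nb1 Hb1]]] := Qlim (2 * t).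
  have [[Ka2 [na2 Ha2]] [Kb2 [nb2 Hb2]]] := Qlim (- (2 * t)).
  pose K2 := Num.max (Num.max `|Ka1| `|Kb1|) (Num.max `|Ka2| `|Kb2|).
  have K20 : 0 <= K2 by rewrite !le_max normr_ge0.
  have weaken K u n : K <= K2 -> u <= K * (ln n%:R) `^ (- (1 + eps)) ->
      u <= K2 * (ln n%:R) `^ (- (1 + eps)).
    by move=> KK2 /le_trans; apply; rewrite ler_wpM2r// powR_ge0.
  have K2s : [/\ Ka1 <= K2, Kb1 <= K2, Ka2 <= K2 & Kb2 <= K2].
    by rewrite /K2 !le_max !ler_norm ?orbT.
  have [ka1 kb1 ka2 kb2] := K2s.
  have sE (s : R) : `|s| = 2 * t -> s = 2 * t \/ s = - (2 * t).
    by move=> sn; case: (ger0P s) sn => _ sn; [left|right; rewrite -sn opprK].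
  have Qa s : `|s| = 2 * t -> \forall n \near \oo,
      `|Finv F (alpha + s * Num.sqrt (ln n%:R / n%:R)) - Finv F alpha| <= K2 * (ln n%:R) `^ (- (1 + eps)).
    by case/sE => ->; [exists na1 => // n /Ha1|exists na2 => // n /Ha2]; exact: weaken.
  have Qb s : `|s| = 2 * t -> \forall n \near \oo,
      `|Finv F (be + s * Num.sqrt (ln n%:R / n%:R)) - Finv F be| <= K2 * (ln n%:R) `^ (- (1 + eps)).
    by case/sE => ->; [exists nb1 => // n /Hb1|exists nb2 => // n /Hb2]; exact: weaken.
  have rem := near_remainder mX XF hB hC kmn al0 albe be1 r00 Jh eps0 eps'0 K20 K3t
    (normr_ge0 K4) t0 Qa Qb km c_c0 eta0.
  near=> n.
  have [Bad [mBad PBad off]] : exists Bad : set T,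
    [/\ measurable Bad, fine (P Bad) <= 4 * expR (- (M * ln n%:R)) &
     forall w, ~ Bad w -> forall x, `|ecdf X n w x - F x| <= t * Num.sqrt (ln n%:R / n%:R)].
    by near: n; exact: near_ecdf_dist.
  exists Bad; split => // w /off.
  by move: w; near: n; exact: rem.
have bi := bmf_influence mX XF mh hB (Finv F alpha) (Finv F be).
have [mi [Bi iB]] := bi.
have biX i : bmf (fun w => infl (X i w)) by split; [exact: measurableT_comp|exists Bi].
have Ei i : \int[P]_w infl (X i w) = 0 by exact: (E_influence mX XF mh hB).
have Ei2 i : \int[P]_w (infl (X i w) ^+ 2) = sigma2 nu J alpha be.
  apply: (E_influence2_sigma2 mX XF mh hB nuQ) => // u.
  rewrite /= in_itv/= => /andP[u1 u2]; apply: Jh.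
  by rewrite (le_trans _ u1) ?gerBl ?(ltW r00)// (le_trans (ltW u2))// lerDl ltW.
(* The scale [a] will be both signs of the inverse standard deviation: the positive one gives the
   upper tail, the negative one the lower tail. *)
have tail a : a ^+ 2 * sigma2 nu J alpha be = 1 -> \forall n \near \oo, forall x S,
    - A <= x -> x <= cc * Num.sqrt (ln n%:R) -> measurable S ->
    (forall w, x < a * (Num.sqrt n%:R * (Lstat X c k m n w - mu_n J F k m n)) -> S w) ->
    (forall w, S w -> x <= a * (Num.sqrt n%:R * (Lstat X c k m n w - mu_n J F k m n))) ->
    `|fine (P S) / (1 - Phi x) - 1| <= e.
  move=> a1.
  have a0 : 0 < `|a|.
    by rewrite normr_gt0; apply/eqP => az; move/eqP: a1; rewrite az expr0n mul0r eq_sym oner_eq0.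
  apply: (@tail_equivalence _ _ _ P X (fun z => a * infl z) (`|a| * Bi)) => //.
  - exact: measurable_funM.
  - by move=> x; rewrite normrM ler_wpM2l.
  - by move=> i; rewrite EbmfZ// Ei mulr0.
  - move=> i; rewrite -a1 -(Ei2 i) -EbmfZ; last exact: bmfM.
    by congr Rintegral; apply/funext => w /=; rewrite exprMn.
  move=> M eta M0 eta0.
  apply: filterS (approx M (eta / `|a|) M0 (divr_gt0 eta0 a0)) => n [Bad [mB PB off]].
  exists Bad; split => // w /off wB.
  rewrite -mulr_sumr [X in _ - X]mulrCA -mulrBr normrM -ler_pdivlMl// mulrA.
  by rewrite [_ * eta]mulrC.
have s0 : 0 < Num.sqrt (sigma2 nu J alpha be) by rewrite sqrtr_gt0.
have sq1 : (Num.sqrt (sigma2 nu J alpha be))^-1 ^+ 2 * sigma2 nu J alpha be = 1.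
  by rewrite exprVn sqr_sqrtr ?(ltW sig0)// mulVf// gt_eqF.
have tail1 := tail _ sq1; have tail2 := tail _ (etrans (congr1 (fun z => z * _) (sqrrN _)) sq1).
have [N _ HN] : \forall n \near \oo, forall x : R, - A <= x -> x <= cc * Num.sqrt (ln n%:R) ->
      `|(1 - FLn P X c k m J F (Num.sqrt (sigma2 nu J alpha be)) n x) / (1 - Phi x) - 1| <= e /\
      `|FLn P X c k m J F (Num.sqrt (sigma2 nu J alpha be)) n (- x) / Phi (- x) - 1| <= e.
  apply: filterS2 tail1 tail2 => n t1 t2.
  pose Y w := Num.sqrt n%:R * (Lstat X c k m n w - mu_n J F k m n) / Num.sqrt (sigma2 nu J alpha be).
  have mY : measurable_fun setT Y.
    apply: measurable_funM => //; apply: measurable_funM => //; apply: measurable_funB => //.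
    exact: measurable_Lstat.
  have mle y : measurable [set w | Y w <= y].
    rewrite (_ : [set w | _] = Y @^-1` `]-oo, y]%classic).
      by rewrite -[X in measurable X]setTI; exact: mY.
    by apply/seteqP; split => w /=; rewrite in_itv.
  move=> x Ax xcc; split.
    have -> : 1 - FLn P X c k m J F (Num.sqrt (sigma2 nu J alpha be)) n x = fine (P (~` [set w | Y w <= x])).
      by rewrite probability_setC// fineB ?fin_num_measure.
    have tl : forall S, measurable S -> (forall w, x < Y w -> S w) -> (forall w, S w -> x <= Y w) ->
        `|fine (P S) / (1 - Phi x) - 1| <= e.
      move=> S mS h1 h2; have := t1 x S Ax xcc mS; apply.
      - by move=> w; rewrite mulrC; exact: h1.
      - by move=> w /h2; rewrite mulrC.
    apply: tl; first exact: measurableC.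
    - by move=> w xY /=; apply/negP; rewrite -ltNge.
    - by move=> w /negP; rewrite -ltNge => /ltW.
  (* The event [Y <= - x] is the non-strict upper tail of [- Y] at [x]. *)
  have := t2 x [set w | Y w <= - x] Ax xcc (mle _); rewrite PhiN; apply.
  - by move=> w; rewrite mulNr mulrC ltrNr => /ltW.
  - by move=> w; rewrite mulNr mulrC lerNr.
by exists N.
Unshelve. all: by end_near. Qed.
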